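(* Let $(u_{ex},f_{ex})$ be an exact solution of the inverse problem (1)–(4) described in the context, corresponding to the exact data $I_{ex}=(\varphi_{ex},X^{ex},u_0^{ex},u_0^{*ex},u_T^{ex})$, and assume $$u_{ex}\in (C^2([0,T];L^2(\Omega))\cap L^2(0,T;H^2(\Omega)))^2,\quad f_{ex}=(f_{1ex},f_{2ex})\in (L^2(\Omega))^2,\quad \varphi_{ex}\in L^1(0,T)\setminus\{0\}.$$ Assume in addition that $$\int_{\mathbb R^2}\left|\int_\Omega f_{jex}(x)\cos(\alpha\cdot x)\,dx\right|d\alpha<\infty,\qquad\forall j\in\{1,2\}.$$ For each $\varepsilon\in(0,e^{-1})$ let $I_\varepsilon=(\varphi,X,u_0,u_0^*,u_T)$ be data (depending on $\varepsilon$) such that $\|\varphi-\varphi_{ex}\|_{L^1(0,T)}\le\varepsilon$ and, for $j\in\{1,2\}$, $$\|X_j-X_j^{ex}\|_{L^1(0,T;L^1(\partial\Omega))}\le\varepsilon,\quad \|u_{0j}-u_{0j}^{ex}\|_{L^1(\Omega)}\le\varepsilon,\quad \|u_{0j}^*-u_{0j}^{*ex}\|_{L^1(\Omega)}\le\varepsilon,\quad \|u_{Tj}-u_{Tj}^{ex}\|_{L^1(\Omega)}\le\varepsilon .$$ Let $f_\varepsilon=(f_{1\varepsilon},f_{2\varepsilon})$ be the regularized solution constructed from $I_\varepsilon$ as in the context, i.e. the function whose Fourier transform is $$F(f_{j\varepsilon})(\alpha)=\chi_{B(0,R_\varepsilon)}(\alpha)\,\frac{g_j(I_\varepsilon)(\alpha)\,D(I_\varepsilon)(\alpha)}{\delta_\varepsilon+(D(I_\varepsilon)(\alpha))^2},\qquad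 \alpha\in\mathbb R^2\setminus\{0\}.$$ Then $f_\varepsilon\in (C(\overline\Omega))^2$ and $$\lim_{\varepsilon\to0}\|f_{j\varepsilon}-f_{jex}\|_{L^\infty(\Omega)}=0,\qquad \forall j\in\{1,2\}.$$
   Context: Setting. $\Omega=(0,1)\times(0,1)$, $T>0$, and $\lambda,\mu$ are real constants with $\mu>0$ and $\lambda+2\mu>0$; $n=(n_1,n_2)$ is the outward unit normal of $\partial\Omega$; $d\omega$ is the surface (arc length) measure on $\partial\Omega$; all functions are real-valued; $\xi\cdot\zeta$ and $|\xi|$ are the Euclidean inner product and norm on $\mathbb R^2$. Data. Data are $I=(\varphi,X,u_0,u_0^*,u_T)$ with $\varphi\in L^1(0,T)$, $X=(X_1,X_2)\in (L^1(0,T;L^1(\partial\Omega)))^2$, and $u_0=(u_{01},u_{02})$, $u_0^*=(u_{01}^*,u_{02}^* )$, $u_T=(u_{T1},u_{T2})$ in $(L^1(\Omega))^2$. Inverse problem (1)–(4). A pair $(u,f)$, $u=(u_1,u_2)(x,t)$, $f=(f_1,f_2)(x)$, satisfies (1)–(4) corresponding to the data $I$ if: (1) $\dfrac{\partial^2u_j}{\partial t^2}=\mu\Delta u_j+(\lambda+\mu)\dfrac{\partial}{\partial x_j}\mathrm{div}(u)+\varphi(t)f_j(x)$ in $\Omega\times(0,T)$, $j\in\{1,2\}$; (2) $u(x,t)=(0,0)$ for $x\in\partial\Omega$, $t\in(0,T)$; (3) $u(x,0)=u_0(x)$, $\dfrac{\partial u}{\partial t}(x,0)=u_0^*(x)$,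 $u(x,T)=u_T(x)$ in $\Omega$; (4) $n_1\sigma_1+n_2\tau=X_1$ and $n_2\sigma_2+n_1\tau=X_2$ on $\partial\Omega\times(0,T)$, where $\tau=\mu\left(\frac{\partial u_1}{\partial x_2}+\frac{\partial u_2}{\partial x_1}\right)$ and $\sigma_j=\lambda\,\mathrm{div}(u)+2\mu\frac{\partial u_j}{\partial x_j}$. The functions $D(I)$ and $g_j(I)$. For data $I$ and $\alpha=(\alpha_1,\alpha_2)\in\mathbb R^2\setminus\{0\}$ put $$D_1(I)=\int_0^T\varphi(T-t)\sin(\sqrt{\lambda+2\mu}\,|\alpha|t)\,dt,\qquad D_2(I)=\int_0^T\varphi(T-t)\sin(\sqrt{\mu}\,|\alpha|t)\,dt,$$ $$D(I)=D_1(I)D_2(I),\qquad g_j(I)=\frac{2}{|\alpha|^2}\left(\alpha_jD_2(I)h_0(I)+D_1(I)h_j(I)\right),\ j\in\{1,2\},$$ where $$\begin{aligned}h_0(I)=&-\sin(\sqrt{\lambda+2\mu}|\alpha|T)\int_\Omega(\alpha\cdot u_0^* )\cos(\alpha\cdot x)dx+\sqrt{\lambda+2\mu}\,|\alpha|\int_\Omega(\alpha\cdot u_T)\cos(\alpha\cdot x)dx\\&-\sqrt{\lambda+2\mu}\,|\alpha|\cos(\sqrt{\lambda+2\mu}|\alpha|T)\int_\Omega(\alpha\cdot u_0)\cos(\alpha\cdot x)dx\\&-\int_0^T\int_{\partial\Omega}\sin(\sqrt{\lambda+2\mu}|\alpha|(T-t))(\alpha\cdot X)\cos(\alpha\cdot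 x)\,d\omega\,dt,\end{aligned}$$ $$\begin{aligned}h_j(I)=&-\sin(\sqrt\mu|\alpha|T)\int_\Omega(|\alpha|^2u_{0j}^*-\alpha_j(\alpha\cdot u_0^* ))\cos(\alpha\cdot x)dx\\&+\sqrt\mu\,|\alpha|\int_\Omega(|\alpha|^2u_{Tj}-\alpha_j(\alpha\cdot u_T))\cos(\alpha\cdot x)dx\\&-\sqrt\mu\,|\alpha|\cos(\sqrt\mu|\alpha|T)\int_\Omega(|\alpha|^2u_{0j}-\alpha_j(\alpha\cdot u_0))\cos(\alpha\cdot x)dx\\&-\int_0^T\int_{\partial\Omega}\sin(\sqrt\mu|\alpha|(T-t))(|\alpha|^2X_j-\alpha_j(\alpha\cdot X))\cos(\alpha\cdot x)\,d\omega\,dt .\end{aligned}$$ Regularization. $q=\frac17$, $\delta_\varepsilon=\varepsilon^{(1+6q)/2}$, $R_\varepsilon=\dfrac{q}{9eT}\cdot\dfrac{\ln(\varepsilon^{-1})}{\ln(\ln(\varepsilon^{-1}))}$; $B(0,R)$ is the open ball in $\mathbb R^2$ and $\chi_A$ the indicator function of $A$. The Fourier transform in $\mathbb R^2$ is $F(w)(\alpha)=\int_{\mathbb R^2}w(x)e^{-i\alpha\cdot x}dx$. The regularized solution is explicitly $$f_{j\varepsilon}(\xi)=\frac1{4\pi^2}\int_{B(0,R_\varepsilon)}\frac{g_j(I_\varepsilon)(\alpha)D(I_\varepsilon)(\alpha)}{\delta_\varepsilon+(D(I_\varepsilon)(\alpha))^2}\,e^{i\xi\cdot\alpha}\,d\alpha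 .$$ *)

(* Defs.v *)
From HB Require Import structures.
From mathcomp Require Import all_boot all_order all_algebra.
From mathcomp Require Import all_classical all_reals all_analysis.
From mathcomp Require Import complex.

Set Implicit Arguments.
Unset Strict Implicit.
Unset Printing Implicit Defensive.

Import Order.TTheory GRing.Theory Num.Theory.
Import numFieldNormedType.Exports.

Local Open Scope classical_set_scope.
Local Open Scope ring_scope.

(* A point of the plane is a pair; the indices 1, 2 of the components of a
   vector are (0 : 'I_2) and (1 : 'I_2). Library caveat: the norm `|x| of
   R * R is the sup norm, so the Euclidean norm is enorm below. *)

Definition coordinate {R : realType} (j : 'I_2) (x : R * R) : R :=
  if j == 0 then x.1 else x.2.

Definition basis {R : realType} (j : 'I_2) : R * R :=
  if j == 0 then (1, 0) else (0, 1).

Definition pdot {R : realType} (x y : R * R) : R := x.1 * y.1 + x.2 * y.2.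

Definition enorm {R : realType} (x : R * R) : R :=
  Num.sqrt (x.1 ^+ 2 + x.2 ^+ 2).

Definition vdot {R : realType} (a : R * R) (v : 'I_2 -> R) : R :=
  \sum_(i < 2) coordinate i a * v i.

Definition leb1 {R : realType} :
  {measure set (measurableTypeR R) -> \bar R} := @lebesgue_measure R.

Definition leb2 {R : realType} :
  {measure set (measurableTypeR R * measurableTypeR R) -> \bar R} :=
  (@lebesgue_measure R \x @lebesgue_measure R)%E.

Definition Omega {R : realType} : set (R * R) :=
  `]0%R, 1%R[%classic `*` `]0%R, 1%R[%classic.

Definition dOmega {R : realType} : set (R * R) :=
  (`[0%R, 1%R]%classic `*` `[0%R, 1%R]%classic) `\` Omega.

(* Unit-speed parametrizations, over [0, 1], of the bottom, top, left and right
   edges of the square. *)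
Definition edge {R : realType} (k : nat) (s : measurableTypeR R) :
    measurableTypeR R * measurableTypeR R :=
  match k with
  | 0%N => (s, 0 : R)
  | 1%N => (s, 1 : R)
  | 2%N => (0 : R, s)
  | _   => (1 : R, s)
  end.

Lemma measurable_edge {R : realType} (k : nat) :
  measurable_fun [set: measurableTypeR R] (@edge R k).
Proof.
by case: k => [|[|[|k]]]; apply/measurable_fun_pairP; split;
  (exact: measurable_id || exact: measurable_cst).
Qed.

Lemma measurable_unit_itv {R : realType} :
  measurable (`[0%R, 1%R]%classic : set (measurableTypeR R)).
Proof. exact: measurable_itv. Qed.

Definition edge_measure {R : realType} (k : nat) :
    set (measurableTypeR R * measurableTypeR R) -> \bar R :=
  pushforward (mrestr (@leb1 R) measurable_unit_itv) (@edge R k).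

HB.instance Definition _ (R : realType) (k : nat) :=
  Measure.copy (@edge_measure R k)
    (measure_function_pushforward__canonical__measure_function_Measure
       (mrestr (@leb1 R) measurable_unit_itv) (@measurable_edge R k)).

(* Arc length on the boundary of the square. *)
Definition arc_length {R : realType} :
  {measure set (measurableTypeR R * measurableTypeR R) -> \bar R} :=
  msum (@edge_measure R) 4.

(* Outward unit normal of the square; its value at the four corners, a set of
   zero arc length, is irrelevant. *)
Definition normal {R : realType} (j : 'I_2) (x : R * R) : R :=
  (coordinate j x == 1)%:R - (coordinate j x == 0)%:R.

(* A function on D is represented by a function on the ambient space whose
   values outside D are disregarded. *)
Definition Lp {R : realType} {d} {X : measurableType d}
    (m : {measure set X -> \bar R}) (D : set X) (p : \bar R) (f : X -> R) : Prop :=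
  f \_ D \in Lfun m p.

Definition Lpnorm {R : realType} {d} {X : measurableType d}
    (m : {measure set X -> \bar R}) (D : set X) (p : \bar R) (f : X -> R) : \bar R :=
  'N[m]_p[EFin \o (f \_ D)]%E.

Definition L2Omega {R : realType} (w : R * R -> R) : Prop := Lp leb2 Omega 2%:E w.

Definition L2norm {R : realType} (w : R * R -> R) : \bar R :=
  Lpnorm leb2 Omega 2%:E w.

Fixpoint Ck {R : realType} (k : nat) (f : R * R -> R) : Prop :=
  match k with
  | 0%N => continuous f
  | k'.+1 => continuous f /\
      forall i, (forall x, derivable f x (basis i)) /\ Ck k' ('D_(basis i) f)
  end.

Definition smooth {R : realType} (f : R * R -> R) : Prop := forall k, Ck k f.

Definition test_function {R : realType} (psi : R * R -> R) : Prop :=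
  smooth psi /\ exists K : set (R * R),
    [/\ compact K, K `<=` Omega & forall x, ~ K x -> psi x = 0].

Definition is_weak_partial {R : realType} (i : 'I_2) (w v : R * R -> R) : Prop :=
  L2Omega v /\ forall psi, test_function psi ->
    \int[leb2]_(x in Omega) (w x * 'D_(basis i) psi x) =
    - \int[leb2]_(x in Omega) (v x * psi x).

(* The weak partial derivative is unique only up to equality a.e.; this is a
   chosen representative, meaningful when a weak derivative in L^2 exists. *)
Definition wpartial {R : realType} (i : 'I_2) (w : R * R -> R) : R * R -> R :=
  get [set v : R * R -> R | is_weak_partial i w v].

Definition H1 {R : realType} (w : R * R -> R) : Prop :=
  L2Omega w /\ forall i, exists v, is_weak_partial i w v.

Definition H2 {R : realType} (w : R * R -> R) : Prop :=
  H1 w /\ forall i, H1 (wpartial i w).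

Definition H2norm {R : realType} (w : R * R -> R) : \bar R :=
  ((L2norm w ^+ 2 + \sum_(i < 2) L2norm (wpartial i w) ^+ 2
    + \sum_(i < 2) \sum_(k < 2) L2norm (wpartial k (wpartial i w)) ^+ 2)
   `^ 2^-1)%E.

(* gamma is the trace of w on the boundary: the limit of the restrictions of
   functions smooth up to the boundary that converge to w in H^1. *)
Definition is_trace {R : realType} (w gamma : R * R -> R) : Prop :=
  [/\ H1 w, Lp arc_length dOmega 2%:E gamma &
   exists s : nat -> R * R -> R,
   [/\ forall n, smooth (s n),
       L2norm (s n \- w) @[n --> \oo] --> 0%E,
       forall i, L2norm ('D_(basis i) (s n) \- wpartial i w) @[n --> \oo] --> 0%E &
       Lpnorm arc_length dOmega 2%:E (s n \- gamma) @[n --> \oo] --> 0%E]].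

Definition divergence {R : realType} (v : 'I_2 -> R * R -> R) (x : R * R) : R :=
  \sum_(i < 2) wpartial i (v i) x.

Definition laplacian {R : realType} (w : R * R -> R) (x : R * R) : R :=
  \sum_(i < 2) wpartial i (wpartial i w) x.

(* A function of (x, t) is written w t x. *)

Definition continuous_L2 {R : realType} (T : R) (w : R -> R * R -> R) : Prop :=
  forall t, `[0, T]%classic t -> L2Omega (w t) /\
    L2norm (w s \- w t) @[s --> within `[0, T]%classic (nbhs t)] --> 0%E.

Definition is_ddt {R : realType} (T : R) (w w' : R -> R * R -> R) : Prop :=
  forall t, `[0, T]%classic t -> L2Omega (w' t) /\
    L2norm (fun x => (w s x - w t x) / (s - t) - w' t x)
      @[s --> within `[0, T]%classic t^'] --> 0%E.

(* The derivative of the L^2-valued map w on [0, T], one-sided at the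
   endpoints; a chosen representative, meaningful when w is differentiable. *)
Definition ddt {R : realType} (T : R) (w : R -> R * R -> R) : R -> R * R -> R :=
  get [set w' : R -> R * R -> R | is_ddt T w w'].

Fixpoint Ck_L2 {R : realType} (T : R) (k : nat) (w : R -> R * R -> R) : Prop :=
  match k with
  | 0%N => continuous_L2 T w
  | k'.+1 => [/\ continuous_L2 T w, exists w', is_ddt T w w' & Ck_L2 T k' (ddt T w)]
  end.

Definition simple_H2 {R : realType} (s : R -> R * R -> R) : Prop :=
  exists (m : nat) (A : 'I_m -> set (measurableTypeR R)) (c : 'I_m -> R * R -> R),
    (forall i, measurable (A i) /\ H2 (c i)) /\
    forall t x, s t x = \sum_(i < m) \1_(A i) t * c i x.

Definition strongly_measurable_H2 {R : realType} (T : R)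
    (w : R -> R * R -> R) : Prop :=
  exists s : nat -> R -> R * R -> R,
    (forall n, simple_H2 (s n)) /\
    {ae leb1, forall t, `]0, T[%classic t ->
       H2norm (s n t \- w t) @[n --> \oo] --> 0%E}.

Definition L2_H2 {R : realType} (T : R) (w : R -> R * R -> R) : Prop :=
  [/\ {ae leb1, forall t, `]0, T[%classic t -> H2 (w t)},
      strongly_measurable_H2 T w &
      (\int[leb1]_(t in `]0%R, T[%classic) (H2norm (w t) ^+ 2) < +oo)%E].

Definition L1L1norm {R : realType} (T : R) (Y : R -> R * R -> R) : \bar R :=
  (\int[leb1]_(t in `]0%R, T[%classic) \int[arc_length]_(x in dOmega) `|Y t x|%:E)%E.

Definition L1_L1 {R : realType} (T : R) (Y : R -> R * R -> R) : Prop :=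
  measurable_fun
    ((`]0%R, T[%classic : set (measurableTypeR R)) `*`
     (dOmega : set (measurableTypeR R * measurableTypeR R)))
    (fun z => Y z.1 z.2) /\
  (L1L1norm T Y < +oo)%E.

Record data (R : realType) := Data {
  phi  : R -> R ;
  surf : 'I_2 -> R -> R * R -> R ;  (* X_j, written X_j t x *)
  u0   : 'I_2 -> R * R -> R ;
  u0s  : 'I_2 -> R * R -> R ;
  uT   : 'I_2 -> R * R -> R
}.

Definition is_data {R : realType} (T : R) (I : data R) : Prop :=
  Lp leb1 `]0, T[%classic 1%E (phi I) /\
  forall j, [/\ L1_L1 T (surf I j), Lp leb2 Omega 1%E (u0 I j),
                Lp leb2 Omega 1%E (u0s I j) & Lp leb2 Omega 1%E (uT I j)].

Definition data_close {R : realType} (T : R) (eps : R) (I J : data R) : Prop :=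
  (Lpnorm leb1 `]0%R, T[%classic 1%E (phi I \- phi J)%R <= eps%:E)%E /\
  forall j,
  [/\ (L1L1norm T (fun t => (surf I j t \- surf J j t)%R) <= eps%:E)%E,
      (Lpnorm leb2 Omega 1%E (u0 I j \- u0 J j)%R <= eps%:E)%E,
      (Lpnorm leb2 Omega 1%E (u0s I j \- u0s J j)%R <= eps%:E)%E &
      (Lpnorm leb2 Omega 1%E (uT I j \- uT J j)%R <= eps%:E)%E].

(* At a fixed time; v is the displacement. *)
Definition sigma {R : realType} (lam mu : R) (v : 'I_2 -> R * R -> R)
    (j : 'I_2) (x : R * R) : R :=
  lam * divergence v x + 2 * mu * wpartial j (v j) x.

Definition tau {R : realType} (mu : R) (v : 'I_2 -> R * R -> R) (x : R * R) : R :=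
  mu * (wpartial 1 (v 0) x + wpartial 0 (v 1) x).

(* The boundary conditions hold in the sense of traces. *)
Definition inverse_solution {R : realType} (T lam mu : R) (I : data R)
    (u : 'I_2 -> R -> R * R -> R) (f : 'I_2 -> R * R -> R) : Prop :=
  let at_time t := fun j => u j t in
  [/\ {ae leb1, forall t, `]0, T[%classic t -> forall j,
        {ae leb2, forall x, Omega x ->
          ddt T (ddt T (u j)) t x =
            mu * laplacian (u j t) x
            + (lam + mu) * wpartial j (divergence (at_time t)) x
            + phi I t * f j x}},
      {ae leb1, forall t, `]0, T[%classic t -> forall j,
        is_trace (u j t) (fun=> 0)},
      forall j, {ae leb2, forall x, Omega x ->
        [/\ u j 0 x = u0 I j x, ddt T (u j) 0 x = u0s I j x
          & u j T x = uT I j x]} &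
      {ae leb1, forall t, `]0, T[%classic t ->
        exists (s : 'I_2 -> R * R -> R) (th : R * R -> R),
        [/\ forall j, is_trace (sigma lam mu (at_time t) j) (s j),
            is_trace (tau mu (at_time t)) th &
            {ae arc_length, forall x, dOmega x ->
              normal 0 x * s 0 x + normal 1 x * th x = surf I 0 t x /\
              normal 1 x * s 1 x + normal 0 x * th x = surf I 1 t x}]}].

Definition D1 {R : realType} (T lam mu : R) (I : data R) (a : R * R) : R :=
  \int[leb1]_(t in `]0, T[%classic)
    (phi I (T - t) * sin (Num.sqrt (lam + 2 * mu) * enorm a * t)).

Definition D2 {R : realType} (T mu : R) (I : data R) (a : R * R) : R :=
  \int[leb1]_(t in `]0, T[%classic)
    (phi I (T - t) * sin (Num.sqrt mu * enorm a * t)).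

Definition DI {R : realType} (T lam mu : R) (I : data R) (a : R * R) : R :=
  D1 T lam mu I a * D2 T mu I a.

Definition h0 {R : realType} (T lam mu : R) (I : data R) (a : R * R) : R :=
  let c := Num.sqrt (lam + 2 * mu) * enorm a in
  - sin (c * T) *
      \int[leb2]_(x in Omega) (vdot a (fun i => u0s I i x) * cos (pdot a x))
  + c * \int[leb2]_(x in Omega) (vdot a (fun i => uT I i x) * cos (pdot a x))
  - c * cos (c * T) *
      \int[leb2]_(x in Omega) (vdot a (fun i => u0 I i x) * cos (pdot a x))
  - \int[leb1]_(t in `]0, T[%classic) \int[arc_length]_(x in dOmega)
      (sin (c * (T - t)) * vdot a (fun i => surf I i t x) * cos (pdot a x)).

Definition hj {R : realType} (T mu : R) (I : data R) (j : 'I_2) (a : R * R) : R :=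
  let c := Num.sqrt mu * enorm a in
  let P (v : 'I_2 -> R) := enorm a ^+ 2 * v j - coordinate j a * vdot a v in
  - sin (c * T) *
      \int[leb2]_(x in Omega) (P (fun i => u0s I i x) * cos (pdot a x))
  + c * \int[leb2]_(x in Omega) (P (fun i => uT I i x) * cos (pdot a x))
  - c * cos (c * T) *
      \int[leb2]_(x in Omega) (P (fun i => u0 I i x) * cos (pdot a x))
  - \int[leb1]_(t in `]0, T[%classic) \int[arc_length]_(x in dOmega)
      (sin (c * (T - t)) * P (fun i => surf I i t x) * cos (pdot a x)).

Definition gj {R : realType} (T lam mu : R) (I : data R) (j : 'I_2) (a : R * R) : R :=
  2 / enorm a ^+ 2 *
    (coordinate j a * D2 T mu I a * h0 T lam mu I a + D1 T lam mu I a * hj T mu I j a).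

Definition q_reg {R : realType} : R := 7^-1.

Definition delta_reg {R : realType} (eps : R) : R := eps `^ ((1 + 6 * q_reg) / 2).

Definition R_reg {R : realType} (T eps : R) : R :=
  q_reg / (9 * expR 1 * T) * (ln eps^-1 / ln (ln eps^-1)).

Definition euclidean_ball {R : realType} (r : R) : set (R * R) :=
  [set a | enorm a < r].

Definition Cintegral {R : realType} (D : set (R * R)) (h : R * R -> R[i]) : R[i] :=
  Complex (\int[leb2]_(a in D) complex.Re (h a))
          (\int[leb2]_(a in D) complex.Im (h a)).

Definition cis {R : realType} (y : R) : R[i] := Complex (cos y) (sin y).

Definition f_reg {R : realType} (T lam mu eps : R) (I : data R) (j : 'I_2)
    (xi : R * R) : R[i] :=
  Complex (4 * pi ^+ 2)^-1 0 *
  Cintegral (euclidean_ball (R_reg T eps)) (fun a =>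
    Complex (gj T lam mu I j a * DI T lam mu I a
             / (delta_reg eps + DI T lam mu I a ^+ 2)) 0 * cis (pdot xi a)).

(* Main.v *)
Require Import Defs.
From HB Require Import structures.
From mathcomp Require Import all_boot all_order all_algebra.
From mathcomp Require Import all_classical all_reals all_analysis.
From mathcomp Require Import measurable_realfun ess_sup_inf complex ring lra.
Import Order.TTheory GRing.Theory Num.Theory.
Import numFieldNormedType.Exports.
Local Open Scope classical_set_scope.
Local Open Scope ring_scope.

(* Testing the equation against [b cos (a . x)], where [b] is parallel or
   orthogonal to [a], turns the Lame operator into multiplication by [- c^2] with
   [c = sqrt (lam + 2 mu) |a|] or [c = sqrt mu |a|], and leaves only the traction
   on the boundary. Solving the resulting oscillator from [t = 0] to [t = T] gives
   [g_j (I_ex) = 2 D (I_ex) C_j], where [C_j (a)] is the integral over [Omega] of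
   [f_j cos (a . x)].
   The factors of [D (I_ex) (a)] are sine transforms, at multiples of [|a|], of a
   nonzero integrable function on [(0, T)]. Such a transform has countably many
   zeros: at a nonisolated common zero of its derivatives up to order [k] the next
   one vanishes too, and a common zero of all of them makes the transform, hence
   the function, vanish. So [D (I_ex)] is nonzero almost everywhere.
   As [C_j] is integrable, Abel summation (the Poisson kernel) recovers [f_j] on
   [Omega] from [C_j]. The regularized integral then differs from [f_j] by a
   truncation error, which tends to zero by dominated convergence, and by the
   effect of the data error, of order [R^3 eps / delta = R^3 eps^(1/14)] where
   [R = O (ln (1 / eps))]. *)

(** * Integration *)

Set Implicit Arguments.
Unset Strict Implicit.
Unset Printing Implicit Defensive.

(** Cosines alone suffice because [Omega] lies in the open first quadrant and is therefore disjoint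
    from [- Omega]. The function [f_j (x) + f_j (- x)], built from the zero extension, agrees with
    [f_j] on [Omega] and has Fourier transform [2 C_j]. Hence the factor [2] in [g_j], and hence the
    constant [2 pi^2] of the cosine inversion against the [4 pi^2] of the regularized solution. In
    the kernels the reflected copy shows up as a mirror-image term that dies in the limit. The
    obstacle in the testing step is that the traction is given by traces of the stresses [sigma] and
    [tau], whereas the equation is written with second weak derivatives of [u], each a chosen
    representative. The equation has to be brought to divergence form, in the weak sense, before
    those traces can enter. No lower bound for [D] near its zeros is available, so the truncation
    error tends to zero without a rate. On the noise side, [R] grows at most like a logarithm, so
    every power of [R] loses against [eps / delta = eps^(1 - 13/14)]. *)

Section L1_pairing.
Context d (X : measurableType d) (R : realType) (m : {measure set X -> \bar R}).
Implicit Types (D : set X) (f k : X -> R) (M : R).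

Lemma integrable_mul_bounded D f k M : measurable D ->
  m.-integrable D (EFin \o f) -> measurable_fun D k ->
  (forall x, D x -> `|k x| <= M) ->
  m.-integrable D (EFin \o (fun x => f x * k x)).
Proof.
move=> mD fi mk kM.
apply: (@le_integrable _ _ _ m D mD _ (EFin \o (fun x => M * f x))).
- apply/measurable_EFinP; apply: measurable_funM => //.
  by apply/measurable_EFinP; exact: measurable_int fi.
- move=> x Dx /=; rewrite lee_fin !normrM mulrC ler_wpM2r//.
  by rewrite (le_trans (kM _ Dx))// ler_norm.
- have := integrableZl mD M fi; apply: eq_integrable => // x _ /=.
Qed.

Lemma Rintegral_mul_le D f k M : measurable D ->
  m.-integrable D (EFin \o f) -> measurable_fun D k ->
  (forall x, D x -> `|k x| <= M) ->
  `|\int[m]_(x in D) (f x * k x)| <= M * \int[m]_(x in D) `|f x|.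
Proof.
move=> mD fi mk kM.
have fki := integrable_mul_bounded mD fi mk kM.
apply: (le_trans (le_normr_Rintegral mD fki)).
have fn := integrable_norm fi.
rewrite -RintegralZl//; apply: le_Rintegral => //.
- exact: (integrable_norm fki).
- have := integrableZl mD M fn; apply: eq_integrable => // x _ /=.
- by move=> x Dx; rewrite normrM mulrC ler_wpM2r// kM.
Qed.

(** Kernels that are uniformly close on [D] have close integrals against a fixed integrable
    function. The filter is arbitrary, so the lemma yields continuity in the frequency and in space,
    where a sequential dominated convergence theorem would not apply directly. *)
Lemma Rintegral_mul_cvg D f (T : Type) (F : set_system T) (k : T -> X -> R) k0
    (rho : T -> R) : Filter F -> measurable D ->
  m.-integrable D (EFin \o f) ->
  (forall a, measurable_fun D (k a)) -> measurable_fun D k0 ->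
  (exists M, forall x, D x -> `|k0 x| <= M) ->
  (forall a x, D x -> `|k a x - k0 x| <= rho a) ->
  rho a @[a --> F] --> 0 ->
  \int[m]_(x in D) (f x * k a x) @[a --> F] --> \int[m]_(x in D) (f x * k0 x).
Proof.
move=> FF mD fi mk mk0 [M k0M] krho rho0.
have kM a x : D x -> `|k a x| <= rho a + M.
  move=> Dx; rewrite -(subrK (k0 x) (k a x)) (le_trans (ler_normD _ _))//.
  by rewrite lerD// ?krho// k0M.
have key a : `|\int[m]_(x in D) (f x * k0 x) - \int[m]_(x in D) (f x * k a x)|
    <= rho a * \int[m]_(x in D) `|f x|.
  rewrite -RintegralB//; last 2 first.
  - exact: (integrable_mul_bounded mD fi mk0 k0M).
  - exact: (integrable_mul_bounded mD fi (mk a) (kM a)).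
  under eq_Rintegral do rewrite -mulrBr.
  apply: Rintegral_mul_le => //; first exact: measurable_funB.
  by move=> x Dx; rewrite distrC krho.
apply/cvgrPdist_le => e e0.
have : rho a * \int[m]_(x in D) `|f x| @[a --> F] --> 0.
  by rewrite -(mul0r (\int[m]_(x in D) `|f x|)); apply: cvgMl.
move/cvgrPdist_le => /(_ _ e0); apply: filterS => a.
rewrite sub0r normrN => h; apply: (le_trans (key a)).
by apply: le_trans h; exact: ler_norm.
Qed.

Lemma Rintegral_dominated_cvg D (f_ : nat -> X -> R) f g : measurable D ->
  (forall n, measurable_fun D (f_ n)) -> measurable_fun D f ->
  {ae m, forall x, D x -> f_ n x @[n --> \oo] --> f x} ->
  m.-integrable D (EFin \o g) ->
  (forall n x, D x -> `|f_ n x| <= g x) ->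
  \int[m]_(x in D) f_ n x @[n --> \oo] --> \int[m]_(x in D) f x.
Proof.
move=> mD mf_ mf cf gi fg.
have [|||||i1 _ c] := @dominated_convergence _ _ _ m D mD
   (fun n => EFin \o f_ n) (EFin \o f) (EFin \o g).
- by move=> n; apply/measurable_EFinP.
- exact/measurable_EFinP.
- apply: filterS cf => x cx Dx /=; apply/fine_cvgP; split; last exact: cx.
  by near=> n.
- exact: gi.
- by apply: aeW => x n Dx /=; rewrite lee_fin fg.
by move: c; rewrite -(fineK (integrable_fin_num mD i1)) => /fine_cvg.
Unshelve. all: by end_near. Qed.

Lemma ae_eq_Rintegral D f g : measurable D ->
  measurable_fun D f -> measurable_fun D g ->
  {ae m, forall x, D x -> f x = g x} ->
  \int[m]_(x in D) f x = \int[m]_(x in D) g x.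
Proof.
move=> mD mf mg fg; congr fine; apply: ae_eq_integral => //.
- exact/measurable_EFinP.
- exact/measurable_EFinP.
- by apply: filterS fg => x h Dx /=; rewrite h.
Qed.

End L1_pairing.

Section Lp_facts.
Context d (X : measurableType d) (R : realType) (m : {measure set X -> \bar R}).
Implicit Types (D : set X) (f k : X -> R) (M : R).

Lemma Lp_measurable D p f : measurable D -> Lp m D p f -> measurable_fun D f.
Proof.
move=> mD; rewrite /Lp inE => /andP[/[!inE] /= mf _].
by apply/(measurable_restrictT _ mD).
Qed.

Lemma Lp1_integrable D f : measurable D ->
  Lp m D 1%E f <-> m.-integrable D (EFin \o f).
Proof.
move=> mD; rewrite /Lp Lfun1_integrable (integrable_mkcond _ mD).
by rewrite restrict_EFin.
Qed.

Lemma Lpnorm1E D f : measurable D ->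
  Lpnorm m D 1%E f = (\int[m]_(x in D) `|f x|%:E)%E.
Proof.
move=> mD; rewrite /Lpnorm Lnorm1 [RHS]integral_mkcond; apply: eq_integral => x _ /=.
by rewrite /patch; case: ifP => //=; rewrite normr0.
Qed.

Lemma Lpnorm2_lty D f : measurable D -> Lp m D 2%:E f ->
  (Lpnorm m D 2%:E f < +oo)%E.
Proof. by move=> mD; rewrite /Lp inE => /andP[_ /[!inE]]. Qed.

(** On a set of finite measure the L2 norm controls the L1 norm, hence every integral against a
    bounded kernel. *)
Lemma Lp2_mul_le D f k M : measurable D -> (m D < +oo)%E ->
  measurable_fun D f -> (Lpnorm m D 2%:E f < +oo)%E -> measurable_fun D k ->
  (forall x, D x -> `|k x| <= M) ->
  `|\int[m]_(x in D) (f x * k x)| <=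
     M * Num.sqrt (fine (m D)) * fine (Lpnorm m D 2%:E f) /\
  m.-integrable D (EFin \o f).
Proof.
move=> mD mDoo mf fL mk kM.
have mfD : measurable_fun [set: X] (f \_ D) by apply/(measurable_restrictT _ mD).
(* The empty set is treated apart, because [0 <= M] can only be deduced from a point of [D]. *)
have [->|D0] := eqVneq D set0.
  split; last exact: integrable_set0.
  by rewrite Rintegral_set0 normr0 measure0 /= sqrtr0 mulr0 mul0r.
have M0 : 0 <= M.
  by move/set0P : D0 => [x Dx]; apply: le_trans (kM x Dx).
have L1 : (\int[m]_(x in D) `|f x|%:E <=
   (Num.sqrt (fine (m D)))%:E * Lpnorm m D 2%:E f)%E.
  rewrite -Lpnorm1E// /Lpnorm.
  (* Hoelder with exponents [2, 2], the second function being the indicator of [D], whose L2 norm is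
     the square root of [m D]. *)
  have := @hoelder _ _ _ m (f \_ D) (\1_D) 2 2 mfD.
  rewrite (_ : (f \_ D) \* \1_D = f \_ D); last first.
    apply/funext => x /=; rewrite /patch indicE.
    by case: (x \in D); rewrite ?mulr1 ?mul0r.
  move=> /(_ _ _ _ _)/le_trans; apply => //.
  - by rewrite [RHS]splitr !div1r.
  rewrite muleC lee_wpmul2r ?Lnorm_ge0//.
  rewrite unlock /=.
  rewrite (eq_integral (fun x => (\1_D x)%:E)); last first.
    move=> x _; rewrite /= indicE; case: (x \in D) => /=.
      by rewrite normr1 powR1.
    by rewrite normr0 powR0.
  rewrite integral_indic// setIT -[m D in leLHS]fineK ?ge0_fin_numE//.
  by rewrite poweR_EFin lee_fin powR12_sqrt.
have fi : m.-integrable D (EFin \o f).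
  apply/integrableP; split; first exact/measurable_EFinP.
  apply: (le_lt_trans L1); apply: lte_mul_pinfty => //.
split => //.
apply: (le_trans (Rintegral_mul_le mD fi mk kM)).
rewrite -mulrA ler_wpM2l// -lee_fin.
rewrite EFinM (@fineK _ (Lpnorm m D 2%:E f)); last first.
  by rewrite ge0_fin_numE//; exact: Lnorm_ge0.
rewrite /Rintegral fineK//.
rewrite ge0_fin_numE; last exact: integral_ge0.
by move/integrableP : fi => [].
Qed.

Lemma Lp2_integrable D f : measurable D -> (m D < +oo)%E ->
  Lp m D 2%:E f -> m.-integrable D (EFin \o f).
Proof.
move=> mD Doo fL; have mf := Lp_measurable mD fL.
(* Pairing with the zero kernel keeps only the integrability half of the lemma. *)
by have [] := @Lp2_mul_le D f (cst 0) 0 mD Doo mf (Lpnorm2_lty mD fL) (measurable_cst _)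
   (fun _ _ => eq_ind_r (fun z => z <= 0) (lexx 0) (normr0 R)).
Qed.

(** L2 convergence in the form used both for traces (sequences of smooth functions) and for time
    derivatives (difference quotients). Integrability of [g a] is asked only along the filter, since
    for times outside [[0, T]] nothing is known. *)
Lemma Lp2_cvg_Rintegral D (T : Type) (F : set_system T) (g : T -> X -> R) g0 k :
  Filter F -> measurable D -> (m D < +oo)%E ->
  Lp m D 2%:E g0 ->
  (\forall a \near F, m.-integrable D (EFin \o g a)) ->
  measurable_fun D k -> (exists M, forall x, D x -> `|k x| <= M) ->
  Lpnorm m D 2%:E (g a \- g0) @[a --> F] --> 0%E ->
  \int[m]_(x in D) (g a x * k x) @[a --> F] --> \int[m]_(x in D) (g0 x * k x).
Proof.
move=> FF mD Doo g0L gi mk [M kM] c.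
have mg0 := Lp_measurable mD g0L.
have g0i := Lp2_integrable mD Doo g0L.
have [cf cr] := (fine_cvgP _ _).1 c.
apply/cvgrPdist_le => e e0.
have : M * Num.sqrt (fine (m D)) * fine (Lpnorm m D 2%:E (g a \- g0)) @[a --> F] --> 0.
  rewrite -(mulr0 (M * Num.sqrt (fine (m D)))).
  by apply: cvgMr; exact: cr.
move/cvgrPdist_le => /(_ _ e0).
move: cf gi; apply: filterS3 => a af ai.
rewrite sub0r normrN => h.
have fin : (Lpnorm m D 2%:E (g a \- g0)%R < +oo)%E.
  by rewrite -ge0_fin_numE ?Lnorm_ge0//.
have mga : measurable_fun D (g a) by apply/measurable_EFinP; exact: measurable_int ai.
have [+ _] := Lp2_mul_le mD Doo (measurable_funB mga mg0) fin mk kM.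
rewrite (_ : \int[m]_(x in D) _ = \int[m]_(x in D) (g a x * k x) - \int[m]_(x in D) (g0 x * k x)).
  rewrite distrC => /le_trans; apply.
  by apply: le_trans h; exact: ler_norm.
rewrite -RintegralB//.
- by apply: eq_Rintegral => x _ /=; rewrite mulrBl.
- exact: (integrable_mul_bounded mD ai mk kM).
- exact: (integrable_mul_bounded mD g0i mk kM).
Qed.

End Lp_facts.

Section almost_everywhere.
Context d (X : measurableType d) (R : realType) (m : {measure set X -> \bar R}).

Lemma ae_imp (P Q : X -> Prop) : {ae m, forall x, P x} -> (forall x, P x -> Q x) ->
  {ae m, forall x, Q x}.
Proof. by move=> h PQ; apply: filterS h => x; exact: PQ. Qed.

Lemma ae_and (P Q : X -> Prop) : {ae m, forall x, P x} -> {ae m, forall x, Q x} ->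
  {ae m, forall x, P x /\ Q x}.
Proof. by move=> hP hQ; apply: filterS2 hP hQ. Qed.

End almost_everywhere.

Section measure_preserving.
Context d (X : measurableType d) (R : realType) (m : {measure set X -> \bar R}).
Variables (h : X -> X) (mh : measurable_fun setT h).
Hypothesis mhE : forall A, measurable A -> pushforward m h A = m A.

(** The pushforward of [m] under [h] has the same integrals as [m]. The maps in view are the
    reflections [t |-> T - t] of the line and [a |-> - a] of the plane. *)
Lemma Rintegral_preserving D (g : X -> R) : measurable D ->
  m.-integrable D (EFin \o g) ->
  \int[m]_(t in h @^-1` D) g (h t) = \int[m]_(t in D) g t /\
  m.-integrable (h @^-1` D) (EFin \o (g \o h)).
Proof.
move=> mD gi.
have mpre : measurable (h @^-1` D) by rewrite -[_ @^-1` _]setTI; exact: mh.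
(* [g] is measurable only on [D]; its zero extension can be composed with [h] everywhere. *)
pose G := (EFin \o g) \_ D.
have mG : measurable_fun setT G.
  by apply/(measurable_restrictT _ mD); exact: measurable_int gi.
pose m' := measure_function_pushforward__canonical__measure_function_Measure m mh.
have mI f : (\int[m']_(x in D) f x = \int[m]_(x in D) f x)%E.
  by apply: eq_measure_integral => A mA _; exact: mhE.
have GD x : D x -> G x = (g x)%:E by move=> Dx; rewrite /G /patch mem_set.
have Gf x : (h @^-1` D) x -> (G \o h) x = (g (h x))%:E by move=> Dx; rewrite /= GD.
have i2 : m.-integrable (h @^-1` D) (EFin \o (g \o h)).
  apply/integrableP; split.
    apply: (eq_measurable_fun (G \o h)).
      by move=> x /set_mem Dx; exact: Gf.
    by apply: measurable_funTS; exact: measurableT_comp.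
  have -> : (\int[m]_(x in h @^-1` D) `|(EFin \o (g \o h)) x| =
      \int[m]_(x in h @^-1` D) ((abse \o G) \o h) x)%E.
    apply: eq_integral => x /set_mem Dx; rewrite [RHS]/=.
    by have := Gf x Dx => /= ->.
  rewrite -(@ge0_integral_pushforward _ _ _ _ _ _ mh m D (abse \o G))//;
    do ?[by move=> y _; exact: abse_ge0|by apply: measurable_funTS; exact: measurableT_comp].
  have /integrableP[_] := gi; apply: le_lt_trans.
  apply: (@le_trans _ _ (\int[m]_(y in D) (abse \o G) y)%E).
    by rewrite -(mI (abse \o G)); exact: lexx.
  rewrite le_eqVlt; apply/orP; left; apply/eqP.
  by apply: eq_integral => x /set_mem Dx; rewrite /= GD.
split; last exact: i2.
congr fine; transitivity (\int[m']_(y in D) G y)%E; last first.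
  by rewrite mI; apply: eq_integral => x /set_mem Dx; rewrite GD.
rewrite /m' (@integral_pushforward _ _ _ _ _ _ mh m D G)//.
- by apply: eq_integral => x /set_mem Dx; rewrite Gf.
- apply: eq_integrable i2 => // x /set_mem Dx; exact: esym (Gf x Dx).
Qed.

End measure_preserving.

Section integrals_over_a_generator.
Context d (X : measurableType d) (R : realType) (m : {measure set X -> \bar R}).

(** The measurable sets over which [g] integrates to zero form a Dynkin system, so it is enough to
    test a generator stable under intersection. *)
Lemma Rintegral_generator_eq0 (G : set (set X)) (g : X -> R) :
  measurable = <<s G >> -> setI_closed G -> m.-integrable setT (EFin \o g) ->
  \int[m]_x g x = 0 -> (forall A, G A -> \int[m]_(x in A) g x = 0) ->
  (forall A, measurable A -> \int[m]_(x in A) g x = 0) /\ {ae m, forall x, g x = 0}.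
Proof.
move=> mG cG gi g0 Gg0.
have gA A : measurable A -> m.-integrable A (EFin \o g).
  by move=> mA; apply: integrableS gi.
have H A : measurable A -> \int[m]_(x in A) g x = 0.
  rewrite mG; apply: (@dynkin_induction _ X G (fun A => \int[m]_(x in A) g x = 0)) => //.
  (* Stability under complements is where the vanishing of the total integral is spent. *)
  - move=> S mS S0; have mSC := measurableC mS.
    have := g0; rewrite -(setUv S) Rintegral_setU//; last 2 first.
    + by rewrite setUv.
    + by apply/disj_setPS; rewrite setICr.
    by rewrite S0 add0r.
  - move=> F mF tF F0; have mU : measurable (\bigcup_k F k) by exact: bigcup_measurable.
    rewrite /Rintegral integral_bigcup//; last exact: gA.
    rewrite eseries0// => n _ _.
    rewrite -[LHS]fineK; first by congr EFin; exact: F0.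
    exact: integrable_fin_num (gA _ (mF n)).
split=> //.
have : ae_eq m setT (EFin \o g) (cst 0%E).
  apply: integral_ae_eq => // E _ mE.
  rewrite -[LHS]fineK; last exact: integrable_fin_num (gA _ mE).
  by rewrite -[fine _]/(\int[m]_(x in E) g x) H// integral_cst// mul0e.
by apply: filterS => x /(_ Logic.I) [].
Qed.

End integrals_over_a_generator.

(** * The unit square and its boundary *)

Section plane.
Context {R : realType}.
Local Notation R2 := (measurableTypeR R * measurableTypeR R)%type.

(** The topology and the sigma-algebra of the plane are two separate product structures. They are
    compared by writing an open set as the countable union of the open boxes with rational corners
    that it contains. *)
Lemma open_measurable_plane (A : set (R * R)) : open A ->
  measurable (A : set R2).
Proof.
move=> oA.
pose box (q : (rat * rat) * (rat * rat)) : set R2 :=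
  `](ratr q.1.1 : R), ratr q.1.2[%classic `*` `](ratr q.2.1 : R), ratr q.2.2[%classic.
have -> : A = \bigcup_q (if `[< box q `<=` A >] then box q else set0).
  apply/seteqP; split => x; last first.
    by move=> [q _]; case: ifPn => // /asboolP; apply.
  move=> Ax; have /nbhs_ballP[e /= e0 eA] : nbhs x A by exact: open_nbhs_nbhs.
  have /rat_in_itvoo[q1 q1P] : x.1 - e < x.1 by lra.
  have /rat_in_itvoo[q2 q2P] : x.1 < x.1 + e by lra.
  have /rat_in_itvoo[q3 q3P] : x.2 - e < x.2 by lra.
  have /rat_in_itvoo[q4 q4P] : x.2 < x.2 + e by lra.
  exists ((q1, q2), (q3, q4)) => //.
  move: q1P q2P q3P q4P; rewrite !in_itv/= => /andP[? ?] /andP[? ?] /andP[? ?] /andP[? ?].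
  have -> : `[< box ((q1, q2), (q3, q4)) `<=` A >].
    apply/asboolP => -[y1 y2] [/=]; rewrite !in_itv/= => /andP[? ?] /andP[? ?].
    by apply: eA; split => /=; rewrite /ball/= ltr_norml; apply/andP; split; lra.
  by rewrite /box; split => /=; rewrite in_itv/=; apply/andP.
apply: countable_bigcupT_measurable; first exact: countableP.
move=> q; case: ifP => _; last exact: measurable0.
by apply: measurableX; exact: measurable_itv.
Qed.

Lemma continuous_measurable_plane (f : R * R -> R) : continuous f ->
  measurable_fun [set: R2] f.
Proof.
move=> /continuousP cf; apply: (measurability _ (RGenOpens.measurableE R)).
move=> _ [_ [a [b ->] <-]]; rewrite setTI; apply: open_measurable_plane.
exact/cf/interval_open.
Qed.

Lemma measurable_Omega : measurable (@Omega R : set R2).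
Proof. by apply: measurableX; exact: measurable_itv. Qed.

Lemma measurable_dOmega : measurable (@dOmega R : set R2).
Proof.
apply: measurableD; last exact: measurable_Omega.
by apply: measurableX; exact: measurable_itv.
Qed.

Lemma leb1_itv (a b : bool) : leb1 [set` Interval (BSide a (0 : R)) (BSide b 1)] = 1%E.
Proof.
have -> : leb1 [set` Interval (BSide a (0 : R)) (BSide b 1)] =
  lebesgue_measure [set` Interval (BSide a (0 : R)) (BSide b 1)] by [].
by rewrite lebesgue_measure_itv /= lte_fin ltr01 oppr0 adde0.
Qed.

Lemma leb2X (A B : set (measurableTypeR R)) : measurable A -> measurable B ->
  leb2 (A `*` B) = (leb1 A * leb1 B)%E.
Proof. by move=> mA mB; exact: product_measure1E. Qed.

Lemma leb2_Omega : @leb2 R Omega = 1%E.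
Proof.
by rewrite leb2X ?leb1_itv ?mule1//; exact: measurable_itv.
Qed.

Lemma leb2_Omega_lty : (@leb2 R Omega < +oo)%E.
Proof. by rewrite leb2_Omega ltry. Qed.

Lemma edge_dOmega k (s : R) : `[0, 1]%classic s -> dOmega (edge k s).
Proof.
rewrite /= in_itv/= => /andP[s0 s1].
case: k => [|[|[|k]]]; (split; [split => /=; rewrite in_itv/=; apply/andP; split; lra|]);
  move=> -[/=]; rewrite !in_itv/=; lra.
Qed.

Lemma arc_length_fin (A : set R2) : measurable A -> (arc_length A < +oo)%E.
Proof.
move=> mA; rewrite /arc_length /msum.
apply: (@le_lt_trans _ _ (\sum_(n < 4) 1)%E); last first.
  by rewrite big_const_ord /= ltry.
apply: lee_sum => k _; rewrite /edge_measure /pushforward /mrestr.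
apply: (@le_trans _ _ (leb1 (`[0%R, 1%R]%classic : set R))).
  apply: le_measure; rewrite ?inE; [|exact: measurable_itv|exact: subIsetr].
  apply: measurableI; last exact: measurable_itv.
  by rewrite -[X in measurable X]setTI; apply: measurable_edge.
by rewrite leb1_itv.
Qed.

Lemma integral_arc_length (h : R2 -> \bar R) : measurable_fun [set: R2] h ->
  (forall x, (0 <= h x)%E) ->
  (\int[arc_length]_(x in dOmega) h x =
   \sum_(k < 4) \int[leb1]_(s in `[0%R, 1%R]%classic) h (edge k s))%E.
Proof.
move=> mh h0; have mD := measurable_dOmega.
rewrite /arc_length ge0_integral_measure_sum//; last exact: measurable_funTS.
apply: eq_bigr => k _.
have -> : (\int[edge_measure k]_(x in dOmega) h x =
   \int[pushforward (mrestr (@leb1 R) measurable_unit_itv) (@edge R k)]_(x in dOmega) h x)%E by [].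
rewrite ge0_integral_pushforward//; [|exact: measurable_edge|exact: measurable_funTS].
(* A point of the line carrying an edge is on the boundary of the square exactly when its parameter
   lies in [[0, 1]]. *)
have preE : @edge R k @^-1` dOmega = `[0%R, 1%R]%classic.
  apply/seteqP; split => [x|x /edge_dOmega]; last exact.
  by case: (nat_of_ord k) => [|[|[|j]]]; move=> [[/=]]; rewrite !in_itv/=.
rewrite preE; apply: eq_measure_integral => A mA Asub.
rewrite /= /mrestr setIidl//.
Qed.

Lemma integrable_edge (h : R2 -> R) M k : measurable_fun [set: R2] h ->
  (forall x, `|h x| <= M) ->
  leb1.-integrable `[0%R, 1%R]%classic (EFin \o (fun s => h (edge k s))).
Proof.
move=> mh hM; apply: measurable_bounded_integrable.
- exact: measurable_itv.
- by rewrite leb1_itv ltry.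
- by apply: measurable_funTS; apply: measurableT_comp => //; exact: measurable_edge.
- exists M; split; first exact: num_real.
  by move=> N MN s _ /=; rewrite (le_trans (hM _))// ltW.
Qed.

Lemma integrable_arc_length (h : R2 -> R) M : measurable_fun [set: R2] h ->
  (forall x, `|h x| <= M) ->
  arc_length.-integrable dOmega (EFin \o h).
Proof.
move=> mh hM; apply: measurable_bounded_integrable.
- exact: measurable_dOmega.
- by apply: arc_length_fin; exact: measurable_dOmega.
- exact: measurable_funTS.
- exists M; split; first exact: num_real.
  by move=> N MN s _ /=; rewrite (le_trans (hM _))// ltW.
Qed.

(** Adding the bound [M] makes [h] nonnegative, which reduces the formula to the nonnegative case;
    finiteness of the measures allows the constant to be subtracted again. *)
Lemma Rintegral_arc_length (h : R2 -> R) M : measurable_fun [set: R2] h ->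
  (forall x, `|h x| <= M) ->
  \int[arc_length]_(x in dOmega) h x =
  \sum_(k < 4) \int[leb1]_(s in `[0%R, 1%R]%classic) h (edge k s).
Proof.
move=> mh hM; have mD := measurable_dOmega.
have M0 : 0 <= M by apply: le_trans (hM (0, 0)).
have ge0E (g : R2 -> R) N : measurable_fun [set: R2] g -> (forall x, `|g x| <= N) ->
    (forall x, 0 <= g x) ->
    \int[arc_length]_(x in dOmega) g x =
    \sum_(k < 4) \int[leb1]_(s in `[0%R, 1%R]%classic) g (edge k s).
  move=> mg gN g0; rewrite /Rintegral integral_arc_length//=; last exact/measurable_EFinP.
  rewrite -sum_fine// => k _; apply: integrable_fin_num; first exact: measurable_itv.
  exact: integrable_edge mg gN.
have mM : measurable_fun [set: R2] (cst M) by exact: measurable_cst.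
have cM (x : R2) : `|cst M x| <= M by rewrite /= ger0_norm.
have mhM : measurable_fun [set: R2] (fun x => h x + M) by exact: measurable_funD.
have chM (x : R2) : `|h x + M| <= M + M.
  by rewrite (le_trans (ler_normD _ _))// lerD// ger0_norm.
have e1 := ge0E _ _ mhM chM (fun x => ltac:(have := hM x; rewrite ler_norml; lra)).
have e2 := ge0E _ _ mM cM (fun x => M0).
have -> : \int[arc_length]_(x in dOmega) h x =
   \int[arc_length]_(x in dOmega) (h x + M) - \int[arc_length]_(x in dOmega) M.
  rewrite -RintegralB//; last 2 first.
  - exact: integrable_arc_length mhM chM.
  - exact: integrable_arc_length mM cM.
  by apply: eq_Rintegral => x _; rewrite addrK.
rewrite e1 e2 -sumrB; apply: eq_bigr => k _.
rewrite -RintegralB//; last 2 first.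
- exact: integrable_edge mhM chM.
- exact: integrable_edge mM cM.
by apply: eq_Rintegral => x _; rewrite /= addrK.
Qed.

Lemma measurable_cont_plane D (f : R * R -> R) : continuous f ->
  measurable_fun (D : set R2) f.
Proof. by move=> /continuous_measurable_plane; exact: measurable_funTS. Qed.

Lemma sum_edges (F : nat -> R) : \sum_(k < 4) F k = F 0%N + F 1%N + F 2%N + F 3%N.
Proof. by rewrite !big_ord_recr big_ord0 /= add0r. Qed.

End plane.

(** * Fubini's theorem for real-valued integrals over rectangles *)

Section Fubini_on_products.
Context d1 d2 (T1 : measurableType d1) (T2 : measurableType d2) (R : realType).
Variables (m1 : {sigma_finite_measure set T1 -> \bar R})
  (m2 : {sigma_finite_measure set T2 -> \bar R}).
Variables (A : set T1) (B : set T2) (f : T1 * T2 -> R).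
Hypotheses (mA : measurable A) (mB : measurable B)
  (fi : (m1 \x m2)%E.-integrable (A `*` B) (EFin \o f)).

Let g := f \_ (A `*` B).

Let gi : (m1 \x m2)%E.-integrable setT (EFin \o g).
Proof.
have mAB : measurable (A `*` B) by exact: measurableX.
by rewrite /g -restrict_EFin; apply/(integrable_mkcond _ mAB).
Qed.

Let gin x y : A x -> (g (x, y))%:E = ((EFin \o (fun y => f (x, y))) \_ B) y.
Proof.
move=> Ax; rewrite /g /patch /=; have [By|By] := boolP (y \in B).
  by rewrite ifT//; apply/mem_set; split => //=; exact: set_mem.
rewrite ifF//; apply/negbTE; apply: contra By => /set_mem[_ ?]; exact/mem_set.
Qed.

Let gout x y : ~ A x -> g (x, y) = 0.
Proof.
move=> Ax; rewrite /g /patch ifF//; apply/negbTE.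
by apply/negP => /set_mem[].
Qed.

Let gin2 x y : B y -> (g (x, y))%:E = ((EFin \o (fun x => f (x, y))) \_ A) x.
Proof.
move=> By; rewrite /g /patch /=; have [Ax|Ax] := boolP (x \in A).
  by rewrite ifT//; apply/mem_set; split => //=; exact: set_mem.
rewrite ifF//; apply/negbTE; apply: contra Ax => /set_mem[? _]; exact/mem_set.
Qed.

Let gout2 x y : ~ B y -> g (x, y) = 0.
Proof.
move=> By; rewrite /g /patch ifF//; apply/negbTE.
by apply/negP => /set_mem[].
Qed.

Lemma ae_integrable_section1 :
  {ae m1, forall x, A x -> m2.-integrable B (EFin \o (fun y => f (x, y)))}.
Proof.
have := ae_integrable1 gi; apply: filterS => x gxi Ax.
apply/(integrable_mkcond _ mB); apply: eq_integrable gxi => // y _ /=.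
exact: gin.
Qed.

Let F_E x : fine (\int[m2]_y (g (x, y))%:E)%E =
  ((fun x => \int[m2]_(y in B) f (x, y)) \_ A) x.
Proof.
rewrite /patch; case: ifPn => [/set_mem Ax|Ax].
  rewrite /Rintegral [in RHS]integral_mkcond; congr fine.
  by apply: eq_integral => y _; exact: gin.
rewrite integral0_eq// => y _; rewrite gout//.
by move=> /mem_set; apply/negP.
Qed.

Let G_E y : fine (\int[m1]_x (g (x, y))%:E)%E =
  ((fun y => \int[m1]_(x in A) f (x, y)) \_ B) y.
Proof.
rewrite /patch; case: ifPn => [/set_mem By|By].
  rewrite /Rintegral [in RHS]integral_mkcond; congr fine.
  by apply: eq_integral => x _; exact: gin2.
rewrite integral0_eq// => x _; rewrite gout2//.
by move=> /mem_set; apply/negP.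
Qed.

Lemma integrable_Rintegral1 :
  m1.-integrable A (EFin \o (fun x => \int[m2]_(y in B) f (x, y))).
Proof.
have Fi := integrable_fubini_F gi.
apply/(integrable_mkcond _ mA); rewrite restrict_EFin.
rewrite -(_ : (fun x => fine (\int[m2]_y (g (x, y))%:E)%E) =
   ((fun x => \int[m2]_(y in B) f (x, y)) \_ A)); last exact/funext.
have mF := measurable_int m1 Fi.
apply: le_integrable Fi => //.
  by apply/measurable_EFinP; apply: measurableT_comp => //; exact: fine_measurable.
move=> x _ /=; rewrite /fubini_F /=.
(* [fine] sends both infinities to [0], so it never increases the absolute value. *)
by case: (\int[m2]_y (g (x, y))%:E)%E => //=; rewrite ?leey.
Qed.

Lemma integrable_Rintegral2 :
  m2.-integrable B (EFin \o (fun y => \int[m1]_(x in A) f (x, y))).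
Proof.
have mgi := measurable_int _ gi.
(* The section integrals in the second variable are bounded by those of the absolute value, which
   are integrable by Tonelli. *)
have Gi : m2.-integrable setT (fubini_G m1 (EFin \o g)).
  apply/integrableP; split; first exact: measurable_fubini_G gi.
  have /(integrable21ltyP m1 m2 mgi) := gi; apply: le_lt_trans.
  apply: ge0_le_integral => //.
  - by apply: measurableT_comp => //; exact: measurable_fubini_G gi.
  - apply: (@measurable_fun_fubini_tonelli_G _ _ _ _ _ m1 (abse \o (EFin \o g))).
      exact: measurableT_comp.
    by move=> z; exact: abse_ge0.
  move=> y _; apply: le_abse_integral => //.
  exact: (measurableT_comp mgi (pair2_measurable y)).
apply/(integrable_mkcond _ mB); rewrite restrict_EFin.
rewrite -(_ : (fun y => fine (\int[m1]_x (g (x, y))%:E)%E) =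
   ((fun y => \int[m1]_(x in A) f (x, y)) \_ B)); last exact/funext.
have mG := measurable_int m2 Gi.
apply: le_integrable Gi => //.
  by apply/measurable_EFinP; apply: measurableT_comp => //; exact: fine_measurable.
move=> y _ /=; rewrite /fubini_G /=.
by case: (\int[m1]_x (g (x, y))%:E)%E => //=; rewrite ?leey.
Qed.

Lemma Rintegral_prod1 : \int[(m1 \x m2)%E]_(z in A `*` B) f z =
  \int[m1]_(x in A) \int[m2]_(y in B) f (x, y).
Proof.
have Fi := integrable_fubini_F gi.
rewrite Rintegral_mkcond [RHS]Rintegral_mkcond.
transitivity (fine (\int[m1]_x fubini_F m2 (EFin \o g) x)%E).
  by congr fine; rewrite integral12_prod_meas1.
congr fine; apply: ae_eq_integral => //.
- exact: measurable_int Fi.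
- apply/measurable_EFinP.
  rewrite -(_ : (fun x => fine (\int[m2]_y (g (x, y))%:E)%E) =
    ((fun x => \int[m2]_(y in B) f (x, y)) \_ A)); last exact/funext.
  by apply: measurableT_comp; [exact: fine_measurable|exact: measurable_int Fi].
- have := integrable_ae measurableT Fi; apply: filterS => x /(_ Logic.I) h _.
  by rewrite -F_E fineK.
Qed.

Lemma Rintegral_prod2 : \int[(m1 \x m2)%E]_(z in A `*` B) f z =
  \int[m2]_(y in B) \int[m1]_(x in A) f (x, y).
Proof.
have mG := measurable_fubini_G gi.
rewrite Rintegral_mkcond [RHS]Rintegral_mkcond.
transitivity (fine (\int[m2]_y fubini_G m1 (EFin \o g) y)%E).
  by congr fine; rewrite integral21_prod_meas1.
congr fine; apply: ae_eq_integral => //.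
- apply/measurable_EFinP.
  rewrite -(_ : (fun y => fine (\int[m1]_x (g (x, y))%:E)%E) =
    ((fun y => \int[m1]_(x in A) f (x, y)) \_ B)); last exact/funext.
  by apply: measurableT_comp; [exact: fine_measurable|exact: mG].
- have := ae_integrable2 gi; apply: filterS => y h _.
  by rewrite -G_E fineK//; exact: integrable_fin_num h.
Qed.

End Fubini_on_products.

Local Notation basis := Defs.basis.

(** * The divergence theorem on the square and integration by parts against traces *)

Section Green.
Context {R : realType}.
Local Notation R2 := (measurableTypeR R * measurableTypeR R)%type.
Local Notation leb := (@lebesgue_measure R).

(** The difference quotients along a coordinate vector are literally those of the one-variable
    section, so existence and value of the derivative transfer together. *)
Lemma derive_basis0 (F : R * R -> R) (x y : R) :
  (derivable F (x, y) (basis (0%R : 'I_2)) <-> derivable (fun s => F (s, y)) x 1) /\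
  'D_(basis (0%R : 'I_2)) F (x, y) = (fun s => F (s, y))^`()%classic x.
Proof.
have E : (fun h : R => h^-1 *: ((F \o shift (x, y)) (h *: basis (0%R : 'I_2)) - F (x, y))) =
    (fun h : R => h^-1 *: (((fun s => F (s, y)) \o shift x) (h *: 1) - F (x, y))).
  apply/funext => h /=; congr (_ *: (F _ - _)).
  by rewrite /basis eqxx /= /shift/=; congr pair; rewrite /= ?[_ *: 0]mulr0 ?add0r.
by rewrite /derivable derive1E /derive E.
Qed.

Lemma derive_basis1 (F : R * R -> R) (x y : R) :
  (derivable F (x, y) (basis (1%R : 'I_2)) <-> derivable (fun s => F (x, s)) y 1) /\
  'D_(basis (1%R : 'I_2)) F (x, y) = (fun s => F (x, s))^`()%classic y.
Proof.
have E : (fun h : R => h^-1 *: ((F \o shift (x, y)) (h *: basis (1%R : 'I_2)) - F (x, y))) =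
    (fun h : R => h^-1 *: (((fun s => F (x, s)) \o shift y) (h *: 1) - F (x, y))).
  apply/funext => h /=; congr (_ *: (F _ - _)).
  by rewrite /basis /= /shift/=; congr pair; rewrite /= ?[_ *: 0]mulr0 ?add0r.
by rewrite /derivable derive1E /derive E.
Qed.

Lemma cont_section1 (F : R * R -> R) (y : R) : continuous F -> continuous (fun s => F (s, y)).
Proof.
move=> cF s; apply: continuous_comp; last exact: cF.
exact: (cvg_pair cvg_id (cvg_cst _)).
Qed.

Lemma cont_section2 (F : R * R -> R) (x : R) : continuous F -> continuous (fun s => F (x, s)).
Proof.
move=> cF s; apply: continuous_comp; last exact: cF.
exact: (cvg_pair (cvg_cst _) cvg_id).
Qed.

Lemma Rintegral_deriv01 (F f : R -> R) : continuous f ->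
  (forall x : R, is_derive x (1 : R) F (f x)) ->
  \int[leb]_(x in `]0, 1[) f x = F 1 - F 0.
Proof.
move=> cf dF.
have cF : continuous F.
  by move=> x; apply: differentiable_continuous; apply/derivable1_diffP; exact: (@ex_derive _ _ _ _ _ _ _ (dF x)).
have fi : leb.-integrable `[0, 1] (EFin \o f).
  by apply: continuous_compact_integrable; [exact: segment_compact|exact: continuous_subspaceT].
have fi1 : leb.-integrable `]0, 1] (EFin \o f).
  by apply: integrableS fi => //; exact: subset_itv_oc_cc.
have fi2 : leb.-integrable `]0, 1[ (EFin \o f).
  by apply: integrableS fi => //; exact: subset_itv_oo_cc.
rewrite Rintegral_itv_bndo_bndc// Rintegral_itv_obnd_cbnd//.
rewrite /Rintegral (@continuous_FTC2 _ f F)//.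
- exact: continuous_subspaceT.
- split => [x _||].
  + exact: (@ex_derive _ _ _ _ _ _ _ (dF x)).
  + by apply: cvg_at_right_filter; exact: cF.
  + by apply: cvg_at_left_filter; exact: cF.
- by move=> x _; rewrite derive1E (@derive_val _ _ _ _ _ _ _ (dF x)).
Qed.

Lemma cont_square_bounded (F : R * R -> R) : continuous F ->
  exists M, forall x, (`[0, 1]%classic `*` `[0, 1]%classic) x -> `|F x| <= M.
Proof.
move=> cF.
have /compact_bounded[M [_ MF]] : compact (F @` (`[0, 1]%classic `*` `[0, 1]%classic)).
  apply: continuous_compact; first exact: continuous_subspaceT.
  by apply: compact_setX; exact: segment_compact.
exists (M + 1) => x Ax; apply: (MF (M + 1)); first by rewrite ltrDl.
by exists x.
Qed.

Lemma sub_Omega_square : @Omega R `<=` (`[0, 1]%classic `*` `[0, 1]%classic).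
Proof. by move=> x [/= h1 h2]; split; exact: subset_itv_oo_cc. Qed.

Lemma cont_Omega_integrable (F : R * R -> R) : continuous F ->
  leb2.-integrable (@Omega R : set R2) (EFin \o F).
Proof.
move=> cF; have [M FM] := cont_square_bounded cF.
apply: measurable_bounded_integrable.
- exact: measurable_Omega.
- exact: leb2_Omega_lty.
- exact: measurable_cont_plane.
- exists M; split; first exact: num_real.
  by move=> N MN x /sub_Omega_square Ox; rewrite /= (le_trans (FM _ Ox))// ltW.
Qed.

Lemma measurable_normal i : measurable_fun [set: R2] (@normal R i).
Proof.
have mc : measurable_fun [set: R2] (@coordinate R i).
  have -> : @coordinate R i = if i == 0 then fst else snd.
    by apply/funext => x; rewrite /coordinate; case: ifP.
  by case: ifP => _; [exact: measurable_fst|exact: measurable_snd].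
have me (c : R) : measurable_fun [set: R2] (fun x : R2 => (coordinate i x == c)%:R : R).
  rewrite (_ : (fun _ => _) = \1_[set x : R2 | coordinate i x = c]); last first.
    apply/funext => x; rewrite indicE; congr (nat_of_bool _)%:R.
    by apply/eqP/idP => [h|/set_mem//]; exact/mem_set.
  apply: measurable_indic; rewrite -[X in measurable X]setTI.
  rewrite (_ : [set x | _] = coordinate i @^-1` [set c])//.
  by apply: mc => //; exact: measurable_set1.
exact: measurable_funB.
Qed.

Lemma normal_le1 i (x : R * R) : `|normal i x| <= 1.
Proof.
rewrite /normal; case: eqP => [->|_]; case: eqP => [/eqP|_]; rewrite /= ?oner_eq0//;
  by rewrite ?subr0 ?sub0r ?normrN ?normr1 ?normr0.
Qed.

Lemma sub_dOmega_square : @dOmega R `<=` (`[0, 1]%classic `*` `[0, 1]%classic).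
Proof. by move=> x []. Qed.

(** Only the two edges orthogonal to the [i]-th direction contribute; along the other two, this
    component of the normal vanishes except at the end points. *)
Lemma boundary_integral (F : R * R -> R) i : continuous F ->
  \int[arc_length]_(x in dOmega) (normal i x * F x) =
  \int[leb]_(s in `]0, 1[) (if i == 0 then F (1, s) else F (s, 1)) -
  \int[leb]_(s in `]0, 1[) (if i == 0 then F (0, s) else F (s, 0)).
Proof.
move=> cF; have [M FM] := cont_square_bounded cF.
have mF := measurable_cont_plane (D := setT) cF.
have mh : measurable_fun [set: R2] ((fun x => normal i x * F x) \_ dOmega).
  apply/(measurable_restrictT _ measurable_dOmega); apply: measurable_funTS.
  by apply: measurable_funM => //; exact: measurable_normal.
have M0 : 0 <= M by apply: le_trans (FM (0, 0) _) => //; split => /=; rewrite in_itv/= lexx ler01.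
have hM (x : R2) : `|((fun x => normal i x * F x) \_ dOmega) x| <= M.
  rewrite /patch; case: ifPn => [/set_mem/sub_dOmega_square Dx|_]; last by rewrite normr0.
  by rewrite normrM -[leRHS]mul1r ler_pM// ?normal_le1// FM.
transitivity (\int[arc_length]_(x in dOmega) ((fun x => normal i x * F x) \_ dOmega) x).
  by apply: eq_Rintegral => x Dx; rewrite /patch Dx.
rewrite (Rintegral_arc_length mh hM) (sum_edges (fun k => \int[leb1]_(s in `[0, 1]) ((fun x => normal i x * F x) \_ dOmega) (edge k s))).
(* Passing to the open interval removes the corners, where [normal] also has the component of the
   adjacent edge. *)
have E k : \int[leb1]_(s in `[0, 1]) ((fun x => normal i x * F x) \_ dOmega) (edge k s) =
    \int[leb]_(s in `]0, 1[) (normal i (edge k s) * F (edge k s)).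
  have hi := integrable_edge k mh hM.
  transitivity (\int[leb]_(s in `]0, 1[) ((fun x => normal i x * F x) \_ dOmega) (edge k s)).
    rewrite Rintegral_itv_bndo_bndc; first rewrite Rintegral_itv_obnd_cbnd//.
      by apply: integrableS hi => //; exact: subset_itv_oc_cc.
    by apply: integrableS hi => //; exact: subset_itv_oo_cc.
  apply: eq_Rintegral => s /set_mem /= s01; rewrite /patch mem_set//.
  by apply: edge_dOmega; exact: subset_itv_oo_cc.
rewrite !E /normal /coordinate /edge.
have Z (c : R -> R) (G : R -> R) : {in `]0, 1[%classic, c =1 cst 0} ->
    \int[leb]_(s in `]0, 1[) (c s * G s) = 0.
  move=> c0; rewrite (@eq_Rintegral _ _ _ _ _ (fun=> 0)); first by rewrite Rintegral_cst// mul0r.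
  by move=> s /c0 ->; rewrite mul0r.
have z01 : {in `]0, 1[%classic, (fun s : R => (s == 1)%:R - (s == 0)%:R : R) =1 cst 0}.
  move=> s /set_mem /=; rewrite in_itv/= => /andP[s0 s1].
  by rewrite (gt_eqF s0) (lt_eqF s1) subrr.
have i01 (G : R -> R) : continuous G -> leb.-integrable `]0, 1[ (EFin \o G).
  move=> cG; have : leb.-integrable `[0, 1] (EFin \o G).
    by apply: continuous_compact_integrable; [exact: segment_compact|exact: continuous_subspaceT].
  by apply: integrableS => //; exact: subset_itv_oo_cc.
have z0 (G : R -> R) : \int[leb]_(s in `]0, 1[) (((s == 1)%:R - (s == 0)%:R) * G s) = 0.
  exact: (Z (fun s => (s == 1)%:R - (s == 0)%:R)).
have z1 (G : R -> R) : continuous G -> \int[leb]_(s in `]0, 1[)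
    ((((0 : R) == 1)%:R - ((0 : R) == 0)%:R) * G s) = - \int[leb]_(s in `]0, 1[) G s.
  by move=> cG; rewrite eq_sym oner_eq0 eqxx sub0r RintegralZl ?mulN1r//; exact: i01.
have z2 (G : R -> R) : \int[leb]_(s in `]0, 1[)
    ((((1 : R) == 1)%:R - ((1 : R) == 0)%:R) * G s) = \int[leb]_(s in `]0, 1[) G s.
  by rewrite oner_eq0 eqxx subr0; under eq_Rintegral do rewrite mul1r.
have [_|i0] := eqVneq i 0.
  rewrite [X in X + _ + _ + _](z0 (fun s => F (s, 0))).
  rewrite [X in _ + X + _ + _](z0 (fun s => F (s, 1))) !add0r.
  rewrite [X in X + _](z1 (fun s => F (0, s)) (@cont_section2 F 0 cF)).
  by rewrite [X in _ + X](z2 (fun s => F (1, s))) addrC.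
rewrite [X in X + _ + _ + _](z1 (fun s => F (s, 0)) (@cont_section1 F 0 cF)).
rewrite [X in _ + X + _ + _](z2 (fun s => F (s, 1))).
rewrite [X in _ + X + _](z0 (fun s => F (0, s))).
by rewrite [X in _ + X](z0 (fun s => F (1, s))) !addr0 addrC.
Qed.

(** Fubini with the differentiated variable innermost, then the fundamental theorem of calculus on
    each segment. *)
Lemma divergence_smooth (F : R * R -> R) i : continuous F ->
  (forall x, derivable F x (basis i)) -> continuous ('D_(basis i) F) ->
  \int[leb2]_(x in Omega) 'D_(basis i) F x =
  \int[arc_length]_(x in dOmega) (normal i x * F x).
Proof.
move=> cF dF cdF; rewrite boundary_integral//.
have Oi := cont_Omega_integrable cdF.
have i01 (G : R -> R) : continuous G -> leb.-integrable `]0, 1[ (EFin \o G).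
  move=> cG; have : leb.-integrable `[0, 1] (EFin \o G).
    by apply: continuous_compact_integrable; [exact: segment_compact|exact: continuous_subspaceT].
  by apply: integrableS => //; exact: subset_itv_oo_cc.
have [i0|i0] := eqVneq i 0.
  rewrite i0 in dF cdF Oi *.
  rewrite -RintegralB//; [|exact/i01/cont_section2|exact/i01/cont_section2].
  transitivity (\int[leb]_(y in `]0, 1[) \int[leb]_(x in `]0, 1[) 'D_(basis 0) F (x, y)).
    by apply: (Rintegral_prod2 (m1 := leb) (m2 := leb)); [exact: measurable_itv|exact: measurable_itv|exact: Oi].
  apply: eq_Rintegral => y _.
  have dE x : 'D_(basis 0) F (x, y) = (fun s => F (s, y))^`()%classic x.
    by have [_ ->] := derive_basis0 F x y.
  apply: (@Rintegral_deriv01 (fun s => F (s, y)) (fun x => 'D_(basis 0) F (x, y))).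
    exact: (@cont_section1 ('D_(basis 0) F) y cdF).
  move=> x; rewrite dE derive1E; apply: DeriveDef => //.
  exact ((derive_basis0 F x y).1.1 (dF (x, y))).
have {i0} i1 : i = 1 by apply/val_inj; case: i i0 {dF cdF Oi} => -[|[|?]].
rewrite i1 in dF cdF Oi *.
rewrite -RintegralB//; [|exact/i01/cont_section1|exact/i01/cont_section1].
transitivity (\int[leb]_(x in `]0, 1[) \int[leb]_(y in `]0, 1[) 'D_(basis 1) F (x, y)).
  by apply: (Rintegral_prod1 (m1 := leb) (m2 := leb)); [exact: measurable_itv|exact: measurable_itv|exact: Oi].
apply: eq_Rintegral => x _.
have dE y : 'D_(basis 1) F (x, y) = (fun s => F (x, s))^`()%classic y.
  by have [_ ->] := derive_basis1 F x y.
apply: (@Rintegral_deriv01 (fun s => F (x, s)) (fun y => 'D_(basis 1) F (x, y))).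
  exact: (@cont_section2 ('D_(basis 1) F) x cdF).
move=> y; rewrite dE derive1E; apply: DeriveDef => //.
exact ((derive_basis1 F x y).1.1 (dF (x, y))).
Qed.

(* Integration by parts against the trace: both sides pass to the limit along
   the smooth functions that define the trace. *)
Lemma trace_integral_by_parts (w gamma v : R * R -> R) i : is_trace w gamma ->
  smooth v ->
  \int[leb2]_(x in Omega) (wpartial i w x * v x) =
  \int[arc_length]_(x in dOmega) (gamma x * (normal i x * v x)) -
  \int[leb2]_(x in Omega) (w x * 'D_(basis i) v x).
Proof.
move=> [[wL2 H1w] gL2 [s [sm sw sdw sg]]] smv.
have [cv dv] := smv 1%N; have {dv} [dv cdv] := dv i.
have cs n : continuous (s n) by exact: (sm n 0%N).
have ds n x : derivable (s n) x (basis i) by have [_ /(_ i)[]] := sm n 1%N.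
have cds n : continuous ('D_(basis i) (s n)) by have [_ /(_ i)[]] := sm n 1%N.
have wpL2 : L2Omega (wpartial i w) by have [v0 hv0] := H1w i; have [] := getPex (ex_intro _ v0 hv0).
have mO := measurable_Omega (R := R).
have mdO := measurable_dOmega (R := R).
have bO (k : R * R -> R) : continuous k -> exists M, forall x, Omega x -> `|k x| <= M.
  by move=> /cont_square_bounded[M kM]; exists M => x /sub_Omega_square/kM.
(* The divergence theorem for [s n * v], split by the product rule. *)
have key n : \int[leb2]_(x in Omega) ('D_(basis i) (s n) x * v x) =
  \int[arc_length]_(x in dOmega) (s n x * (normal i x * v x)) -
  \int[leb2]_(x in Omega) (s n x * 'D_(basis i) v x).
  have cp (a b : R * R -> R) : continuous a -> continuous b -> continuous (a \* b).
    by move=> ca cb x; apply: continuousM; [exact: ca|exact: cb].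
  have dE : 'D_(basis i) (s n * v) = (fun x => 'D_(basis i) (s n) x * v x + s n x * 'D_(basis i) v x).
    apply/funext => x; rewrite deriveM//= addrC; congr (_ + _).
    by rewrite mulrC.
  have := @divergence_smooth (s n * v) i (cp _ _ (cs n) cv).
  rewrite dE => /(_ _ _).
  have -> : (fun x => normal i x * (s n * v) x) = (fun x => s n x * (normal i x * v x)).
    by apply/funext => x /=; rewrite mulrCA.
  move=> <-.
  - rewrite RintegralD ?addrK//.
    + exact: (cont_Omega_integrable (cp _ _ (cds n) cv)).
    + exact: (cont_Omega_integrable (cp _ _ (cs n) cdv)).
  - by move=> x; apply: derivableM.
  - move=> x; apply: (@continuousD _ _ _ (fun x => 'D_(basis i) (s n) x * v x)
      (fun x => s n x * 'D_(basis i) v x)).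
    + exact: (cp _ _ (cds n) cv).
    + exact: (cp _ _ (cs n) cdv).
have mv := measurable_cont_plane (D := Omega) cv.
have mdv := measurable_cont_plane (D := Omega) cdv.
have c1 : \int[leb2]_(x in Omega) ('D_(basis i) (s n) x * v x) @[n --> \oo] -->
    \int[leb2]_(x in Omega) (wpartial i w x * v x).
  apply: Lp2_cvg_Rintegral => //.
  - exact: leb2_Omega_lty.
  - by near=> n; exact: cont_Omega_integrable.
  - exact: bO.
  - exact: sdw.
have c2 : \int[leb2]_(x in Omega) (s n x * 'D_(basis i) v x) @[n --> \oo] -->
    \int[leb2]_(x in Omega) (w x * 'D_(basis i) v x).
  apply: Lp2_cvg_Rintegral => //.
  - exact: leb2_Omega_lty.
  - by near=> n; exact: cont_Omega_integrable.
  - exact: bO.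
have c3 : \int[arc_length]_(x in dOmega) (s n x * (normal i x * v x)) @[n --> \oo] -->
    \int[arc_length]_(x in dOmega) (gamma x * (normal i x * v x)).
  apply: Lp2_cvg_Rintegral => //.
  - exact: arc_length_fin.
  - near=> n; have [M sM] := cont_square_bounded (cs n).
    apply: measurable_bounded_integrable => //.
    + exact: arc_length_fin.
    + exact: measurable_cont_plane.
    + exists M; split; first exact: num_real.
      by move=> N MN x /sub_dOmega_square Ox; rewrite /= (le_trans (sM _ Ox))// ltW.
  - apply: measurable_funM; first by apply: measurable_funTS; exact: measurable_normal.
    exact: measurable_cont_plane.
  - have [M vM] := cont_square_bounded cv; exists M => x /sub_dOmega_square Dx.
    by rewrite normrM -[leRHS]mul1r ler_pM// ?normal_le1// vM.
apply: (cvg_unique (@Rhausdorff R) c1).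
rewrite (_ : (fun n => _) = (fun n => \int[arc_length]_(x in dOmega) (s n x * (normal i x * v x)))
  \- (fun n => \int[leb2]_(x in Omega) (s n x * 'D_(basis i) v x))); last exact/funext.
exact: cvgB c3 c2.
Unshelve. all: by end_near. Qed.

End Green.

(** * Iterated integrals of a product of two integrable functions against a bounded kernel *)

Section product_kernels.
Context d1 d2 (T1 : measurableType d1) (T2 : measurableType d2) (R : realType).
Variables (m1 : {sigma_finite_measure set T1 -> \bar R})
  (m2 : {sigma_finite_measure set T2 -> \bar R}).
Variables (A : set T1) (B : set T2) (f : T1 -> R) (g : T2 -> R).
Hypotheses (mA : measurable A) (mB : measurable B)
  (fi : m1.-integrable A (EFin \o f)) (gi : m2.-integrable B (EFin \o g)).

Lemma integrable_tensor :
  (m1 \x m2)%E.-integrable (A `*` B) (EFin \o (fun z => f z.1 * g z.2)).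
Proof.
have mAB : measurable (A `*` B) by exact: measurableX.
pose f0 := f \_ A; pose g0 := g \_ B.
have mf0 : measurable_fun setT f0.
  by apply/(measurable_restrictT _ mA)/measurable_EFinP; exact: measurable_int fi.
have mg0 : measurable_fun setT g0.
  by apply/(measurable_restrictT _ mB)/measurable_EFinP; exact: measurable_int gi.
have fi0 : m1.-integrable setT (EFin \o f0).
  by rewrite /f0 -restrict_EFin; apply/(integrable_mkcond _ mA).
have gi0 : m2.-integrable setT (EFin \o g0).
  by rewrite /g0 -restrict_EFin; apply/(integrable_mkcond _ mB).
have i0 : (m1 \x m2)%E.-integrable setT (EFin \o (fun z => f0 z.1 * g0 z.2)).
  apply/integrable12ltyP.
    apply/measurable_EFinP; apply: measurable_funM.
      exact: measurableT_comp mf0 measurable_fst.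
    exact: measurableT_comp mg0 measurable_snd.
  have mng : measurable_fun setT (fun y => `|g0 y|%:E).
    by apply/measurable_EFinP; exact: measurableT_comp.
  have mnf : measurable_fun setT (fun x => `|f0 x|%:E).
    by apply/measurable_EFinP; exact: measurableT_comp.
  have /integrableP[_ gf] := gi0; have /integrableP[_ ff] := fi0.
  pose K := fine (\int[m2]_y `|g0 y|%:E)%E.
  have KE : (\int[m2]_y `|g0 y|%:E)%E = K%:E.
    rewrite fineK// ge0_fin_numE//; exact: integral_ge0.
  have -> : (\int[m1]_x \int[m2]_y `|(EFin \o (fun z : T1 * T2 => (f0 z.1 * g0 z.2)%R)) (x, y)| =
      \int[m1]_x (`|f0 x|%:E * K%:E))%E.
    apply: eq_integral => x _ /=.
    rewrite -KE -ge0_integralZl//; first by apply: eq_integral => y _; rewrite normrM EFinM.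
  have K0 : (0 <= K%:E)%E by rewrite -KE; exact: integral_ge0.
  have F0 : (0 <= \int[m1]_x `|f0 x|%:E)%E by exact: integral_ge0.
  have Ffin : (\int[m1]_x `|f0 x|%:E)%E \is a fin_num by rewrite ge0_fin_numE.
  by rewrite ge0_integralZr// -(fineK Ffin) -EFinM ltry.
apply: (eq_integrable mAB) (integrableS measurableT mAB (@subsetT _ _) i0) => -[x y] /set_mem[/= Ax By].
by rewrite /f0 /g0 /patch !mem_set.
Qed.

Lemma integrable_product_kernel (k : T1 * T2 -> R) M : measurable_fun (A `*` B) k ->
  (forall z, (A `*` B) z -> `|k z| <= M) ->
  (m1 \x m2)%E.-integrable (A `*` B) (EFin \o (fun z => f z.1 * g z.2 * k z)).
Proof.
move=> mk kM; apply: (integrable_mul_bounded _ integrable_tensor mk kM).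
exact: measurableX.
Qed.

(** A tensor product of integrable functions is integrable, and a bounded jointly measurable kernel
    keeps it so. All exchanges of a frequency integral with a space integral in the inversion
    formulas are instances. *)
Lemma Rintegral_swap (k : T1 * T2 -> R) M : measurable_fun (A `*` B) k ->
  (forall z, (A `*` B) z -> `|k z| <= M) ->
  \int[m1]_(x in A) (f x * \int[m2]_(y in B) (g y * k (x, y))) =
  \int[m2]_(y in B) (g y * \int[m1]_(x in A) (f x * k (x, y))).
Proof.
move=> mk kM; have ki := integrable_product_kernel mk kM.
have mkx x : A x -> measurable_fun B (fun y => k (x, y)).
  move=> Ax; have mAB : measurable (A `*` B) by exact: measurableX.
  have mk0 : measurable_fun setT (k \_ (A `*` B)) by exact/(measurable_restrictT _ mAB).
  move: (measurableT_comp mk0 (pair1_measurable x)) => /(measurable_funS measurableT (@subsetT _ B)); apply: eq_measurable_fun => y /set_mem By.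
  by rewrite /= /patch mem_set.
have mky y : B y -> measurable_fun A (fun x => k (x, y)).
  move=> By; have mAB : measurable (A `*` B) by exact: measurableX.
  have mk0 : measurable_fun setT (k \_ (A `*` B)) by exact/(measurable_restrictT _ mAB).
  move: (measurableT_comp mk0 (pair2_measurable y)) => /(measurable_funS measurableT (@subsetT _ A)); apply: eq_measurable_fun => x /set_mem Ax.
  by rewrite /= /patch mem_set.
transitivity (\int[(m1 \x m2)%E]_(z in A `*` B) (f z.1 * g z.2 * k z)).
  rewrite (@Rintegral_prod1 _ _ _ _ _ m1 m2 A B (fun z => f z.1 * g z.2 * k z))//.
  apply: eq_Rintegral => x /set_mem Ax; rewrite -RintegralZl//.
    by apply: eq_Rintegral => y _; rewrite /= mulrA.
  by apply: (@integrable_mul_bounded _ _ _ _ _ _ _ M) => // [|y By]; [exact: mkx|exact: kM].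
rewrite (@Rintegral_prod2 _ _ _ _ _ m1 m2 A B (fun z => f z.1 * g z.2 * k z))//.
apply: eq_Rintegral => y /set_mem By; rewrite -RintegralZl//.
  by apply: eq_Rintegral => x _; rewrite /= mulrCA mulrA.
by apply: (@integrable_mul_bounded _ _ _ _ _ _ _ M) => // [|x Ax]; [exact: mky|exact: kM].
Qed.

Lemma Rintegral_tensor :
  \int[(m1 \x m2)%E]_(z in A `*` B) (f z.1 * g z.2) =
  (\int[m1]_(x in A) f x) * (\int[m2]_(y in B) g y).
Proof.
rewrite (@Rintegral_prod1 _ _ _ _ _ m1 m2 A B (fun z => f z.1 * g z.2))//; last exact: integrable_tensor.
by rewrite -RintegralZr//; apply: eq_Rintegral => x _; rewrite -RintegralZl.
Qed.

End product_kernels.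

(** * Weak derivatives and Green's identity *)

Section smooth_functions.
Context {R : realType}.
Local Notation R2 := (measurableTypeR R * measurableTypeR R)%type.

(** The powers [x^(-m)] in front of [exp (-1/x)] make the family stable under differentiation up to
    linear combinations: the derivative of the [m]-th member involves the members [m + 2] and
    [m + 1]. *)
Definition bump (m : nat) (x : R) : R :=
  if 0 < x then x^-1 ^+ m * expR (- x^-1) else 0.

Lemma bump_ge0 m x : 0 <= bump m x.
Proof.
rewrite /bump; case: ifP => // x0.
by rewrite mulr_ge0 ?expR_ge0// exprn_ge0// invr_ge0 ltW.
Qed.

(** From [y^(m+2) / (m+2)! <= exp y] at [y = 1/x]. The square of [x] on the right is what makes the
    derivative at the origin zero. *)
Lemma bump_le m x : bump m x <= (m.+2)`!%:R * x ^+ 2.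
Proof.
rewrite /bump; case: ifPn => [x0|_]; last by rewrite mulr_ge0// sqr_ge0.
have y0 : 0 < x^-1 by rewrite invr_gt0.
have := expR_ge1Dxn m.+1 (ltW y0).
set y := x^-1 in y0 *; have -> : x = y^-1 by rewrite /y invrK.
move=> h; rewrite expRN ler_pdivrMr ?expR_gt0//.
rewrite [y^-1 ^+ 2]exprVn mulrAC ler_pdivlMr ?exprn_gt0// -exprD addn2.
rewrite mulrC -ler_pdivrMr ?ltr0n ?fact_gt0//.
by apply: le_trans h; rewrite lerDr.
Qed.

Lemma bump0_le1 x : bump 0 x <= 1.
Proof.
rewrite /bump; case: ifP => // x0; rewrite expr0 mul1r.
by rewrite -expR0 ler_expR oppr_le0 invr_ge0 ltW.
Qed.

Lemma is_derive_bump m (x : R) :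
  is_derive x (1 : R) (bump m) (bump m.+2 x - m%:R * bump m.+1 x).
Proof.
have [x0|x0|->] := ltrgt0P x.
- have E : \forall y \near x, (fun y : R => y^-1 ^+ m * expR (- y^-1)) y = bump m y.
    near=> y; rewrite /bump ifT//; near: y; exact: lt_nbhsr.
  have xn0 : id x != 0 by rewrite gt_eqF.
  apply: (@near_eq_is_derive _ _ _ (fun y : R => y^-1 ^+ m * expR (- y^-1))) => //.
  have dV := is_deriveV xn0 (is_derive_id x (1 : R)).
  have dE := @is_derive1_comp _ expR _ x _ _ (is_derive_expR _) (is_deriveN dV).
  have dM := is_deriveM (is_deriveX m dV) dE.
  move: dM; rewrite (_ : (fun y : R => y^-1) ^+ m * _ = (fun y : R => y^-1 ^+ m * expR (- y^-1))); last first.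
    by apply/funext => y; rewrite mulrfctE exprfctE compE opprfctE.
  move=> dM; apply: is_derive_eq dM _.
  rewrite /bump x0 /= fctE; rewrite -!/(_ * _) /GRing.scale /=.
  rewrite ?fctE /=; set y := x^-1.
  rewrite -exprVn -/y mulr1; case: m {E} => [|m] /=; rewrite !exprS; ring.
- have E : \forall y \near x, (fun=> 0) y = bump m y.
    near=> y; rewrite /bump ifF//; apply/negbTE; rewrite -leNgt ltW//.
    near: y; exact: lt_nbhsl.
  apply: (@near_eq_is_derive _ _ _ (fun=> 0 : R)) => //.
  have -> : bump m.+2 x - m%:R * bump m.+1 x = 0.
    by rewrite /bump ltNge (ltW x0)/= mulr0 subr0.
  exact: is_derive_cst.
- have b0 k : bump k (0 : R) = 0 by rewrite /bump ltxx.
  rewrite !b0 mulr0 subr0.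
  (* By [bump_le] the difference quotient at the origin is at most [(m+2)! |h|]. *)
  suff H : (fun h : R => h^-1 *: ((bump m \o shift 0) (h *: 1) - bump m 0)) h @[h --> 0^'] --> (0 : R).
    apply: DeriveDef; first by apply/cvg_ex; exists 0.
    exact: (cvg_lim (@Rhausdorff R) H).
  apply/cvgrPdist_le => e e0; near=> h.
  have h0 : h != 0 by near: h; exact: nbhs_dnbhs_neq.
  rewrite sub0r normrN /= b0 subr0 addr0 [_ *: 1]mulr1 [_ *: _]/(_ * _) normrM.
  rewrite normfV ler_pdivrMl ?normr_gt0// ger0_norm ?bump_ge0//.
  apply: (le_trans (bump_le m h)).
  rewrite -[h ^+ 2]real_normK ?num_real//.
  rewrite expr2 mulrCA ler_wpM2l//.
  rewrite mulrC -ler_pdivlMr ?ltr0n ?fact_gt0//.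
  near: h; apply: dnbhs0_le; rewrite divr_gt0// ltr0n fact_gt0.
Unshelve. all: by end_near. Qed.

(** A class closed under differentiation by construction. It contains the trigonometric factors, the
    cutoffs and their products, so smoothness of all orders follows by induction on the order. *)
Inductive smooth1 : (R -> R) -> Prop :=
| smooth1_sin a b : smooth1 (fun x => sin (a * x + b))
| smooth1_bump m a b : smooth1 (fun x => bump m (a * x + b))
| smooth1_cst c : smooth1 (fun=> c)
| smooth1_add p q : smooth1 p -> smooth1 q -> smooth1 (fun x => p x + q x)
| smooth1_mul p q : smooth1 p -> smooth1 q -> smooth1 (fun x => p x * q x).

Lemma is_derive_affine (a b x : R) : is_derive x (1 : R) (fun x => a * x + b) a.
Proof.
have := is_deriveD (is_deriveZ a (is_derive_id x (1 : R))) (is_derive_cst b x (1 : R)).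
move=> h; apply: is_derive_eq h _; by rewrite addr0 [_ *: _]mulr1.
Qed.

Lemma smooth1_derive p : smooth1 p ->
  exists2 p', smooth1 p' & forall x : R, is_derive x (1 : R) p (p' x).
Proof.
elim=> [a b|m a b|c|p1 q1 _ [p' sp' dp] _ [q' sq' dq]|p1 q1 sp [p' sp' dp] sq [q' sq' dq]].
(* Differentiation advances the phase by a quarter period, so one trigonometric constructor covers
   sine and cosine. *)
- exists (fun x => sin (a * x + (b + pi / 2)) * a).
    by apply: smooth1_mul; [exact: smooth1_sin|exact: smooth1_cst].
  move=> x; rewrite addrA sinDpihalf.
  exact: (@is_derive1_comp _ sin _ x _ _ (is_derive_sin _) (is_derive_affine a b x)).
- exists (fun x => (bump m.+2 (a * x + b) + (- m%:R) * bump m.+1 (a * x + b)) * a).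
    apply: smooth1_mul; last exact: smooth1_cst.
    apply: smooth1_add; first exact: smooth1_bump.
    by apply: smooth1_mul; [exact: smooth1_cst|exact: smooth1_bump].
  move=> x; rewrite mulNr.
  exact: (@is_derive1_comp _ (bump m) _ x _ _ (is_derive_bump _ _) (is_derive_affine a b x)).
- by exists (fun=> 0) => [|x]; [exact: smooth1_cst|exact: is_derive_cst].
- exists (fun x => p' x + q' x) => [|x]; first exact: smooth1_add.
  exact: is_deriveD (dp x) (dq x).
- exists (fun x => p1 x * q' x + q1 x * p' x) => [|x].
    by apply: smooth1_add; exact: smooth1_mul.
  exact: is_deriveM (dp x) (dq x).
Qed.

Lemma smooth1_continuous p : smooth1 p -> continuous p.
Proof.
move=> /smooth1_derive[p' _ dp] x; apply: differentiable_continuous.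
apply/derivable1_diffP; exact: (@ex_derive _ _ _ _ _ _ _ (dp x)).
Qed.

Lemma smooth1_cos a b : smooth1 (fun x => cos (a * x + b)).
Proof.
rewrite (_ : (fun x => _) = (fun x => sin (a * x + (b + pi / 2)))); first exact: smooth1_sin.
by apply/funext => x; rewrite addrA sinDpihalf.
Qed.

Definition tensor (p q : R -> R) (x : R * R) : R := p x.1 * q x.2.

Lemma tensor_continuous p q : smooth1 p -> smooth1 q -> continuous (tensor p q).
Proof.
move=> /smooth1_continuous cp /smooth1_continuous cq x.
apply: (@continuousM _ _ (fun x => p x.1) (fun x => q x.2)).
- by apply: continuous_comp; [exact: cvg_fst|exact: cp].
- by apply: continuous_comp; [exact: cvg_snd|exact: cq].
Qed.

Lemma tensor_derive0 p q p' : (forall x : R, is_derive x (1 : R) p (p' x)) ->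
  (forall x, derivable (tensor p q) x (basis 0)) /\ 'D_(basis 0) (tensor p q) = tensor p' q.
Proof.
move=> dp.
have d (x y : R) : is_derive x (1 : R) (fun s => tensor p q (s, y)) (p' x * q y).
  have := is_deriveM (dp x) (is_derive_cst (q y) x (1 : R)).
  move=> h; apply: is_derive_eq h _.
  by rewrite [_ *: _]mulr0 add0r [_ *: _]mulrC.
split=> [[x y]|].
  by apply/(derive_basis0 _ _ _).1; exact: (@ex_derive _ _ _ _ _ _ _ (d x y)).
apply/funext => -[x y].
by rewrite (derive_basis0 _ _ _).2 derive1E (@derive_val _ _ _ _ _ _ _ (d x y)).
Qed.

Lemma tensor_derive1 p q q' : (forall x : R, is_derive x (1 : R) q (q' x)) ->
  (forall x, derivable (tensor p q) x (basis 1)) /\ 'D_(basis 1) (tensor p q) = tensor p q'.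
Proof.
move=> dq.
have d (x y : R) : is_derive y (1 : R) (fun s => tensor p q (x, s)) (p x * q' y).
  have := is_deriveM (is_derive_cst (p x) y (1 : R)) (dq y).
  move=> h; apply: is_derive_eq h _.
  by rewrite [_ *: 0]mulr0 addr0.
split=> [[x y]|].
  by apply/(derive_basis1 _ _ _).1; exact: (@ex_derive _ _ _ _ _ _ _ (d x y)).
apply/funext => -[x y].
by rewrite (derive_basis1 _ _ _).2 derive1E (@derive_val _ _ _ _ _ _ _ (d x y)).
Qed.

Lemma tensor_smooth p q : smooth1 p -> smooth1 q -> smooth (tensor p q).
Proof.
move=> + + k; elim: k p q => [|k IH] p q sp sq; first exact: tensor_continuous.
split=> [|i]; first exact: tensor_continuous.
have [p' sp' dp] := smooth1_derive sp; have [q' sq' dq] := smooth1_derive sq.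
have [d0 D0] := tensor_derive0 q dp; have [d1 D1] := tensor_derive1 p dq.
have [->|i0] := eqVneq i 0; first by rewrite D0; split => //; exact: IH.
have -> : i = 1 by apply/val_inj; case: i i0 => -[|[|?]].
by rewrite D1; split => //; exact: IH.
Qed.

Lemma tensor_commute p q : smooth1 p -> smooth1 q ->
  'D_(basis 0) ('D_(basis 1) (tensor p q)) = 'D_(basis 1) ('D_(basis 0) (tensor p q)).
Proof.
move=> sp sq.
have [p' sp' dp] := smooth1_derive sp; have [q' sq' dq] := smooth1_derive sq.
rewrite (tensor_derive1 p dq).2 (tensor_derive0 q dp).2.
by rewrite (tensor_derive0 q' dp).2 (tensor_derive1 p' dq).2.
Qed.

Lemma test_function_derive i psi : test_function psi -> test_function ('D_(@basis R i) psi).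
Proof.
move=> [sm [K [cK KO psi0]]]; split.
  by move=> k; have [_ /(_ i)[]] := sm k.+1.
exists K; split => // x Kx.
rewrite -(@derive_cst _ _ _ (0 : R) x (basis i)); apply: near_eq_derive.
(* Off the compact support the function vanishes in a whole neighbourhood, hence so does its
   derivative. *)
have oK : open (~` K).
  by apply: closed_openC; apply: compact_closed => //; exact: norm_hausdorff.
have : \forall y \near x, (~` K) y by exact: open_nbhs_nbhs.
by apply: filterS => y /psi0.
Qed.

Lemma tensor_test_function p q (d : R) : 0 < d -> smooth1 p -> smooth1 q ->
  (forall x, (x <= d) || (1 - d <= x) -> p x = 0) ->
  (forall x, (x <= d) || (1 - d <= x) -> q x = 0) ->
  test_function (tensor p q).
Proof.
move=> d0 sp sq p0 q0; split; first exact: tensor_smooth.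
exists (`[d, 1 - d]%classic `*` `[d, 1 - d]%classic); split.
- by apply: compact_setX; exact: segment_compact.
- by move=> x [/= ]; rewrite !in_itv/= => /andP[? ?] /andP[? ?]; split => /=; rewrite in_itv/=; lra.
- move=> x nx; rewrite /tensor.
  have [h1|h1] := boolP (x.1 \in `[d, 1 - d]); last first.
    rewrite p0 ?mul0r//; move: h1; rewrite in_itv/= negb_and -!ltNge.
    by case/orP => /ltW ->; rewrite ?orbT.
  rewrite q0 ?mulr0//; have : x.2 \notin `[d, 1 - d].
    by apply/negP => h2; apply: nx; split.
  rewrite in_itv/= negb_and -!ltNge.
  by case/orP => /ltW ->; rewrite ?orbT.
Qed.

(** With [N = n + 1] the two arguments are [N (N x - 1)] and [N (N (1 - x) - 1)]. They are positive
    exactly for [x > 1/N] and for [x < 1 - 1/N], and both tend to infinity like [N^2] inside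
    [(0, 1)], where [bump 0] tends to [1]. *)
Definition cutoff (n : nat) (x : R) : R :=
  let N := n.+1%:R in bump 0 (N ^+ 2 * x + - N) * bump 0 (- N ^+ 2 * x + (N ^+ 2 - N)).

Lemma smooth1_cutoff n : smooth1 (cutoff n).
Proof. by apply: smooth1_mul; exact: smooth1_bump. Qed.

Lemma cutoff_le1 n x : `|cutoff n x| <= 1.
Proof.
rewrite /cutoff normrM -[leRHS]mulr1 ler_pM//;
  by rewrite ger0_norm ?bump_ge0// bump0_le1.
Qed.

Lemma cutoff_eq0 n x : (x <= n.+1%:R^-1) || (1 - n.+1%:R^-1 <= x) -> cutoff n x = 0.
Proof.
rewrite /cutoff; set N : R := n.+1%:R; have N0 : 0 < N by rewrite ltr0n.
case/orP => h.
  rewrite {1}/bump ifF ?mul0r//; apply/negbTE; rewrite -leNgt.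
  have -> : N ^+ 2 * x + - N = N * (N * x - 1) by ring.
  by rewrite pmulr_rle0// subr_le0 mulrC -ler_pdivlMr// div1r.
rewrite [X in _ * X]/bump ifF ?mulr0//; apply/negbTE; rewrite -leNgt.
have -> : - N ^+ 2 * x + (N ^+ 2 - N) = N ^+ 2 * (1 - N^-1 - x).
  by rewrite !mulrBr mulr1 expr2 mulfK ?lt0r_neq0//; ring.
by rewrite pmulr_rle0 ?exprn_gt0// subr_le0.
Qed.

Lemma bump0_dist (N y : R) : 0 < N -> N <= y -> `|1 - bump 0 y| <= N^-1.
Proof.
move=> N0 Ny; have y0 : 0 < y by lra.
rewrite ger0_norm ?subr_ge0 ?bump0_le1// /bump y0 expr0 mul1r.
have := expR_ge1Dx (- y^-1); have : y^-1 <= N^-1 by rewrite lef_pV2.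
lra.
Qed.

Lemma cutoff_cvg x : 0 < x < 1 -> cutoff n x @[n --> \oo] --> (1 : R).
Proof.
move=> /andP[x0 x1].
have B c : 0 < c -> bump 0 (n.+1%:R ^+ 2 * c - n.+1%:R) @[n --> \oo] --> (1 : R).
  move=> c0; apply/cvgrPdist_le => e e0; near=> n.
  have Ne : (n.+1%:R : R)^-1 <= e.
    near: n; have := @cvg_harmonic R; move/cvgrPdist_le => /(_ _ e0).
    by apply: filterS => n; rewrite sub0r normrN; apply: le_trans; exact: ler_norm.
  apply: le_trans Ne; apply: bump0_dist; first by rewrite ltr0n.
  (* As soon as [N c >= 2], the argument [N^2 c - N] is at least [N], and [bump0_dist] gives the
     distance [1/N]. *)
  have h : 2 <= n.+1%:R * c.
    rewrite -ler_pdivrMr//; near: n.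
    by apply: filterS (nbhs_infty_ger (2 / c)) => n /le_trans; apply; rewrite ler_nat.
  rewrite -subr_ge0; set N : R := n.+1%:R in h *.
  have -> : N ^+ 2 * c - N - N = N * (N * c - 2) by ring.
  by rewrite mulr_ge0// subr_ge0.
rewrite -(mul1r 1); apply: (@cvgM _ _ _ _ (fun n => bump 0 (n.+1%:R ^+ 2 * x - n.+1%:R))).
  exact: B.
rewrite (_ : (fun n => bump 0 (- _ * x + _)) = (fun n => bump 0 (n.+1%:R ^+ 2 * (1 - x) - n.+1%:R))).
  by apply: B; rewrite subr_gt0.
by apply/funext => n; congr bump; ring.
Unshelve. all: by end_near. Qed.

(** The cutoffs are bounded by [1] and tend to [1] on [Omega], so dominated convergence removes the
    compact support. No derivative of a cutoff occurs, because all derivatives already sit in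
    [E]. *)
Lemma Rintegral_cutoff_eq0 (E : R * R -> R) p q :
  leb2.-integrable (Omega : set R2) (EFin \o E) -> smooth1 p -> smooth1 q ->
  (forall p' q', smooth1 p' -> smooth1 q' -> test_function (tensor p' q') ->
     \int[leb2]_(x in Omega) (E x * tensor p' q' x) = 0) ->
  \int[leb2]_(x in Omega) (E x * tensor p q x) = 0.
Proof.
move=> Ei sp sq E0.
have spn n : smooth1 (fun x => p x * cutoff n x) by apply: smooth1_mul => //; exact: smooth1_cutoff.
have sqn n : smooth1 (fun x => q x * cutoff n x) by apply: smooth1_mul => //; exact: smooth1_cutoff.
have mE : measurable_fun Omega E by apply/measurable_EFinP; exact: measurable_int Ei.
have mO := measurable_Omega (R := R).
have [M pqM] := cont_square_bounded (tensor_continuous sp sq).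
have c : \int[leb2]_(x in Omega) (E x * tensor (fun x => p x * cutoff n x) (fun x => q x * cutoff n x) x)
    @[n --> \oo] --> \int[leb2]_(x in Omega) (E x * tensor p q x).
  apply: (@Rintegral_dominated_cvg _ _ _ leb2 Omega (fun n x => E x *
    tensor (fun x => p x * cutoff n x) (fun x => q x * cutoff n x) x)
    _ (fun x => `|M * E x|)) => //.
  - move=> n; apply: measurable_funM => //.
    by apply: measurable_cont_plane; exact: tensor_continuous.
  - by apply: measurable_funM => //; apply: measurable_cont_plane; exact: tensor_continuous.
  - apply: aeW => -[x y] [/= x01 y01]; apply: cvgMr.
    rewrite /tensor/= -[p x]mulr1 -[q y]mulr1.
    rewrite in_itv/= in x01; rewrite in_itv/= in y01; rewrite !mulr1.
    by apply: cvgM; rewrite -[X in _ --> X]mulr1; apply: cvgMr; exact: cutoff_cvg.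
  - by apply: integrable_norm; exact: (integrableZl mO M Ei).
  - move=> n x Ox; rewrite normrM [leRHS]normrM mulrC ler_wpM2r//.
    rewrite (@le_trans _ _ `|tensor p q x|)//; last first.
      by rewrite (le_trans (pqM _ (sub_Omega_square Ox)))// ler_norm.
    rewrite /tensor [leLHS]normrM [leRHS]normrM; apply: ler_pM => //;
      by rewrite normrM ler_piMr// cutoff_le1.
have c0 : \int[leb2]_(x in Omega) (E x * tensor (fun x => p x * cutoff n x) (fun x => q x * cutoff n x) x)
    @[n --> \oo] --> (0 : R).
  rewrite (_ : (fun n => _) = (fun=> 0)); first exact: cvg_cst.
  apply/funext => n; apply: E0 => //.
  by apply: (@tensor_test_function _ _ (n.+1%:R^-1)) => //; rewrite ?invr_gt0 ?ltr0n//;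
    move=> x xn; rewrite cutoff_eq0// mulr0.
exact: (cvg_unique (@Rhausdorff R) c c0).
Qed.

Definition pairing (w k : R * R -> R) : R := \int[leb2]_(x in Omega) (w x * k x).

Lemma pairing_integrable w k : leb2.-integrable (Omega : set R2) (EFin \o w) ->
  continuous k -> leb2.-integrable (Omega : set R2) (EFin \o (fun x => w x * k x)).
Proof.
move=> wi ck; have [M kM] := cont_square_bounded ck.
apply: (@integrable_mul_bounded _ _ _ _ _ _ _ M) => //.
- exact: measurable_Omega.
- exact: measurable_cont_plane.
- by move=> x /sub_Omega_square/kM.
Qed.

Lemma pairing_lin w1 w2 k a b : leb2.-integrable (Omega : set R2) (EFin \o w1) ->
  leb2.-integrable (Omega : set R2) (EFin \o w2) -> continuous k ->
  pairing (fun x => a * w1 x + b * w2 x) k = a * pairing w1 k + b * pairing w2 k.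
Proof.
move=> i1 i2 ck; have mO := measurable_Omega (R := R).
have h1 := pairing_integrable i1 ck; have h2 := pairing_integrable i2 ck.
rewrite /pairing -!RintegralZl// -RintegralD//.
- by apply: eq_Rintegral => x _; rewrite mulrDl !mulrA.
- exact: (integrableZl mO a h1).
- exact: (integrableZl mO b h2).
Qed.

Lemma integrable_lin w1 w2 a b : leb2.-integrable (Omega : set R2) (EFin \o w1) ->
  leb2.-integrable (Omega : set R2) (EFin \o w2) ->
  leb2.-integrable (Omega : set R2) (EFin \o (fun x => a * w1 x + b * w2 x)).
Proof.
move=> i1 i2; have mO := measurable_Omega (R := R).
exact: (integrableD mO (integrableZl mO a i1) (integrableZl mO b i2)).
Qed.

Lemma L2Omega_integrable w : L2Omega w -> leb2.-integrable (Omega : set R2) (EFin \o w).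
Proof. by apply: Lp2_integrable; [exact: measurable_Omega|exact: leb2_Omega_lty]. Qed.

Lemma L2Omega_lin (w1 w2 : R * R -> R) a b : L2Omega w1 -> L2Omega w2 ->
  L2Omega (fun x => a * w1 x + b * w2 x).
Proof.
rewrite /L2Omega /Lp => h1 h2.
have p1 : (1 <= (2%:E : \bar R))%E by rewrite lee_fin ler1n.
have [_ H] := @Lfun_submod_closed _ _ _ (@leb2 R) _ p1.
(* Closure is available for combinations [c f + g] only, so [a w1] is produced as
   [(a - 1) w1 + w1]. *)
have h3 := H b _ _ h2 (H 0 _ _ h1 (H (a - 1) _ _ h1 h1)).
rewrite (_ : _ \_ _ = b *: (w2 \_ Omega) +
   (0 *: (w1 \_ Omega) + ((a - 1) *: (w1 \_ Omega) + w1 \_ Omega))) //.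
apply/funext => x; transitivity (b * (w2 \_ Omega) x +
  (0 * (w1 \_ Omega) x + ((a - 1) * (w1 \_ Omega) x + (w1 \_ Omega) x))) => //.
by rewrite /patch; case: ifP => _; rewrite /point /=; ring.
Qed.

Lemma wpartialP (w : R * R -> R) i : H1 w -> is_weak_partial i w (wpartial i w).
Proof. by move=> [_ /(_ i)[v hv]]; exact: getPex (ex_intro _ v hv). Qed.

Local Opaque wpartial.

Lemma H1_lin (w1 w2 : R * R -> R) a b : H1 w1 -> H1 w2 -> H1 (fun x => a * w1 x + b * w2 x).
Proof.
move=> h1 h2; split; first by apply: L2Omega_lin; [exact: h1.1|exact: h2.1].
move=> i; have [l1 d1] := wpartialP i h1; have [l2 d2] := wpartialP i h2.
exists (fun x => a * wpartial i w1 x + b * wpartial i w2 x); split; first exact: L2Omega_lin.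
move=> psi tpsi.
have cpsi : continuous psi by exact: (tpsi.1 0%N).
have cdpsi : continuous ('D_(basis i) psi) by have [_ /(_ i)[]] := tpsi.1 1%N.
have := pairing_lin a b (L2Omega_integrable h1.1) (L2Omega_integrable h2.1) cdpsi.
rewrite /pairing => ->; rewrite d1// d2//.
have := pairing_lin a b (L2Omega_integrable l1) (L2Omega_integrable l2) cpsi.
by rewrite /pairing => ->; rewrite !mulrN -opprD.
Qed.

Lemma H1_add (w1 w2 : R * R -> R) : H1 w1 -> H1 w2 -> H1 (fun x => w1 x + w2 x).
Proof.
move=> h1 h2; rewrite (_ : (fun x => _) = (fun x => 1 * w1 x + 1 * w2 x)).
  exact: H1_lin.
by apply/funext => x; rewrite !mul1r.
Qed.

Lemma pairing_cutoff_eq0 (E : R * R -> R) p q :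
  leb2.-integrable (Omega : set R2) (EFin \o E) -> smooth1 p -> smooth1 q ->
  (forall p' q', smooth1 p' -> smooth1 q' -> test_function (tensor p' q') ->
     pairing E (tensor p' q') = 0) ->
  pairing E (tensor p q) = 0.
Proof. exact: Rintegral_cutoff_eq0. Qed.

Lemma weak_pairing (w w' : R * R -> R) i f : (forall f, test_function f ->
    \int[leb2]_(x in Omega) (w x * 'D_(basis i) f x) =
    - \int[leb2]_(x in Omega) (w' x * f x)) -> test_function f ->
  pairing w' f = - pairing w ('D_(basis i) f).
Proof. by move=> h tf; rewrite /pairing h// opprK. Qed.

Local Opaque pairing.

(* The two forms of the Lame operator agree in the weak sense because mixed
   derivatives of a test function commute; [Rintegral_cutoff_eq0] then removes
   the compact support. *)
Lemma lame_forms_weak lam mu (vk w1 w2 w3 w4 A1 A2 dv s t : R * R -> R) (j k : 'I_2) p q :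
  (j = 0 /\ k = 1) \/ (j = 1 /\ k = 0) ->
  L2Omega w1 -> L2Omega w2 ->
  is_weak_partial j vk w3 -> is_weak_partial k vk w4 ->
  is_weak_partial j w1 A1 -> is_weak_partial k w2 A2 ->
  is_weak_partial j (fun x => w1 x + w4 x) dv ->
  is_weak_partial j (fun x => lam * (w1 x + w4 x) + 2 * mu * w1 x) s ->
  is_weak_partial k (fun x => mu * (w2 x + w3 x)) t ->
  smooth1 p -> smooth1 q ->
  pairing (fun x => mu * (A1 x + A2 x) + (lam + mu) * dv x) (tensor p q) =
  pairing (fun x => s x + t x) (tensor p q).
Proof.
move=> jk01 /L2Omega_integrable i1 /L2Omega_integrable i2.
move=> [/L2Omega_integrable i3 d3] [/L2Omega_integrable i4 d4].
move=> [/L2Omega_integrable iA1 dA1] [/L2Omega_integrable iA2 dA2].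
move=> [/L2Omega_integrable idv ddv] [/L2Omega_integrable is_ ds].
move=> [/L2Omega_integrable it dt] sp sq.
have cpq := tensor_continuous sp sq.
have E1 : (fun x => mu * (A1 x + A2 x) + (lam + mu) * dv x) =
    (fun x => 1 * (mu * A1 x + mu * A2 x) + (lam + mu) * dv x).
  by apply/funext => x; rewrite mul1r mulrDr.
have E2 : (fun x => s x + t x) = (fun x => 1 * s x + 1 * t x).
  by apply/funext => x; rewrite !mul1r.
have E3 : (fun x => w1 x + w4 x) = (fun x => 1 * w1 x + 1 * w4 x).
  by apply/funext => x; rewrite !mul1r.
have E4 : (fun x => lam * (w1 x + w4 x) + 2 * mu * w1 x) =
    (fun x => (lam + 2 * mu) * w1 x + lam * w4 x).
  by apply/funext => x; ring.
have E5 : (fun x => mu * (w2 x + w3 x)) = (fun x => mu * w2 x + mu * w3 x).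
  by apply/funext => x; ring.
have iA := integrable_lin mu mu iA1 iA2.
have iL := integrable_lin 1 (lam + mu) iA idv.
have iR := integrable_lin 1 1 is_ it.
(* The difference of the two sides is one integrable function, so its pairings need to be computed
   on compactly supported tensors only. *)
rewrite E1 E2; apply/eqP; rewrite -subr_eq0.
rewrite -[X in X - _]mul1r -mulN1r -(pairing_lin 1 (-1) iL iR cpq); apply/eqP.
apply: (pairing_cutoff_eq0 (integrable_lin 1 (-1) iL iR)) => // p' q' sp' sq' tpsi.
set psi := tensor p' q' in tpsi *.
have cpsi : continuous psi by exact: (tpsi.1 0%N).
have tD i : test_function ('D_(basis i) psi) by exact: test_function_derive.
have cD i : continuous ('D_(basis i) psi) by exact: ((tD i).1 0%N).
have comm : 'D_(basis j) ('D_(basis k) psi) = 'D_(basis k) ('D_(basis j) psi).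
  have c := tensor_commute sp' sq'.
  case: jk01 => -[-> ->]; [exact c|exact (esym c)].
clearbody psi.
rewrite (pairing_lin 1 (-1) iL iR cpsi) (pairing_lin 1 _ iA idv cpsi).
rewrite (pairing_lin _ _ iA1 iA2 cpsi) (pairing_lin _ _ is_ it cpsi).
rewrite (weak_pairing dA1 tpsi) (weak_pairing dA2 tpsi) (weak_pairing ddv tpsi).
rewrite (weak_pairing ds tpsi) (weak_pairing dt tpsi) E3 E4 E5.
rewrite (pairing_lin _ _ i1 i4 (cD j)) (pairing_lin _ _ i1 i4 (cD j)).
rewrite (pairing_lin _ _ i2 i3 (cD k)).
(* [vk] is reached with both orders of differentiation on [psi], once through [w3] and once through
   [w4]; [comm] makes them one number. *)
have e3 := eq_trans (weak_pairing d3 (tD k)) (congr1 (fun g => - pairing vk g) comm).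
rewrite e3 (weak_pairing d4 (tD j)).
(* Here [a1], [a2], [a3] stand for the pairings of [w1] with the [j]-derivative, of [w2] with the
   [k]-derivative and of [vk] with the mixed derivative of [psi]. *)
have alg (a1 a2 a3 : R) : 1 * (1 * (mu * - a1 + mu * - a2) + (lam + mu) * - (1 * a1 + 1 * - a3)) +
   -1 * (1 * - ((lam + 2 * mu) * a1 + lam * - a3) + 1 * - (mu * a2 + mu * - a3)) = 0 by ring.
exact: (alg _ _ _).
Qed.

(** This is the passage to the divergence form of the operator, the one in which the stresses, and
    thus the traction, appear. It is stated through pairings because each [wpartial] is a chosen
    representative. *)
Lemma lame_forms lam mu (v : 'I_2 -> R * R -> R) p q :
  (forall i, H2 (v i)) -> (forall j, H1 (sigma lam mu v j)) -> H1 (tau mu v) ->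
  smooth1 p -> smooth1 q -> forall j k : 'I_2, (j = 0 /\ k = 1) \/ (j = 1 /\ k = 0) ->
  pairing (fun x => mu * laplacian (v j) x + (lam + mu) * wpartial j (divergence v) x) (tensor p q) =
  pairing (fun x => wpartial j (sigma lam mu v j) x + wpartial k (tau mu v) x) (tensor p q).
Proof.
move=> H2v H1s H1t sp sq j k jk01.
have sum2 (F : 'I_2 -> R) : \sum_(i < 2) F i = F j + F k.
  rewrite big_ord_recl big_ord1; have -> : lift ord0 ord0 = 1 :> 'I_2 by exact/val_inj.
  by case: jk01 => -[-> ->] //; rewrite addrC.
have divE : divergence v = fun x => wpartial j (v j) x + wpartial k (v k) x.
  by apply/funext => x; exact: (sum2 (fun i => wpartial i (v i) x)).
have lapE : laplacian (v j) = fun x => wpartial j (wpartial j (v j)) x + wpartial k (wpartial k (v j)) x.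
  by apply/funext => x; exact: (sum2 (fun i => wpartial i (wpartial i (v j)) x)).
have sigE : sigma lam mu v j =
    fun x => lam * (wpartial j (v j) x + wpartial k (v k) x) + 2 * mu * wpartial j (v j) x.
  by apply/funext => x; rewrite /sigma divE.
have tauE : tau mu v = fun x => mu * (wpartial k (v j) x + wpartial j (v k) x).
  apply/funext => x; case: jk01 => -[-> ->]; rewrite /tau; first reflexivity.
  rewrite [X in _ = mu * X]addrC; reflexivity.
have h (i l : 'I_2) : H1 (wpartial i (v l)) := (H2v l).2 i.
have hd := H1_add (h j j) (h k k).
have hs : is_weak_partial j (fun x => lam * (wpartial j (v j) x + wpartial k (v k) x) +
    2 * mu * wpartial j (v j) x) (wpartial j (sigma lam mu v j)).
  by rewrite -sigE; exact: wpartialP (H1s j).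
have ht : is_weak_partial k (fun x => mu * (wpartial k (v j) x + wpartial j (v k) x))
    (wpartial k (tau mu v)).
  by rewrite -tauE; exact: wpartialP H1t.
rewrite lapE divE.
exact (lame_forms_weak jk01 (h j j).1 (h k j).1 (wpartialP j (H2v k).1)
  (wpartialP k (H2v k).1) (wpartialP j (h j j)) (wpartialP k (h k j)) (wpartialP j hd)
  hs ht sp sq).
Qed.

End smooth_functions.

(** * The Lame operator tested against a cosine *)

Section energy_identity.
Context {R : realType}.
Local Notation R2 := (measurableTypeR R * measurableTypeR R)%type.

(** Both amplitudes are carried along so that a partial derivative has the same shape, with
    amplitudes [B a_i] and [- A a_i]; smoothness is then an induction. *)
Definition trig (a : R * R) (A B : R) (x : R * R) : R :=
  A * cos (pdot a x) + B * sin (pdot a x).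

Lemma trig_continuous a A B : continuous (trig a A B).
Proof.
have c1 : continuous (fun x : R * R => pdot a x).
  move=> x; apply: (@continuousD _ _ _ (fun x : R * R => a.1 * x.1) (fun x : R * R => a.2 * x.2)).
  - by apply: cvgMr; exact: cvg_fst.
  - by apply: cvgMr; exact: cvg_snd.
move=> x; apply: (@continuousD _ _ _ (fun x : R * R => A * cos (pdot a x)) (fun x : R * R => B * sin (pdot a x))).
- by apply: cvgMr; apply: continuous_comp; [exact: c1|exact: continuous_cos].
- by apply: cvgMr; apply: continuous_comp; [exact: c1|exact: continuous_sin].
Qed.

Lemma trig_derive a A B (i : 'I_2) :
  (forall x, derivable (trig a A B) x (basis i)) /\
  'D_(basis i) (trig a A B) = trig a (B * coordinate i a) (- A * coordinate i a).
Proof.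
have d (al be s : R) : is_derive s (1 : R) (fun s => A * cos (al * s + be) + B * sin (al * s + be))
    (B * al * cos (al * s + be) + - A * al * sin (al * s + be)).
  have da := is_derive_affine al be s.
  have dc := @is_derive1_comp _ cos _ s _ _ (is_derive_cos _) da.
  have ds := @is_derive1_comp _ sin _ s _ _ (is_derive_sin _) da.
  apply: is_derive_eq (is_deriveD (is_deriveZ A dc) (is_deriveZ B ds)) _.
  have alg (x y : R) : A * (- x * al) + B * (y * al) = B * al * y + - A * al * x by ring.
  exact: alg.
have [->|i0] := eqVneq i 0; rewrite /coordinate.
  have d0 (x y : R) : is_derive x (1 : R) (fun s => trig a A B (s, y))
     (trig a (B * a.1) (- A * a.1) (x, y)).
    exact: d a.1 (a.2 * y) x.
  split=> [[x y]|].
    by apply/(derive_basis0 _ _ _).1; exact: (@ex_derive _ _ _ _ _ _ _ (d0 x y)).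
  apply/funext => -[x y].
  by rewrite (derive_basis0 _ _ _).2 derive1E (@derive_val _ _ _ _ _ _ _ (d0 x y)).
have -> : i = 1 by apply/val_inj; case: i i0 => -[|[|?]].
have d1 (x y : R) : is_derive y (1 : R) (fun s => trig a A B (x, s))
   (trig a (B * a.2) (- A * a.2) (x, y)).
  rewrite (_ : (fun s => _) = (fun s => A * cos (a.2 * s + a.1 * x) + B * sin (a.2 * s + a.1 * x))).
    by rewrite /trig /pdot /= [a.1 * x + _]addrC; exact: d.
  by apply/funext => s; rewrite /trig /pdot /= [a.1 * x + _]addrC.
split=> [[x y]|].
  by apply/(derive_basis1 _ _ _).1; exact: (@ex_derive _ _ _ _ _ _ _ (d1 x y)).
apply/funext => -[x y].
by rewrite (derive_basis1 _ _ _).2 derive1E (@derive_val _ _ _ _ _ _ _ (d1 x y)).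
Qed.

Lemma trig_smooth a A B : smooth (trig a A B).
Proof.
move=> k; elim: k A B => [|k IH] A B; first exact: trig_continuous.
split=> [|i]; first exact: trig_continuous.
by have [d ->] := trig_derive a A B i; split.
Qed.

(** The addition formula writes [cos (a . x)] as a difference of two tensors, to which the cutoff
    argument applies. *)
Lemma trig_tensor a (x : R * R) : trig a 1 0 x =
  tensor (fun s => cos (a.1 * s + 0)) (fun s => cos (a.2 * s + 0)) x -
  tensor (fun s => sin (a.1 * s + 0)) (fun s => sin (a.2 * s + 0)) x.
Proof. by rewrite /trig /tensor /pdot mul1r mul0r !addr0 cosD. Qed.

Lemma pairing_linr w k1 k2 (A B : R) : leb2.-integrable (Omega : set R2) (EFin \o w) ->
  continuous k1 -> continuous k2 ->
  pairing w (fun x => A * k1 x + B * k2 x) = A * pairing w k1 + B * pairing w k2.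
Proof.
move=> wi c1 c2; have mO := measurable_Omega (R := R).
have h1 := pairing_integrable wi c1; have h2 := pairing_integrable wi c2.
rewrite /pairing -!RintegralZl// -RintegralD//.
- by apply: eq_Rintegral => x _; ring.
- exact: (integrableZl mO A h1).
- exact: (integrableZl mO B h2).
Qed.

Lemma trace_pairing (w gamma v : R * R -> R) i : is_trace w gamma -> smooth v ->
  pairing (wpartial i w) v =
  \int[arc_length]_(x in dOmega) (gamma x * (normal i x * v x)) - pairing w ('D_(basis i) v).
Proof. exact: trace_integral_by_parts. Qed.

Lemma trace0_pairing (w v : R * R -> R) i : is_trace w (fun=> 0) -> smooth v ->
  pairing (wpartial i w) v = - pairing w ('D_(basis i) v).
Proof.
move=> tw sv; rewrite (trace_pairing i tw sv).
rewrite (_ : (\int[_]_(_ in _) _) = 0) ?sub0r//.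
under eq_Rintegral do rewrite mul0r.
by rewrite Rintegral_cst ?mul0r//; exact: measurable_dOmega.
Qed.

Lemma pairing_scale w k (r : R) : leb2.-integrable (Omega : set R2) (EFin \o w) ->
  continuous k -> pairing w (fun x => r * k x) = r * pairing w k.
Proof.
move=> wi ck; rewrite /pairing -RintegralZl//; last 2 first.
- exact: measurable_Omega.
- exact: pairing_integrable.
by apply: eq_Rintegral => x _; rewrite mulrCA.
Qed.

Lemma boundary_split (s th C : R * R -> R) j k : Lp arc_length dOmega 2%:E s ->
  Lp arc_length dOmega 2%:E th -> continuous C ->
  \int[arc_length]_(x in dOmega) ((normal j x * s x + normal k x * th x) * C x) =
    \int[arc_length]_(x in dOmega) (s x * (normal j x * C x)) +
    \int[arc_length]_(x in dOmega) (th x * (normal k x * C x)).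
Proof.
move=> sL tL cC; have mdO := measurable_dOmega (R := R).
have [M tM] := cont_square_bounded cC.
have nti i r : Lp arc_length dOmega 2%:E r ->
    arc_length.-integrable (dOmega : set R2) (EFin \o (fun x => r x * (normal i x * C x))).
  move=> rL; apply: (@integrable_mul_bounded _ _ _ _ _ _ _ M) => //.
  - by apply: Lp2_integrable => //; exact: arc_length_fin.
  - apply: measurable_funM; first by apply: measurable_funTS; exact: measurable_normal.
    by apply: measurable_cont_plane.
  - by move=> x /sub_dOmega_square/tM h; rewrite normrM -[leRHS]mul1r ler_pM// normal_le1.
rewrite -RintegralD//; [|exact: nti|exact: nti].
by apply: eq_Rintegral => x _; ring.
Qed.

Local Opaque pairing wpartial.

(* Integrating by parts twice against [C e_j], where [C] and [S] behave like
   [cos (a . x)] and [sin (a . x)]: only the traction survives on the boundary. *)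
Lemma lame_green_aux lam mu (v : 'I_2 -> R * R -> R) (s : 'I_2 -> R * R -> R) th a C S p1 q1 p2 q2
    (j k : 'I_2) : (j = 0 /\ k = 1) \/ (j = 1 /\ k = 0) ->
  (forall i, H2 (v i)) -> (forall i, is_trace (v i) (fun=> 0)) ->
  (forall i, is_trace (sigma lam mu v i) (s i)) -> is_trace (tau mu v) th ->
  smooth C -> smooth S ->
  (forall i, 'D_(basis i) C = fun x => - coordinate i a * S x) ->
  (forall i, 'D_(basis i) S = fun x => coordinate i a * C x) ->
  smooth1 p1 -> smooth1 q1 -> smooth1 p2 -> smooth1 q2 ->
  C = (fun x => 1 * tensor p1 q1 x + (-1) * tensor p2 q2 x) ->
  pairing (fun x => mu * laplacian (v j) x + (lam + mu) * wpartial j (divergence v) x) C =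
  \int[arc_length]_(x in dOmega) ((normal j x * s j x + normal k x * th x) * C x) -
  ((lam + mu) * coordinate j a * (\sum_(i < 2) coordinate i a * pairing (v i) C) +
   mu * (a.1 ^+ 2 + a.2 ^+ 2) * pairing (v j) C).
Proof.
move=> jk01 H2v tr0 trs trt smC smS DC DS sp1 sq1 sp2 sq2 CE.
have sum2 (F : 'I_2 -> R) : \sum_(i < 2) F i = F j + F k.
  rewrite big_ord_recl big_ord1; have -> : lift ord0 ord0 = 1 :> 'I_2 by exact/val_inj.
  by case: jk01 => -[-> ->] //; rewrite addrC.
have aE : a.1 ^+ 2 + a.2 ^+ 2 = coordinate j a ^+ 2 + coordinate k a ^+ 2.
  by case: jk01 => -[-> ->]; rewrite /coordinate //= addrC.
have H1s i : H1 (sigma lam mu v i) by case: (trs i).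
have H1t : H1 (tau mu v) by case: trt.
have iv i := L2Omega_integrable (H2v i).1.1.
have iw (i l : 'I_2) := L2Omega_integrable ((H2v l).2 i).1.
have cC : continuous C := smC 0%N; have cS : continuous S := smS 0%N.
(* First integration by parts: [v l] has zero trace, so nothing is left on the boundary. *)
have P i l : pairing (wpartial i (v l)) S = - (coordinate i a * pairing (v l) C).
  by rewrite (trace0_pairing i (tr0 l) smS) DS (pairing_scale _ (iv l) cC).
have divE : divergence v = fun x => 1 * wpartial j (v j) x + 1 * wpartial k (v k) x.
  apply/funext => x; rewrite [LHS](sum2 (fun i => wpartial i (v i) x)).
  by have mul1D (r t : R) : r + t = 1 * r + 1 * t; [rewrite !mul1r|exact: mul1D].
have idiv : leb2.-integrable (Omega : set R2) (EFin \o divergence v).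
  by rewrite divE; exact: (integrable_lin 1 1 (iw j j) (iw k k)).
have Pdiv : pairing (divergence v) S =
    1 * - (coordinate j a * pairing (v j) C) + 1 * - (coordinate k a * pairing (v k) C).
  rewrite [in LHS]divE [LHS](pairing_lin 1 1 (iw j j) (iw k k) cS).
  exact: (congr2 (fun r t => 1 * r + 1 * t) (P j j) (P k k)).
have Psig : pairing (sigma lam mu v j) S =
    lam * pairing (divergence v) S + (2 * mu) * - (coordinate j a * pairing (v j) C).
  transitivity (lam * pairing (divergence v) S + (2 * mu) * pairing (wpartial j (v j)) S).
    exact: (pairing_lin lam (2 * mu) idiv (iw j j) cS).
  exact: (congr1 (fun t => _ + _ * t) (P j j)).
have tauE : tau mu v = fun x => mu * wpartial k (v j) x + mu * wpartial j (v k) x.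
  apply/funext => x.
  transitivity (mu * (wpartial k (v j) x + wpartial j (v k) x)); last exact: mulrDr.
  rewrite /tau; case: jk01 => -[-> ->]; first reflexivity.
  rewrite [X in _ = mu * X]addrC; reflexivity.
have Ptau : pairing (tau mu v) S =
    mu * - (coordinate k a * pairing (v j) C) + mu * - (coordinate j a * pairing (v k) C).
  transitivity (mu * pairing (wpartial k (v j)) S + mu * pairing (wpartial j (v k)) S); last first.
    exact: (congr2 (fun r t => mu * r + mu * t) (P k j) (P j k)).
  rewrite -[RHS](pairing_lin mu mu (iw k j) (iw j k) cS).
  exact: (congr1 (fun w => pairing w S) tauE).
have is_ i := L2Omega_integrable (H1s i).1.
have it := L2Omega_integrable H1t.1.
have iws := L2Omega_integrable (wpartialP j (H1s j)).1.
have iwt := L2Omega_integrable (wpartialP k H1t).1.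
have ilap : leb2.-integrable (Omega : set R2) (EFin \o laplacian (v j)).
  have := integrable_lin 1 1 (L2Omega_integrable (wpartialP j ((H2v j).2 j)).1)
    (L2Omega_integrable (wpartialP k ((H2v j).2 k)).1).
  congr (leb2.-integrable _ (EFin \o _)); apply/funext => x.
  have mul1D (r t : R) : 1 * r + 1 * t = r + t by rewrite !mul1r.
  rewrite [LHS]mul1D; exact: esym (sum2 (fun i => wpartial i (wpartial i (v j)) x)).
have idv : leb2.-integrable (Omega : set R2) (EFin \o wpartial j (divergence v)).
  apply: L2Omega_integrable; apply: (wpartialP j _).1; rewrite divE.
  exact: (H1_lin 1 1 ((H2v j).2 j) ((H2v k).2 k)).
have iL := integrable_lin mu (lam + mu) ilap idv.
have iR := integrable_lin 1 1 iws iwt.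
(* [lame_forms] is applied to each of the two tensors that make up [C]. *)
have L1 : pairing (fun x => mu * laplacian (v j) x + (lam + mu) * wpartial j (divergence v) x) C =
    1 * pairing (wpartial j (sigma lam mu v j)) C + 1 * pairing (wpartial k (tau mu v)) C.
  rewrite -[RHS](pairing_lin 1 1 iws iwt cC).
  have F p q : smooth1 p -> smooth1 q ->
     pairing (fun x => mu * laplacian (v j) x + (lam + mu) * wpartial j (divergence v) x) (tensor p q) =
     pairing (fun x => 1 * wpartial j (sigma lam mu v j) x + 1 * wpartial k (tau mu v) x) (tensor p q).
    move=> sp sq; have LF := lame_forms H2v H1s H1t sp sq jk01.
    have LE : (fun x => wpartial j (sigma lam mu v j) x + wpartial k (tau mu v) x) =
        (fun x => 1 * wpartial j (sigma lam mu v j) x + 1 * wpartial k (tau mu v) x).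
      apply/funext => x.
      by have mul1D (r t : R) : r + t = 1 * r + 1 * t; [rewrite !mul1r|exact: mul1D].
    exact (eq_trans LF (congr1 (fun w => pairing w (tensor p q)) LE)).
  have s1 := tensor_continuous sp1 sq1; have s2 := tensor_continuous sp2 sq2.
  rewrite CE [LHS](pairing_linr 1 (-1) iL s1 s2) [RHS](pairing_linr 1 (-1) iR s1 s2).
  exact (congr2 (fun r t => 1 * r + -1 * t) (F _ _ sp1 sq1) (F _ _ sp2 sq2)).
(* Second integration by parts, now on the stress: its trace produces the boundary term, and the
   derivative of [C] brings back [S]. *)
have T1 : pairing (wpartial j (sigma lam mu v j)) C =
    \int[arc_length]_(x in dOmega) (s j x * (normal j x * C x)) -
    - coordinate j a * pairing (sigma lam mu v j) S.
  rewrite [LHS](trace_pairing j (trs j) smC) (DC j).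
  exact: (congr1 (fun t => _ - t) (pairing_scale _ (is_ j) cS)).
have T2 : pairing (wpartial k (tau mu v)) C =
    \int[arc_length]_(x in dOmega) (th x * (normal k x * C x)) -
    - coordinate k a * pairing (tau mu v) S.
  rewrite [LHS](trace_pairing k trt smC) (DC k).
  exact: (congr1 (fun t => _ - t) (pairing_scale _ it cS)).
rewrite Pdiv in Psig; rewrite Psig in T1; rewrite Ptau in T2.
have L2 := eq_trans L1 (congr2 (fun r t => 1 * r + 1 * t) T1 T2).
have sL : Lp arc_length dOmega 2%:E (s j) by case: (trs j).
have tL : Lp arc_length dOmega 2%:E th by case: trt.
have BE := boundary_split j k sL tL cC.
have alg (B1 B2 aj ak Vj Vk : R) : 1 * (B1 - - aj * (lam * (1 * - (aj * Vj) + 1 * - (ak * Vk)) +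
      (2 * mu) * - (aj * Vj))) + 1 * (B2 - - ak * (mu * - (ak * Vj) + mu * - (aj * Vk))) =
    B1 + B2 - ((lam + mu) * aj * (aj * Vj + ak * Vk) + mu * (aj ^+ 2 + ak ^+ 2) * Vj) by ring.
have f3 (x x' y y' z z' t : R) : x = x' -> y = y' -> z = z' ->
   x - ((lam + mu) * coordinate j a * y + mu * z * t) =
   x' - ((lam + mu) * coordinate j a * y' + mu * z' * t) by move=> -> -> ->.
exact (eq_trans L2 (eq_trans (alg _ _ _ _ _ _)
  (f3 _ _ _ _ _ _ _ (esym BE) (esym (sum2 (fun i => coordinate i a * pairing (v i) C))) (esym aE)))).
Qed.

(** The subtracted term is the symbol [(lam + mu) a a^T + mu |a|^2] of the operator, applied to the
    vector of cosine coefficients. Its eigenvectors are [a], with eigenvalue [(lam + 2 mu) |a|^2],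
    and the vectors orthogonal to [a], with [mu |a|^2]. *)
Lemma lame_green lam mu (v : 'I_2 -> R * R -> R) (s : 'I_2 -> R * R -> R) th a
    (j k : 'I_2) : (j = 0 /\ k = 1) \/ (j = 1 /\ k = 0) ->
  (forall i, H2 (v i)) -> (forall i, is_trace (v i) (fun=> 0)) ->
  (forall i, is_trace (sigma lam mu v i) (s i)) -> is_trace (tau mu v) th ->
  pairing (fun x => mu * laplacian (v j) x + (lam + mu) * wpartial j (divergence v) x) (trig a 1 0) =
  \int[arc_length]_(x in dOmega) ((normal j x * s j x + normal k x * th x) * trig a 1 0 x) -
  ((lam + mu) * coordinate j a * (\sum_(i < 2) coordinate i a * pairing (v i) (trig a 1 0)) +
   mu * (a.1 ^+ 2 + a.2 ^+ 2) * pairing (v j) (trig a 1 0)).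
Proof.
move=> jk01 H2v tr0 trs trt.
apply: (lame_green_aux jk01 H2v tr0 trs trt (trig_smooth a 1 0) (trig_smooth a 0 1) _ _
  (smooth1_cos a.1 0) (smooth1_cos a.2 0) (smooth1_sin a.1 0) (smooth1_sin a.2 0)).
- move=> i; rewrite (trig_derive a 1 0 i).2; apply/funext => x; rewrite /trig; ring.
- move=> i; rewrite (trig_derive a 0 1 i).2; apply/funext => x; rewrite /trig; ring.
- by apply/funext => x; rewrite trig_tensor mul1r mulN1r.
Qed.

End energy_identity.

(** * Integrals over the product of the time interval and the boundary *)

Section arc_finite.
Context {R : realType}.
Local Notation R2 := (measurableTypeR R * measurableTypeR R)%type.

(* A copy of [arc_length] that carries its finiteness. *)
Definition arcF : set R2 -> \bar R := arc_length.

HB.instance Definition _ := isMeasure.Build _ _ _ arcF (measure0 arc_length)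
  (measure_ge0 arc_length) (@measure_semi_sigma_additive _ _ _ arc_length).

Let arcF_fin : fin_num_fun arcF.
Proof. by move=> A mA; rewrite ge0_fin_numE//; exact: arc_length_fin. Qed.

HB.instance Definition _ := Measure_isFinite.Build _ _ _ arcF arcF_fin.

Lemma Rintegral_arcF (D : set R2) f : measurable D ->
  \int[arcF]_(x in D) f x = \int[arc_length]_(x in D) f x.
Proof. by move=> mD; congr fine; apply: eq_measure_integral. Qed.

Lemma integral_arcF (D : set R2) f :
  (\int[arcF]_(x in D) f x = \int[arc_length]_(x in D) f x)%E.
Proof. exact: eq_measure_integral. Qed.

Definition boundary_slab (T : R) : set (measurableTypeR R * R2) :=
  (`]0, T[%classic : set (measurableTypeR R)) `*` (dOmega : set R2).

Lemma measurable_slab T : measurable (boundary_slab T).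
Proof. by apply: measurableX; [exact: measurable_itv|exact: measurable_dOmega]. Qed.

Definition slab_measure : {measure set (measurableTypeR R * R2) -> \bar R} :=
  (lebesgue_measure \x arcF)%E.

(** By Tonelli the iterated norm of a traction is its L1 norm for the product measure. Tractions
    thereby become integrable functions of one variable [z = (t, x)], and the general kernel lemmas
    apply. *)
Lemma slab_norm T (Y : R -> R * R -> R) : measurable_fun (boundary_slab T) (fun z => Y z.1 z.2) ->
  (\int[slab_measure]_(z in boundary_slab T) `|Y z.1 z.2|%:E = L1L1norm T Y)%E.
Proof.
move=> mY; pose g := (fun z : measurableTypeR R * R2 => `|Y z.1 z.2|%:E) \_ (boundary_slab T).
have mg : measurable_fun setT g.
  apply/(measurable_restrictT _ (measurable_slab T)).
  by apply/measurable_EFinP; exact: measurableT_comp.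
have g0 z : (0 <= g z)%E by rewrite /g /patch; case: ifP.
transitivity (\int[lebesgue_measure]_t fubini_F arcF g t)%E.
  rewrite integral_mkcond.
  exact: (@fubini_tonelli1 _ _ _ _ _ lebesgue_measure arcF g mg g0).
rewrite /L1L1norm [RHS]integral_mkcond; apply: eq_integral => t _; rewrite /patch /fubini_F.
case: ifPn => tT.
  rewrite -integral_arcF [RHS]integral_mkcond; apply: eq_integral => x _.
  rewrite /g /patch /=; have [xd|xd] := boolP (x \in dOmega).
    by rewrite ifT//; apply/mem_set; split => /=; exact: set_mem.
  by rewrite ifF//; apply/negbTE; apply: contra xd => /set_mem[_ ?]; exact/mem_set.
apply: integral0_eq => x _; rewrite /g /patch ifF//; apply/negbTE.
by apply: contra tT => /set_mem[? _]; exact/mem_set.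
Qed.

Lemma slab_integrable T Y : L1_L1 T Y ->
  slab_measure.-integrable (boundary_slab T) (EFin \o (fun z => Y z.1 z.2)).
Proof.
move=> [mY Yoo]; apply/integrableP; split; first exact/measurable_EFinP.
by rewrite slab_norm.
Qed.

Lemma slab_Rnorm T Y : L1_L1 T Y ->
  \int[slab_measure]_(z in boundary_slab T) `|Y z.1 z.2| = fine (L1L1norm T Y).
Proof. by move=> [mY _]; rewrite /Rintegral slab_norm. Qed.

Lemma slab_Fubini T (f : R -> R * R -> R) :
  slab_measure.-integrable (boundary_slab T) (EFin \o (fun z => f z.1 z.2)) ->
  \int[slab_measure]_(z in boundary_slab T) f z.1 z.2 =
  \int[leb1]_(t in `]0, T[%classic) \int[arc_length]_(x in dOmega) f t x /\
  leb1.-integrable `]0, T[%classic (EFin \o (fun t => \int[arc_length]_(x in dOmega) f t x)) /\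
  {ae leb1, forall t, `]0, T[%classic t -> arc_length.-integrable dOmega (EFin \o f t)}.
Proof.
move=> fi; have mI : measurable (`]0, T[%classic : set (measurableTypeR R)) by exact: measurable_itv.
have mdO := measurable_dOmega (R := R).
have E : (fun t => \int[arcF]_(x in dOmega) f t x) = (fun t => \int[arc_length]_(x in dOmega) f t x).
  by apply/funext => t; exact: Rintegral_arcF.
split; [|split].
- transitivity (\int[lebesgue_measure]_(t in `]0, T[%classic) \int[arcF]_(x in dOmega) f t x).
    exact: (Rintegral_prod1 (m1 := lebesgue_measure) (m2 := arcF) mI mdO fi).
  by apply: eq_Rintegral => t _; exact: Rintegral_arcF.
- by rewrite -E; exact: (integrable_Rintegral1 (m1 := lebesgue_measure) (m2 := arcF) mI mdO fi).
- have := ae_integrable_section1 (m1 := lebesgue_measure) (m2 := arcF) mI mdO fi.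
  apply: filterS => t h tT; have /integrableP[mf ff] := h tT.
  by apply/integrableP; split => //; rewrite -integral_arcF.
Qed.

End arc_finite.

(** * Evolution of the cosine coefficients *)

Section time_evolution.
Context {R : realType}.
Local Notation R2 := (measurableTypeR R * measurableTypeR R)%type.
Local Notation leb := (@lebesgue_measure R).
Implicit Types (T t c : R).

Lemma dnbhs_shift t : (fun h : R => h + t) @ 0^' --> t^'.
Proof.
move=> P /nbhs_ballP[e /= e0 eP]; apply/nbhs_ballP; exists e => //= h.
rewrite /ball/= sub0r normrN => he h0; apply: eP.
  by rewrite /ball/= opprD addrCA subrr addr0 normrN.
by apply: contra_neq h0 => ht; apply: (addIr t); rewrite ht add0r.
Qed.

Lemma is_derive_quotient (V : R -> R) t l :
  (V s - V t) / (s - t) @[s --> t^'] --> l -> is_derive t (1 : R) V l.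
Proof.
move=> h.
have H : (fun h : R => h^-1 *: ((V \o shift t) (h *: 1) - V t)) h @[h --> 0^'] --> l.
  have := cvg_comp _ _ (dnbhs_shift (t := t)) h.
  apply: cvg_trans; apply: near_eq_cvg; near=> x => /=.
  by rewrite [x *: 1]mulr1 addrK [LHS]mulrC.
apply: DeriveDef; first by apply/cvg_ex; exists l.
exact: (cvg_lim (@Rhausdorff R) H).
Unshelve. all: by end_near. Qed.

Lemma continuous_L2_pairing T (w : R -> R * R -> R) C : continuous_L2 T w -> continuous C ->
  forall t, `[0, T]%classic t ->
  pairing (w s) C @[s --> within `[0, T]%classic (nbhs t)] --> pairing (w t) C.
Proof.
move=> cw cC t tT; have [M CM] := cont_square_bounded cC.
have mO := measurable_Omega (R := R).
apply: Lp2_cvg_Rintegral.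
- exact: mO.
- exact: leb2_Omega_lty.
- exact: (cw t tT).1.
- rewrite near_withinE; apply: filterE => s sT.
  by apply: L2Omega_integrable; exact: (cw s sT).1.
- exact: measurable_cont_plane.
- by exists M => x /sub_Omega_square/CM.
- exact: (cw t tT).2.
Qed.

(** Pairing with a bounded function is linear and continuous for the L2 norm, so it commutes with
    the limit of the difference quotients. At the end points of [[0, T]] only one-sided quotients
    would be controlled. *)
Lemma is_ddt_pairing T (w w' : R -> R * R -> R) C : continuous_L2 T w ->
  is_ddt T w w' -> continuous C -> forall t, 0 < t < T ->
  is_derive t (1 : R) (fun s => pairing (w s) C) (pairing (w' t) C).
Proof.
move=> cw dw cC t t0T; have [M CM] := cont_square_bounded cC.
have tT : `[0, T]%classic t.
  by case/andP: t0T => ? ?; rewrite /= in_itv/=; apply/andP; split; exact: ltW.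
have mO := measurable_Omega (R := R).
have iw s : `[0, T]%classic s -> leb2.-integrable (Omega : set R2) (EFin \o w s).
  by move=> sT; apply: L2Omega_integrable; exact: (cw s sT).1.
have Q s : `[0, T]%classic s -> pairing (fun x => (w s x - w t x) / (s - t)) C =
    (pairing (w s) C - pairing (w t) C) / (s - t).
  move=> sT; rewrite mulrBl -!(mulrC (s - t)^-1) -mulNr.
  rewrite -(pairing_lin _ _ (iw s sT) (iw t tT) cC).
  by rewrite /pairing; apply: eq_Rintegral => x _; ring.
apply: is_derive_quotient.
have : pairing (fun x => (w s x - w t x) / (s - t)) C
    @[s --> within `[0, T]%classic t^'] --> pairing (w' t) C.
  apply: Lp2_cvg_Rintegral.
  - exact: mO.
  - exact: leb2_Omega_lty.
  - exact: (dw t tT).1.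
  - rewrite near_withinE; apply: filterE => s sT.
    have := integrable_lin (s - t)^-1 (- (s - t)^-1) (iw s sT) (iw t tT).
    by congr (leb2.-integrable _ (EFin \o _)); apply/funext => x; ring.
  - exact: measurable_cont_plane.
  - by exists M => x /sub_Omega_square/CM.
  - exact: (dw t tT).2.
move=> h U /h hU.
(* Near an interior time the restriction to [[0, T]] is void. *)
have nT : \forall s \near t^', `[0, T]%classic s.
  apply: nbhs_dnbhs; have : t \in `]0, T[ by rewrite in_itv.
  move=> /near_in_itvoo; apply: filterS => s; exact: subset_itv_oo_cc.
move: hU; rewrite /= !near_simpl /fmap /= near_withinE => hU.
near=> s; have sT : `[0, T]%classic s by near: s.
rewrite /= -(Q s sT).
by move: sT; near: s; exact: hU.
Unshelve. all: by end_near. Qed.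

Lemma within_cvg_continuous T (V : R -> R) : 0 < T ->
  (forall t, `[0, T]%classic t -> V s @[s --> within `[0, T]%classic (nbhs t)] --> V t) ->
  {within `[0, T], continuous V}.
Proof.
move=> T0 h; apply/(continuous_within_itvP _ T0); split.
- move=> t tT; have tT' : `[0, T]%classic t by exact: subset_itv_oo_cc tT.
  have := h t tT'; rewrite within_interior//.
  by move: tT => /near_in_itvoo; apply: filterS => s; exact: subset_itv_oo_cc.
- have /h c0 : `[0, T]%classic 0 by rewrite /= in_itv/= lexx ltW.
  move=> U /c0 hU; have {}hU : \forall s \near (0 : R), `[0, T]%classic s -> U (V s) := hU.
  have hr : \forall s \near 0^'+, `[0, T]%classic s -> U (V s).
    by rewrite near_withinE; apply: filterS hU => s hs _ sT; exact: hs.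
  suff : \forall s \near 0^'+, U (V s) by [].
  near=> s; have : `[0, T]%classic s.
    rewrite /= in_itv/=; apply/andP; split; near: s; [exact: nbhs_right_ge|exact: nbhs_right_le].
  by near: s; exact: hr.
- have /h c0 : `[0, T]%classic T by rewrite /= in_itv/= lexx ltW.
  move=> U /c0 hU; have {}hU : \forall s \near T, `[0, T]%classic s -> U (V s) := hU.
  have hr : \forall s \near T^'-, `[0, T]%classic s -> U (V s).
    by rewrite near_withinE; apply: filterS hU => s hs _ sT; exact: hs.
  suff : \forall s \near T^'-, U (V s) by [].
  near=> s; have : `[0, T]%classic s.
    rewrite /= in_itv/=; apply/andP; split; near: s; [exact: nbhs_left_ge|exact: nbhs_left_le].
  by near: s; exact: hr.
Unshelve. all: by end_near. Qed.

(** The integrand has the primitive [sin (c (T - t)) W' + c cos (c (T - t)) W], whose values at [T]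
    and [0] give the three terms. Derivatives are required inside only; continuity carries the
    formula to the end points. *)
Lemma duhamel T c (W W1 W2 : R -> R) : 0 < T ->
  {within `[0, T], continuous W} -> {within `[0, T], continuous W1} ->
  {within `[0, T], continuous W2} ->
  (forall t, 0 < t < T -> is_derive t (1 : R) W (W1 t)) ->
  (forall t, 0 < t < T -> is_derive t (1 : R) W1 (W2 t)) ->
  \int[leb]_(t in `]0, T[) (sin (c * (T - t)) * (W2 t + c ^+ 2 * W t)) =
    c * W T - sin (c * T) * W1 0 - c * cos (c * T) * W 0 /\
  leb.-integrable `]0, T[ (EFin \o (fun t => sin (c * (T - t)) * (W2 t + c ^+ 2 * W t))).
Proof.
move=> T0 cW cW1 cW2 dW dW1.
pose f t := sin (c * (T - t)) * (W2 t + c ^+ 2 * W t).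
pose F t := sin (c * (T - t)) * W1 t + c * cos (c * (T - t)) * W t.
have cM (g h : R -> R) : {within `[0, T], continuous g} -> {within `[0, T], continuous h} ->
    {within `[0, T], continuous (fun t => g t * h t)}.
  by move=> cg ch x; apply: (@continuousM R (subspace `[0, T]) g h x); [exact: cg|exact: ch].
have cD (g h : R -> R) : {within `[0, T], continuous g} -> {within `[0, T], continuous h} ->
    {within `[0, T], continuous (fun t => g t + h t)}.
  by move=> cg ch x; apply: (@continuousD R _ (subspace `[0, T]) g h x); [exact: cg|exact: ch].
have caff : continuous (fun t : R => c * (T - t)).
  by move=> x; apply: cvgMr; apply: cvgB; [exact: cvg_cst|exact: cvg_id].
have cs : {within `[0, T], continuous (fun t => sin (c * (T - t)))}.
  apply: continuous_subspaceT => x; apply: continuous_comp; [exact: caff|exact: continuous_sin].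
have cc : {within `[0, T], continuous (fun t => c * cos (c * (T - t)))}.
  apply: continuous_subspaceT => x; apply: cvgMr.
  apply: continuous_comp; [exact: caff|exact: continuous_cos].
have cc2 : {within `[0, T], continuous (fun _ : R => c ^+ 2)}.
  by apply: continuous_subspaceT => x; exact: cvg_cst.
have cf : {within `[0, T], continuous f} by exact: cM cs (cD _ _ cW2 (cM _ _ cc2 cW)).
have cF : {within `[0, T], continuous F} by exact: cD (cM _ _ cs cW1) (cM _ _ cc cW).
have dF t : 0 < t < T -> is_derive t (1 : R) F (f t).
  move=> tT.
  have da : is_derive t (1 : R) (fun t : R => c * (T - t)) (- c).
    have := is_derive_affine (- c) (c * T) t.
    by congr is_derive; apply/funext => x; ring.
  have ds := @is_derive1_comp _ sin _ t _ _ (is_derive_sin _) da.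
  have dc := @is_derive1_comp _ cos _ t _ _ (is_derive_cos _) da.
  have h1 := is_deriveM ds (dW1 t tT).
  have h2 := is_deriveM (is_deriveZ c dc) (dW t tT).
  apply: is_derive_eq (is_deriveD h1 h2) _.
  have alg (s k w w1 w2 : R) : (s * w2 + w1 * (k * - c)) +
     ((c * k) * w1 + w * (c * (- s * - c))) = s * (w2 + c ^+ 2 * w) by ring.
  exact: alg.
have [cFi cF0 cFT] := (continuous_within_itvP F T0).1 cF.
have fi : leb.-integrable `[0, T] (EFin \o f).
  by apply: continuous_compact_integrable; [exact: segment_compact|].
have fi1 : leb.-integrable `]0, T] (EFin \o f).
  by apply: integrableS fi => //; exact: subset_itv_oc_cc.
have fi2 : leb.-integrable `]0, T[ (EFin \o f).
  by apply: integrableS fi => //; exact: subset_itv_oo_cc.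
split=> //; rewrite Rintegral_itv_bndo_bndc// Rintegral_itv_obnd_cbnd//.
rewrite /Rintegral (@continuous_FTC2 _ f F)//.
- rewrite -EFinB /= /F subrr mulr0 sin0 cos0 subr0 mulr1 mul0r add0r.
  by rewrite opprD addrA.
- split => [x|//|//]; rewrite in_itv/= => x0T.
  exact: (@ex_derive _ _ _ _ _ _ _ (dF x x0T)).
- move=> x; rewrite in_itv/= => x0T.
  by rewrite derive1E (@derive_val _ _ _ _ _ _ _ (dF x x0T)).
Qed.

Lemma measurable_reflect T :
  measurable_fun setT (fun x : measurableTypeR R => T - x : measurableTypeR R).
Proof. by apply: measurable_funB; [exact: measurable_cst|exact: measurable_id]. Qed.

(** By uniqueness of Lebesgue measure it suffices to look at half-open intervals; the reflection
    exchanges the open and the closed end and keeps the length. *)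
Lemma lebesgue_reflect T (A : set (measurableTypeR R)) : measurable A ->
  pushforward leb (fun x : measurableTypeR R => T - x : measurableTypeR R) A = leb A.
Proof.
move=> mA; apply/esym.
apply: (@lebesgue_measure_unique R (measure_function_pushforward__canonical__measure_function_Measure leb (measurable_reflect T))) => //.
move=> _ [[a b]] _ <-; rewrite /= /pushforward.
rewrite (_ : (fun x => T - x) @^-1` _ = `[T - b, T - a[%classic); last first.
  by apply/seteqP; split => x /=; rewrite !in_itv/= => /andP[? ?]; apply/andP; split; lra.
rewrite !lebesgue_measure_itv/= !lte_fin; case: ifPn => ab; case: ifPn => ab'; rewrite -?EFinB.
- by congr EFin; ring.
- by exfalso; move: ab'; rewrite -leNgt; lra.
- by exfalso; move: ab; rewrite -leNgt; lra.
- by [].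
Qed.

Lemma Rintegral_reflect T (g : R -> R) : leb.-integrable `]0, T[ (EFin \o g) ->
  \int[leb]_(t in `]0, T[) g (T - t) = \int[leb]_(t in `]0, T[) g t /\
  leb.-integrable `]0, T[ (EFin \o (fun t => g (T - t))).
Proof.
move=> gi; pose D : set (measurableTypeR R) := `]0, T[%classic.
have preD : (fun x => T - x) @^-1` D = D.
  by apply/seteqP; split => x; rewrite /D /= !in_itv/= => /andP[? ?]; apply/andP; split; lra.
have [|] := Rintegral_preserving (measurable_reflect T) (@lebesgue_reflect T) _ gi.
  exact: measurable_itv.
by rewrite preD.
Qed.

Definition boundary_pairing (T c : R) (Y : R -> R * R -> R) (a : R * R) : R :=
  \int[leb1]_(t in `]0, T[%classic) \int[arc_length]_(x in dOmega)
    (sin (c * (T - t)) * Y t x * cos (pdot a x)).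

(** This is the real part of the Fourier transform of the extension of [w] by zero, and [C_j] when
    [w = f_j]. *)
Definition cos_coef (w : R * R -> R) (a : R * R) : R :=
  \int[leb2]_(x in Omega) (w x * cos (pdot a x)).

(* The functionals [h0] and [hj] are combinations of these scalar ones, with
   [c] the frequency and [a] the wave vector. *)
Definition hcomp (T c : R) (I : data R) (j : 'I_2) (a : R * R) : R :=
  - sin (c * T) * cos_coef (u0s I j) a + c * cos_coef (uT I j) a
  - c * cos (c * T) * cos_coef (u0 I j) a - boundary_pairing T c (surf I j) a.

Lemma trig10 (a : R * R) : trig a 1 0 = fun x => cos (pdot a x).
Proof. by apply/funext => x; rewrite /trig mul1r mul0r addr0. Qed.

Definition wave_kernel (T c : R) (a : R * R) (z : measurableTypeR R * R2) : R :=
  sin (c * (T - z.1)) * cos (pdot a z.2).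

Lemma measurable_cos_pdot (a : R * R) : measurable_fun [set: R2] (fun x => cos (pdot a x)).
Proof. by rewrite -trig10; exact: continuous_measurable_plane (@trig_continuous R a 1 0). Qed.

Lemma measurable_wave_kernel T c a D : measurable_fun D (wave_kernel T c a).
Proof.
apply: measurable_funTS; apply: measurable_funM.
- have cs : continuous (fun t : R => sin (c * (T - t))).
    move=> x; apply: continuous_comp; last exact: continuous_sin.
    by apply: cvgMr; apply: cvgB; [exact: cvg_cst|exact: cvg_id].
  exact: (measurableT_comp (continuous_measurable_fun cs) measurable_fst).
- exact: (measurableT_comp (measurable_cos_pdot a) measurable_snd).
Qed.

Lemma wave_kernel_le1 T c a z : `|wave_kernel T c a z| <= 1.
Proof. by rewrite /wave_kernel normrM -[leRHS]mulr1 ler_pM// ?sin_max ?cos_max. Qed.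

(** As an integral over the slab against a kernel bounded by [1], the pairing is visibly linear in
    [Y] and bounded by its norm. The other two conclusions are what Fubini gives in addition, and
    the time-dependent argument uses them. *)
Lemma boundary_pairingE T c Y a : L1_L1 T Y ->
  boundary_pairing T c Y a =
    \int[slab_measure]_(z in boundary_slab T) (Y z.1 z.2 * wave_kernel T c a z) /\
  leb1.-integrable `]0, T[%classic (EFin \o (fun t => \int[arc_length]_(x in dOmega)
    (sin (c * (T - t)) * Y t x * cos (pdot a x)))) /\
  {ae leb1, forall t, `]0, T[%classic t -> arc_length.-integrable dOmega (EFin \o Y t)}.
Proof.
move=> Yi; have mS := measurable_slab (R := R) T.
have i1 := slab_integrable Yi.
have i2 := integrable_mul_bounded mS i1 (@measurable_wave_kernel T c a (boundary_slab T))
  (fun z _ => wave_kernel_le1 T c a z).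
have E : (fun z : measurableTypeR R * R2 => Y z.1 z.2 * wave_kernel T c a z) =
   (fun z => sin (c * (T - z.1)) * Y z.1 z.2 * cos (pdot a z.2)).
  by apply/funext => z; rewrite /wave_kernel; ring.
rewrite E in i2 *.
have [F1 [F2 _]] := @slab_Fubini R T (fun t x => sin (c * (T - t)) * Y t x * cos (pdot a x)) i2.
have [_ [_ F3]] := @slab_Fubini R T Y i1.
by split; [rewrite F1|split].
Qed.

End time_evolution.

(** * Scalar identities satisfied by exact data *)

Section exact_identity.
Context {R : realType}.
Local Notation R2 := (measurableTypeR R * measurableTypeR R)%type.
Local Notation leb := (@lebesgue_measure R).
Implicit Types (T c lam mu : R).

Lemma sum_I2 (F : 'I_2 -> R) : \sum_(i < 2) F i = F 0 + F 1.
Proof.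
rewrite big_ord_recl big_ord1; have -> : lift ord0 ord0 = 1 :> 'I_2 by exact/val_inj.
by [].
Qed.

Lemma I2P (P : 'I_2 -> Prop) : P 0 -> P 1 -> forall j, P j.
Proof.
move=> P0 P1 j; have [->|j0] := eqVneq j 0; first exact: P0.
by have -> : j = 1 by apply/val_inj; case: j j0 => -[|[|?]].
Qed.

Lemma integrable_bounded_cos (w : R * R -> R) a : leb2.-integrable (Omega : set R2) (EFin \o w) ->
  leb2.-integrable (Omega : set R2) (EFin \o (fun x => w x * cos (pdot a x))).
Proof.
move=> wi; apply: (@integrable_mul_bounded _ _ _ _ _ _ _ 1) => //.
- exact: measurable_Omega.
- by apply: measurable_funTS; exact: measurable_cos_pdot.
- by move=> x _; exact: cos_max.
Qed.

Lemma pairing_cos (w : R * R -> R) a : pairing w (trig a 1 0) = cos_coef w a.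
Proof. by rewrite trig10. Qed.

Lemma cos_coef_ae (w w' : R * R -> R) a : measurable_fun (Omega : set R2) w ->
  measurable_fun (Omega : set R2) w' ->
  {ae leb2, forall x, Omega x -> w x = w' x} -> cos_coef w a = cos_coef w' a.
Proof.
move=> mw mw' h; have mO := measurable_Omega (R := R).
have mc : measurable_fun (Omega : set R2) (fun x => cos (pdot a x)).
  by apply: measurable_funTS; exact: measurable_cos_pdot.
apply: ae_eq_Rintegral => //; [exact: measurable_funM|exact: measurable_funM|].
by refine (ae_imp h _) => x {}h Ox; rewrite h.
Qed.

Lemma L2Omega_measurable (w : R * R -> R) : L2Omega w -> measurable_fun (Omega : set R2) w.
Proof. by move=> h; exact: (Lp_measurable (measurable_Omega (R := R)) h). Qed.

Lemma is_ddt_ddt T (w : R -> R * R -> R) : (exists w', is_ddt T w w') -> is_ddt T w (ddt T w).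
Proof. by move=> [w' hw]; exact: getPex (ex_intro _ w' hw). Qed.

(** The cosine coefficients of [u] satisfy a linear system of ordinary differential equations for
    almost every time. The displacement traces vanish, and the traces of the stresses are eliminated
    in favour of the given traction. *)
Lemma ae_equation T lam mu (I : data R) u f a : 0 < T -> is_data T I ->
  inverse_solution T lam mu I u f ->
  (forall j, Ck_L2 T 2 (u j) /\ L2_H2 T (u j)) -> (forall j, L2Omega (f j)) ->
  {ae leb1, forall t, `]0, T[%classic t -> forall j,
    cos_coef (ddt T (ddt T (u j)) t) a =
    \int[arc_length]_(x in dOmega) (surf I j t x * cos (pdot a x)) -
    ((lam + mu) * coordinate j a * (\sum_(i < 2) coordinate i a * cos_coef (u i t) a) +
     mu * (a.1 ^+ 2 + a.2 ^+ 2) * cos_coef (u j t) a) + phi I t * cos_coef (f j) a}.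
Proof.
move=> T0 Idata [eqn tr0 _ trX] ureg fL2.
have H2u : {ae leb1, forall t, `]0, T[%classic t -> forall j, H2 (u j t)}.
  have [h0 _ _] := (ureg 0).2; have [h1 _ _] := (ureg 1).2.
  refine (ae_imp (ae_and h0 h1) _) => t [{}h0 {}h1] tT; apply: I2P; [exact: h0|exact: h1].
have Xi : {ae leb1, forall t, `]0, T[%classic t -> forall j,
    arc_length.-integrable dOmega (EFin \o surf I j t)}.
  have X j : L1_L1 T (surf I j) by case: (Idata.2 j).
  have [_ [_ h0]] := boundary_pairingE 0 0 (X 0).
  have [_ [_ h1]] := boundary_pairingE 0 0 (X 1).
  refine (ae_imp (ae_and h0 h1) _) => t [{}h0 {}h1] tT; apply: I2P; [exact: h0|exact: h1].
have mO := measurable_Omega (R := R). have mdO := measurable_dOmega (R := R).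
have mc : measurable_fun (Omega : set R2) (fun x => cos (pdot a x)).
  by apply: measurable_funTS; exact: measurable_cos_pdot.
have mcd : measurable_fun (dOmega : set R2) (fun x => cos (pdot a x)).
  by apply: measurable_funTS; exact: measurable_cos_pdot.
have d2L2 j t : `[0, T]%classic t -> L2Omega (ddt T (ddt T (u j)) t).
  move=> tT; have [[_ _ [_ /is_ddt_ddt h _]] _] := ureg j.
  exact: (h t tT).1.
refine (ae_imp (ae_and (ae_and eqn tr0) (ae_and trX (ae_and H2u Xi))) _) => t.
move=> [[E1 ht0] [h3 [hH hX]]] tT.
have tT' : `[0, T]%classic t by exact: subset_itv_oo_cc tT.
move: (E1 tT) (ht0 tT) (hH tT) (hX tT) (h3 tT) => {}E1 {}ht0 {}hH {}hX {h3} [s [th [hs hth hbd]]].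
move=> j.
(* [k] is the other index; with it the two boundary conditions take one common form. *)
have [k jk01 hbj] : exists2 k : 'I_2, (j = 0 /\ k = 1) \/ (j = 1 /\ k = 0) &
    {ae arc_length, forall x, dOmega x -> normal j x * s j x + normal k x * th x = surf I j t x}.
  move: j; apply: I2P.
  - exists 1; first by left.
    by refine (ae_imp hbd _) => x h /h[].
  - exists 0; first by right.
    by refine (ae_imp hbd _) => x h /h[].
have G := lame_green a jk01 hH ht0 hs hth.
rewrite !trig10 in G.
have sI i : measurable_fun (dOmega : set R2) (s i).
  by have [_ sL _] := hs i; exact: (Lp_measurable mdO sL).
have tI : measurable_fun (dOmega : set R2) th.
  by have [_ tL _] := hth; exact: (Lp_measurable mdO tL).
have mn i : measurable_fun (dOmega : set R2) (normal i).
  by apply: measurable_funTS; exact: measurable_normal.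
have BE : \int[arc_length]_(x in dOmega) ((normal j x * s j x + normal k x * th x) * cos (pdot a x)) =
    \int[arc_length]_(x in dOmega) (surf I j t x * cos (pdot a x)).
  apply: ae_eq_Rintegral => //.
  - by apply: measurable_funM => //; apply: measurable_funD; exact: measurable_funM.
  - by apply: measurable_funM => //; apply/measurable_EFinP; exact: measurable_int (hX j).
  - by refine (ae_imp hbj _) => x h Dx; rewrite h.
rewrite BE in G.
have h (i l : 'I_2) : H1 (wpartial i (u l t)) := (hH l).2 i.
have ilap : leb2.-integrable (Omega : set R2) (EFin \o laplacian (u j t)).
  have e (x : R * R) : laplacian (u j t) x =
      wpartial 0 (wpartial 0 (u j t)) x + wpartial 1 (wpartial 1 (u j t)) x.
    exact: (sum_I2 (fun i => wpartial i (wpartial i (u j t)) x)).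
  have -> : laplacian (u j t) =
      fun x => wpartial 0 (wpartial 0 (u j t)) x + wpartial 1 (wpartial 1 (u j t)) x.
    by apply/funext => x; exact (e x).
  exact: (integrableD mO (L2Omega_integrable (wpartialP 0 (h 0 j)).1)
    (L2Omega_integrable (wpartialP 1 (h 1 j)).1)).
have idiv : leb2.-integrable (Omega : set R2) (EFin \o wpartial j (divergence (fun j => u j t))).
  apply: L2Omega_integrable; apply: (wpartialP j _).1.
  rewrite (_ : divergence _ = fun x => wpartial 0 (u 0 t) x + wpartial 1 (u 1 t) x).
    exact: (H1_add (h 0 0) (h 1 1)).
  apply/funext => x; exact: (sum_I2 (fun i => wpartial i (u i t) x)).
have iL := integrable_lin mu (lam + mu) ilap idiv.
have ifj := L2Omega_integrable (fL2 j).
have iR := integrable_lin 1 (phi I t) iL ifj.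
transitivity (cos_coef (fun x => 1 * (mu * laplacian (u j t) x +
   (lam + mu) * wpartial j (divergence (fun j => u j t)) x) + phi I t * f j x) a).
  apply: cos_coef_ae.
  - exact: L2Omega_measurable (d2L2 j t tT').
  - by apply/measurable_EFinP; exact: measurable_int iR.
  - refine (ae_imp (E1 j) _) => x hx Ox; rewrite (hx Ox).
    by have alg (r s0 : R) : r + s0 = 1 * r + s0; [rewrite mul1r|exact: alg].
have cC := @trig_continuous R a 1 0.
have PL := pairing_lin 1 (phi I t) iL ifj cC; rewrite !trig10 in PL.
apply: (eq_trans PL); have alg (r r' s0 : R) : r = r' -> 1 * r + s0 = r' + s0 by move=> ->; rewrite mul1r.
exact: (alg _ _ _ G).
Qed.

(** The condition on [b] makes it an eigenvector, with eigenvalue [c^2], of the symbol found in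
    [lame_green]. The combination of the coefficients with weights [b] then obeys a scalar
    oscillator equation, and [duhamel] expresses its forcing by initial, final and boundary data. *)
Lemma exact_identity T lam mu (I : data R) u f a c (b : 'I_2 -> R) : 0 < T -> is_data T I ->
  inverse_solution T lam mu I u f ->
  (forall j, Ck_L2 T 2 (u j) /\ L2_H2 T (u j)) -> (forall j, L2Omega (f j)) ->
  (forall j, (lam + mu) * coordinate j a * (\sum_(i < 2) coordinate i a * b i) +
     mu * (a.1 ^+ 2 + a.2 ^+ 2) * b j = c ^+ 2 * b j) ->
  \sum_(j < 2) b j * hcomp T c I j a =
  (\int[leb1]_(t in `]0, T[%classic) (phi I (T - t) * sin (c * t))) *
  \sum_(j < 2) b j * cos_coef (f j) a.
Proof.
move=> T0 Idata sol ureg fL2 bE.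
have AE := ae_equation a T0 Idata sol ureg fL2.
have [_ _ init _] := sol.
have cC := @trig_continuous R a 1 0.
pose V j t := cos_coef (u j t) a.
pose V1 j t := cos_coef (ddt T (u j) t) a.
pose V2 j t := cos_coef (ddt T (ddt T (u j)) t) a.
have T0T : `[0, T]%classic 0 by rewrite /= in_itv/= lexx ltW.
have TTT : `[0, T]%classic T by rewrite /= in_itv/= lexx ltW.
have reg j : [/\ continuous_L2 T (u j), is_ddt T (u j) (ddt T (u j)),
    continuous_L2 T (ddt T (u j)), is_ddt T (ddt T (u j)) (ddt T (ddt T (u j))) &
    continuous_L2 T (ddt T (ddt T (u j)))].
  by have [[cu /is_ddt_ddt du [cu1 /is_ddt_ddt du1 cu2]] _] := ureg j.
have cV j : {within `[0, T], continuous (V j)}.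
  apply: within_cvg_continuous => // t tT; rewrite /V -pairing_cos.
  under eq_fun do rewrite -pairing_cos.
  by apply: continuous_L2_pairing => //; have [] := reg j.
have cV1 j : {within `[0, T], continuous (V1 j)}.
  apply: within_cvg_continuous => // t tT; rewrite /V1 -pairing_cos.
  under eq_fun do rewrite -pairing_cos.
  by apply: continuous_L2_pairing => //; have [] := reg j.
have cV2 j : {within `[0, T], continuous (V2 j)}.
  apply: within_cvg_continuous => // t tT; rewrite /V2 -pairing_cos.
  under eq_fun do rewrite -pairing_cos.
  by apply: continuous_L2_pairing => //; have [] := reg j.
have dV j t : 0 < t < T -> is_derive t (1 : R) (V j) (V1 j t).
  have [r1 r2 _ _ _] := reg j; move=> tT.
  have := is_ddt_pairing r1 r2 cC tT; rewrite pairing_cos.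
  by congr is_derive; apply/funext => s; rewrite pairing_cos.
have dV1 j t : 0 < t < T -> is_derive t (1 : R) (V1 j) (V2 j t).
  have [_ _ r1 r2 _] := reg j; move=> tT.
  have := is_ddt_pairing r1 r2 cC tT; rewrite pairing_cos.
  by congr is_derive; apply/funext => s; rewrite pairing_cos.
pose cmb (F : 'I_2 -> R -> R) t := b 0 * F 0 t + b 1 * F 1 t.
have ccmb F : (forall j, {within `[0, T], continuous (F j)}) -> {within `[0, T], continuous (cmb F)}.
  move=> cF x; apply: (@continuousD R _ (subspace `[0, T]) (fun t => b 0 * F 0 t) (fun t => b 1 * F 1 t) x);
    apply: cvgMr; exact: cF.
have dcmb F F' t : (forall j, is_derive t (1 : R) (F j) (F' j t)) -> is_derive t (1 : R) (cmb F) (cmb F' t).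
  by move=> dF; exact: is_deriveD (is_deriveZ (b 0) (dF 0)) (is_deriveZ (b 1) (dF 1)).
have [DU DUi] := duhamel c T0 (ccmb _ cV) (ccmb _ cV1) (ccmb _ cV2)
   (fun t tT => dcmb _ _ t (fun j => dV j t tT)) (fun t tT => dcmb _ _ t (fun j => dV1 j t tT)).
have mI : measurable (`]0, T[%classic : set (measurableTypeR R)) by exact: measurable_itv.
have mdO := measurable_dOmega (R := R).
have Xi j : L1_L1 T (surf I j) by case: (Idata.2 j).
pose beta j t := \int[arc_length]_(x in dOmega) (sin (c * (T - t)) * surf I j t x * cos (pdot a x)).
have BPi j : leb1.-integrable `]0, T[%classic (EFin \o beta j) by have [_ [h _]] := boundary_pairingE c a (Xi j).
have sm D : measurable_fun (D : set (measurableTypeR R)) (fun t => sin (c * (T - t))).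
  apply: measurable_funTS; apply: continuous_measurable_fun => x.
  apply: continuous_comp; last exact: continuous_sin.
  by apply: cvgMr; apply: cvgB; [exact: cvg_cst|exact: cvg_id].
have phii : leb1.-integrable `]0, T[%classic (EFin \o phi I).
  exact/(Lp1_integrable _ _ mI)/(Idata.1).
have psi : leb1.-integrable `]0, T[%classic (EFin \o (fun t => phi I t * sin (c * (T - t)))).
  by apply: (@integrable_mul_bounded _ _ _ _ _ _ _ 1) => // t _; exact: sin_max.
pose Fb := b 0 * cos_coef (f 0) a + b 1 * cos_coef (f 1) a.
(* The eigenvector relations make the terms in the unknown coefficients [V0] and [V1'] cancel. *)
have alg (s0 B0 B1 a0 a1 V0 V1' n p f0 f1 b0 b1 : R) :
    (lam + mu) * a0 * (a0 * b0 + a1 * b1) + mu * n * b0 = c ^+ 2 * b0 ->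
    (lam + mu) * a1 * (a0 * b0 + a1 * b1) + mu * n * b1 = c ^+ 2 * b1 ->
    s0 * (b0 * (B0 - ((lam + mu) * a0 * (a0 * V0 + a1 * V1') + mu * n * V0) + p * f0) +
          b1 * (B1 - ((lam + mu) * a1 * (a0 * V0 + a1 * V1') + mu * n * V1') + p * f1) +
          c ^+ 2 * (b0 * V0 + b1 * V1')) =
    b0 * (s0 * B0) + b1 * (s0 * B1) + (b0 * f0 + b1 * f1) * (p * s0).
  move=> h0 h1.
  rewrite (_ : c ^+ 2 * (b0 * V0 + b1 * V1') = (c ^+ 2 * b0) * V0 + (c ^+ 2 * b1) * V1'); last by ring.
  by rewrite -h0 -h1; ring.
have bE0 := bE 0; have bE1 := bE 1; rewrite !sum_I2 in bE0 bE1.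
have aeE : {ae leb1, forall t, `]0, T[%classic t ->
    sin (c * (T - t)) * (cmb V2 t + c ^+ 2 * cmb V t) =
    b 0 * beta 0 t + b 1 * beta 1 t + Fb * (phi I t * sin (c * (T - t)))}.
  have [_ [_ x0]] := boundary_pairingE c a (Xi 0).
  have [_ [_ x1]] := boundary_pairingE c a (Xi 1).
  refine (ae_imp (ae_and AE (ae_and x0 x1)) _) => t [h [h0 h1]] tT.
  have bt j : arc_length.-integrable dOmega (EFin \o surf I j t) ->
      beta j t = sin (c * (T - t)) * \int[arc_length]_(x in dOmega) (surf I j t x * cos (pdot a x)).
    move=> hj; rewrite /beta -RintegralZl//; last first.
      apply: (@integrable_mul_bounded _ _ _ _ _ _ _ 1) => //.
      - by apply: measurable_funTS; exact: measurable_cos_pdot.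
      - by move=> x _; exact: cos_max.
    by apply: eq_Rintegral => x _; rewrite mulrA.
  have g0 := h tT 0; have g1 := h tT 1; rewrite !sum_I2 in g0 g1.
  have f4 (r0 r0' r1 r1' s v0 v1 : R) : r0 = r0' -> r1 = r1' ->
     s * (b 0 * r0 + b 1 * r1 + c ^+ 2 * (b 0 * v0 + b 1 * v1)) =
     s * (b 0 * r0' + b 1 * r1' + c ^+ 2 * (b 0 * v0 + b 1 * v1)) by move=> -> ->.
  have f5 (y0 y0' y1 y1' z : R) : y0 = y0' -> y1 = y1' ->
     b 0 * y0 + b 1 * y1 + z = b 0 * y0' + b 1 * y1' + z by move=> -> ->.
  exact (eq_trans (f4 _ _ _ _ _ _ _ g0 g1) (eq_trans (alg _ _ _ _ _ _ _ _ _ _ _ _ _ bE0 bE1)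
    (f5 _ _ _ _ _ (esym (bt 0 (h0 tT))) (esym (bt 1 (h1 tT)))))).
have Ei : leb1.-integrable `]0, T[%classic (EFin \o (fun t =>
    b 0 * beta 0 t + b 1 * beta 1 t + Fb * (phi I t * sin (c * (T - t))))).
  exact: (integrableD mI (integrableD mI (integrableZl mI (b 0) (BPi 0))
    (integrableZl mI (b 1) (BPi 1))) (integrableZl mI Fb psi)).
have IE : \int[leb]_(t in `]0, T[) (sin (c * (T - t)) * (cmb V2 t + c ^+ 2 * cmb V t)) =
    b 0 * boundary_pairing T c (surf I 0) a + b 1 * boundary_pairing T c (surf I 1) a +
    Fb * \int[leb1]_(t in `]0, T[%classic) (phi I t * sin (c * (T - t))).
  transitivity (\int[leb1]_(t in `]0, T[%classic) (b 0 * beta 0 t + b 1 * beta 1 t +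
      Fb * (phi I t * sin (c * (T - t))))).
    apply: ae_eq_Rintegral => //.
    - by apply/measurable_EFinP; exact: measurable_int DUi.
    - by apply/measurable_EFinP; exact: measurable_int Ei.
  rewrite RintegralD//; [|exact: (integrableD mI (integrableZl mI (b 0) (BPi 0))
    (integrableZl mI (b 1) (BPi 1)))|exact: (integrableZl mI Fb psi)].
  rewrite RintegralD//; [|exact: (integrableZl mI (b 0) (BPi 0))|exact: (integrableZl mI (b 1) (BPi 1))].
  by rewrite !RintegralZl.
(* [duhamel] puts the time reversal on the sine, while [D1] and [D2] put it on [phi]. *)
have reflE : \int[leb1]_(t in `]0, T[%classic) (phi I (T - t) * sin (c * t)) =
    \int[leb1]_(t in `]0, T[%classic) (phi I t * sin (c * (T - t))).
  have [<- _] := Rintegral_reflect psi.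
  by apply: eq_Rintegral => t _; rewrite subKr.
have mO := measurable_Omega (R := R).
have md j : [/\ measurable_fun (Omega : set R2) (u0 I j), measurable_fun (Omega : set R2) (u0s I j) &
    measurable_fun (Omega : set R2) (uT I j)].
  by have [_ h1 h2 h3] := Idata.2 j; split; [exact: (Lp_measurable mO h1)|
    exact: (Lp_measurable mO h2)|exact: (Lp_measurable mO h3)].
have mu_ j t : `[0, T]%classic t -> measurable_fun (Omega : set R2) (u j t).
  by move=> tT; have [r1 _ _ _ _] := reg j; exact: L2Omega_measurable (r1 t tT).1.
have eU j : V j 0 = cos_coef (u0 I j) a.
  have [m1 _ _] := md j; apply: (cos_coef_ae a (mu_ j 0 T0T) m1).
  by refine (ae_imp (init j) _) => x h /h[].
have eS j : V1 j 0 = cos_coef (u0s I j) a.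
  have [_ m1 _] := md j; have [_ _ r1 _ _] := reg j.
  apply: (cos_coef_ae a (L2Omega_measurable (r1 0 T0T).1) m1).
  by refine (ae_imp (init j) _) => x h /h[].
have eT j : V j T = cos_coef (uT I j) a.
  have [_ _ m1] := md j; apply: (cos_coef_ae a (mu_ j T TTT) m1).
  by refine (ae_imp (init j) _) => x h /h[].
move: DU; rewrite IE reflE !sum_I2 /cmb !eU !eS !eT /hcomp -/Fb.
set Dp := \int[leb1]_(t in `]0, T[%classic) (phi I t * sin (c * (T - t))).
have alg2 (b0 b1 P0 P1 F D U0 U1 S0 S1 T0' T1 s0 k0 : R) :
   b0 * P0 + b1 * P1 + F * D = c * (b0 * T0' + b1 * T1) - s0 * (b0 * S0 + b1 * S1) -
     c * k0 * (b0 * U0 + b1 * U1) ->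
   b0 * (- s0 * S0 + c * T0' - c * k0 * U0 - P0) + b1 * (- s0 * S1 + c * T1 - c * k0 * U1 - P1) = D * F.
  move=> h; have -> : D * F = (b0 * P0 + b1 * P1 + F * D) - b0 * P0 - b1 * P1 by ring.
  by rewrite h; ring.
by move=> h; exact: (alg2 _ _ _ _ _ _ _ _ _ _ _ _ _ _ h).
Qed.

End exact_identity.

(** * Poisson kernel and inversion formulas *)

Section Poisson_kernel.
Context {R : realType}.
Local Notation leb := (@lebesgue_measure R).
Implicit Types (e x y s a b : R).

Lemma Rintegral_even_odd (g : R -> R) : leb.-integrable setT (EFin \o g) ->
  \int[leb]_s g s = \int[leb]_(s in `[0, +oo[) (g s + g (- s)) /\
  leb.-integrable `[0, +oo[ (EFin \o (fun s => g (- s))).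
Proof.
move=> gi.
have iS (A : set (measurableTypeR R)) : measurable A -> leb.-integrable A (EFin \o g).
  by move=> mA; apply: integrableS gi.
have iN : leb.-integrable setT (EFin \o (fun s : R => g (- s))).
  have [_] := Rintegral_preserving (measurable_reflect 0) (@lebesgue_reflect R 0) measurableT gi.
  by rewrite preimage_setT; apply: eq_integrable => // s _ /=; rewrite sub0r.
have iNS (A : set (measurableTypeR R)) : measurable A -> leb.-integrable A (EFin \o (fun s : R => g (- s))).
  by move=> mA; apply: integrableS iN.
split; last by apply: iNS; exact: measurable_itv.
have -> : [set: measurableTypeR R] = `]-oo, 0[%classic `|` `[0, +oo[%classic.
  apply/seteqP; split => // s _ /=; rewrite !in_itv/= andbT.
  by case: (ltP s 0) => h; [left|right].
rewrite Rintegral_setU//; last 2 first.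
- by apply: iS; apply: measurableU; exact: measurable_itv.
- apply/disj_setPS => s [] /=; rewrite !in_itv/= andbT => h1 h2.
  by move: (lt_le_trans h1 h2); rewrite ltxx.
have E : \int[leb]_(s in `]-oo, 0[) g s = \int[leb]_(s in `[0, +oo[) g (- s).
  have [<- _] := Rintegral_preserving (measurable_reflect 0) (@lebesgue_reflect R 0)
     (measurable_itv `]-oo, (0:R)[) (iS _ (measurable_itv `]-oo, 0[)).
  rewrite -Rintegral_itv_obnd_cbnd; last by apply: iNS; exact: measurable_itv.
  have -> : (fun x : R => 0 - x) @^-1` `]-oo, 0[ = `]0, +oo[%classic.
    by apply/seteqP; split => s /=; rewrite !in_itv/= andbT sub0r oppr_lt0.
  by apply: eq_Rintegral => s _; rewrite sub0r.
rewrite E addrC RintegralD//; first by apply: iS; exact: measurable_itv.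
by apply: iNS; exact: measurable_itv.
Qed.

Definition damping e s : R := expR (- (e * `|s|)).

(** The Fourier transform of [damping e], that is, [2 pi] times the Poisson kernel of the
    half-plane; its total mass is [2 pi]. *)
Definition poisson e y : R := 2 * e / (e ^+ 2 + y ^+ 2).

Lemma damping_ge0 e s : 0 <= damping e s. Proof. exact: expR_ge0. Qed.

Lemma damping_le1 e s : 0 < e -> `|damping e s| <= 1.
Proof.
move=> e0; rewrite ger0_norm ?damping_ge0// -expR0 ler_expR oppr_le0.
by rewrite mulr_ge0// ltW.
Qed.

Lemma continuous_damping e : continuous (damping e).
Proof.
move=> s; apply: continuous_comp; last exact: continuous_expR.
by apply: cvgN; apply: cvgMr; exact: norm_continuous.
Qed.

Lemma measurable_damping e (D : set (measurableTypeR R)) : measurable_fun D (damping e).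
Proof.
by apply: measurable_funTS; apply: continuous_measurable_fun; exact: continuous_damping.
Qed.

Lemma damping_integrable e : 0 < e -> leb.-integrable setT (EFin \o damping e).
Proof.
move=> e0.
have pi0 := integrable_exponential_pdf e0.
have pN : leb.-integrable setT (EFin \o (fun s : R => exponential_pdf e (- s))).
  have [_] := Rintegral_preserving (measurable_reflect 0) (@lebesgue_reflect R 0) measurableT pi0.
  by rewrite preimage_setT; apply: eq_integrable => // s _ /=; rewrite sub0r.
(* The two-sided exponential is at most [1/e] times the sum of the exponential density and its
   reflection. *)
have := integrableZl measurableT e^-1 (integrableD measurableT pi0 pN).
apply: le_integrable => //; first by apply/measurable_EFinP; exact: measurable_damping.
move=> s _; rewrite lee_fin ger0_norm ?damping_ge0//.
have p0 z : 0 <= exponential_pdf e z by rewrite exponential_pdf_ge0// ltW.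
have pE z : 0 <= z -> exponential_pdf e z = e * expR (- (e * z)).
  by move=> z0; rewrite /exponential_pdf patchE mem_set ?mulNr//= in_itv/= z0.
rewrite /= ger0_norm; last by rewrite mulr_ge0 ?addr_ge0// invr_ge0 ltW.
rewrite ler_pdivlMl//.
have [s0|s0] := leP 0 s.
- by rewrite -[leLHS]addr0 lerD// pE// /damping ger0_norm.
- have Ns0 : 0 <= - s by rewrite oppr_ge0 ltW.
  by rewrite (pE (- s) Ns0) /damping ltr0_norm// lerDr.
Qed.

Lemma cvg_natM_pinfty e : 0 < e -> e * n.+1%:R @[n --> \oo] --> +oo.
Proof.
move=> e0; have c : (fun n : nat => n.+1%:R : R) @ \oo --> +oo.
  by have := @cvgr_idn R; rewrite -(cvg_shiftS (fun n : nat => n%:R : R)).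
exact: (cvg_comp _ _ c (gt0_cvgMry e0 (@cvg_id _ _))).
Qed.

Lemma cvg_expRN_nat e : 0 < e -> expR (- (e * n.+1%:R)) @[n --> \oo] --> 0.
Proof.
by move=> e0; exact: (cvg_comp _ _ (cvg_natM_pinfty e0) (@cvgr_expR R)).
Qed.

Lemma integrable_damped e y k : 0 < e -> continuous k -> (forall z, `|k z| <= 1) ->
  leb.-integrable setT (EFin \o (fun s => damping e s * k (y * s))).
Proof.
move=> e0 ck k1; apply: (@integrable_mul_bounded _ _ _ _ _ _ _ 1) => //.
  exact: damping_integrable.
apply: continuous_measurable_fun => s; apply: continuous_comp; last exact: ck.
by apply: cvgMr; exact: cvg_id.
Qed.

Lemma Rintegral_damped_cos_half e y : 0 < e ->
  \int[leb]_(s in `[0, +oo[) (damping e s * cos (y * s)) = e / (e ^+ 2 + y ^+ 2).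
Proof.
move=> e0; have ey0 : 0 < e ^+ 2 + y ^+ 2 by rewrite ltr_pwDl ?sqr_ge0// exprn_gt0.
pose g s := expR (- (e * s)) * cos (y * s).
(* A primitive of [g]: the real part of [exp ((- e + i y) s) / (- e + i y)]. *)
pose F s := expR (- (e * s)) * ((y * sin (y * s) - e * cos (y * s)) / (e ^+ 2 + y ^+ 2)).
have cl c : continuous (fun s : R => c * s) by move=> s; apply: cvgMr; exact: cvg_id.
have cg : continuous g.
  move=> s; apply: cvgM; last by apply: continuous_comp; [exact: cl|exact: continuous_cos].
  apply: continuous_comp; last exact: continuous_expR.
  by apply: cvgN; exact: cl.
have dF s : is_derive s (1 : R) F (g s).
  have d1 : is_derive s (1 : R) (fun s : R => - (e * s)) (- e).
    by have := is_derive_affine (- e) 0 s; congr is_derive; apply/funext => z; rewrite addr0 mulNr.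
  have d2 : is_derive s (1 : R) (fun s : R => y * s) y.
    by have := is_derive_affine y 0 s; congr is_derive; apply/funext => z; rewrite addr0.
  have de := @is_derive1_comp _ expR _ s _ _ (is_derive_expR _) d1.
  have dc := @is_derive1_comp _ cos _ s _ _ (is_derive_cos _) d2.
  have ds := @is_derive1_comp _ sin _ s _ _ (is_derive_sin _) d2.
  have h1 := is_deriveB (is_deriveZ y ds) (is_deriveZ e dc).
  have h := is_deriveM de (is_deriveZ (e ^+ 2 + y ^+ 2)^-1 h1).
  have {}h := is_derive_eq h.
  have alg (E S C q : R) : (e ^+ 2 + y ^+ 2) * q = 1 ->
      E * (q * (y * (C * y) - e * (- S * y))) + (q * (y * S - e * C)) * (E * - e) = E * C.
    move=> hq; transitivity (E * C * ((e ^+ 2 + y ^+ 2) * q)); first by ring.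
    by rewrite hq mulr1.
  have {}h := h _ (alg _ _ _ _ (divff (lt0r_neq0 ey0))).
  by move: h; congr is_derive; apply/funext => z; rewrite /F [in RHS](mulrC _ _^-1).
have gE s : 0 <= s -> damping e s * cos (y * s) = g s.
  by move=> s0; rewrite /damping ger0_norm.
have iD : leb.-integrable `[0, +oo[ (EFin \o damping e).
  apply: integrableS (damping_integrable e0) => //.
have cF : continuous F.
  by move=> s; apply: differentiable_continuous; apply/derivable1_diffP; exact: (@ex_derive _ _ _ _ _ _ _ (dF s)).
pose G (n : nat) := g \_ `[0, n.+1%:R].
have GE n : \int[leb]_(s in `[0, +oo[) G n s = F n.+1%:R - F 0.
  rewrite /G -Rintegral_mkcondr (_ : _ `&` _ = `[0, n.+1%:R]%classic); last first.
    by rewrite setIidr// => s /=; rewrite !in_itv/= => /andP[->].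
  rewrite /Rintegral (@continuous_FTC2 _ g F)//.
  - exact: continuous_subspaceT.
  - split => [s _| |]; [exact: (@ex_derive _ _ _ _ _ _ _ (dF s))| |].
    + exact/cvg_at_right_filter/cF.
    + exact/cvg_at_left_filter/cF.
  - by move=> s _; rewrite derive1E (@derive_val _ _ _ _ _ _ _ (dF s)).
have L1 : \int[leb]_(s in `[0, +oo[) G n s @[n --> \oo] -->
    \int[leb]_(s in `[0, +oo[) (damping e s * cos (y * s)).
  apply: (@Rintegral_dominated_cvg _ _ _ leb `[0, +oo[ G _ (damping e)) => //.
  - move=> n; apply: measurable_funTS; apply/(measurable_restrictT _ (measurable_itv _)).
    by apply: measurable_funTS; exact: continuous_measurable_fun.
  - apply: measurable_funTS; apply: measurable_funM; first exact: measurable_damping.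
    by apply: continuous_measurable_fun => s; apply: continuous_comp; [exact: cl|exact: continuous_cos].
  - apply: aeW => s /=; rewrite in_itv/= andbT => s0; rewrite gE//.
    apply: cvg_near_cst; near=> n; rewrite /G patchE mem_set//= in_itv/= s0/=.
    apply: (@le_trans _ _ (n%:R)); last by rewrite ler_nat.
    by near: n; exact: nbhs_infty_ger.
  - move=> n s /=; rewrite in_itv/= andbT => s0; rewrite /G patchE.
    case: ifP => _; last by rewrite normr0 damping_ge0.
    rewrite -gE// normrM -[leRHS]mulr1 ler_pM ?cos_max//.
    by rewrite ger0_norm ?damping_ge0.
have L2 : \int[leb]_(s in `[0, +oo[) G n s @[n --> \oo] --> 0 - F 0.
  under eq_fun do rewrite GE.
  apply: cvgB; last exact: cvg_cst.
  pose K := (`|y| + e) / (e ^+ 2 + y ^+ 2).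
  apply: (@squeeze_cvgr _ _ _ _ (fun n => - (expR (- (e * n.+1%:R)) * K)) (fun n => expR (- (e * n.+1%:R)) * K)).
  - apply: nearW => n; rewrite -ler_norml /F normrM ger0_norm ?expR_ge0//.
    rewrite ler_wpM2l ?expR_ge0// /K normrM [X in _ * X]ger0_norm; last by rewrite invr_ge0 ltW.
    rewrite ler_wpM2r ?invr_ge0 ?(ltW ey0)//; apply: (le_trans (ler_normB _ _)).
    rewrite !normrM (gtr0_norm e0) lerD//.
      by rewrite -[leRHS]mulr1 ler_wpM2l ?sin_max.
    by rewrite -[leRHS]mulr1 ler_wpM2l ?cos_max ?ltW.
  - rewrite -oppr0 -(mul0r K); apply: cvgN; apply: cvgMl; exact: cvg_expRN_nat.
  - rewrite -(mul0r K); apply: cvgMl; exact: cvg_expRN_nat.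
rewrite (cvg_unique (@Rhausdorff R) L1 L2) /F !mulr0 oppr0 expR0 sin0 cos0 mulr0 mulr1 !sub0r mul1r.
by rewrite mulNr opprK.
Unshelve. all: by end_near. Qed.

Lemma Rintegral_damped_cos e y : 0 < e ->
  \int[leb]_s (damping e s * cos (y * s)) = poisson e y.
Proof.
move=> e0; have i := integrable_damped y e0 (@continuous_cos R) (@cos_max R).
rewrite (Rintegral_even_odd i).1.
have -> : (fun s => damping e s * cos (y * s) + damping e (- s) * cos (y * - s)) =
   (fun s => 2 * (damping e s * cos (y * s))).
  by apply/funext => s; rewrite /damping normrN mulrN cosN -mulr2n mulr_natl.
rewrite RintegralZl//; first by rewrite Rintegral_damped_cos_half// mulrA.
exact: integrableS i.
Qed.

Lemma Rintegral_damped_sin e y : 0 < e ->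
  \int[leb]_s (damping e s * sin (y * s)) = 0.
Proof.
move=> e0; have i := integrable_damped y e0 (@continuous_sin R) (@sin_max R).
rewrite (Rintegral_even_odd i).1.
have -> : (fun s => damping e s * sin (y * s) + damping e (- s) * sin (y * - s)) =
   (fun s => 0).
  by apply/funext => s; rewrite /damping normrN mulrN sinN mulrN subrr.
by rewrite Rintegral_cst// mul0r.
Qed.

(** The integral of the kernel centred at [x] over [(a, b)], in closed form. It is bounded uniformly
    in [e], unlike the kernel, and this permits dominated convergence as [e] tends to zero. *)
Definition poisson_mass e a b x : R := 2 * (atan ((b - x) / e) - atan ((a - x) / e)).

Lemma poissonN e y : poisson e (- y) = poisson e y.
Proof. by rewrite /poisson sqrrN. Qed.

Lemma continuous_poisson e : 0 < e -> continuous (poisson e).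
Proof.
move=> e0 y; apply: cvgMr; apply: cvgV.
  by rewrite lt0r_neq0// ltr_pwDl ?sqr_ge0// exprn_gt0.
by apply: cvgD; [exact: cvg_cst|exact: exprn_continuous].
Qed.

Lemma poisson_bound e y : 0 < e -> `|poisson e y| <= 2 / e.
Proof.
move=> e0; have h : 0 < e ^+ 2 + y ^+ 2 by rewrite ltr_pwDl ?sqr_ge0// exprn_gt0.
rewrite ger0_norm /poisson; last by rewrite divr_ge0 ?mulr_ge0// ltW.
rewrite ler_pdivrMr// mulrAC ler_pdivlMr// -mulrA -expr2 ler_wpM2l//.
by rewrite lerDl sqr_ge0.
Qed.

Lemma Rintegral_poisson e a b x : 0 < e -> a < b ->
  \int[leb]_(z in `]a, b[) poisson e (x - z) = poisson_mass e a b x.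
Proof.
move=> e0 ab; have eN0 := lt0r_neq0 e0.
pose F z := 2 * atan ((z - x) / e).
have cP : continuous (fun z => poisson e (x - z)).
  move=> z; apply: (@continuous_comp _ _ _ (fun z : R => x - z) (poisson e)); last exact: continuous_poisson.
  by apply: cvgB; [exact: cvg_cst|exact: cvg_id].
have dF z : is_derive z (1 : R) F (poisson e (x - z)).
  have d1 : is_derive z (1 : R) (fun z : R => (z - x) / e) e^-1.
    have := is_derive_affine e^-1 (- x / e) z; congr is_derive; apply/funext => t.
    by rewrite mulrBl mulNr mulrC.
  have da := is_deriveZ (2 : R) (@is_derive1_comp _ atan _ z _ _ (is_derive1_atan _) d1).
  apply: is_derive_eq da _; rewrite /poisson.
  have h : e ^+ 2 + (x - z) ^+ 2 != 0 by rewrite lt0r_neq0// ltr_pwDl ?sqr_ge0// exprn_gt0.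
  have h3 : e ^+ 2 + (z - x) ^+ 2 != 0 by rewrite lt0r_neq0// ltr_pwDl ?sqr_ge0// exprn_gt0.
  have h2 : 1 + ((z - x) / e) ^+ 2 != 0 by rewrite lt0r_neq0// ltr_pwDl ?sqr_ge0.
  by rewrite /GRing.scale/=; field; rewrite ?eN0 ?h ?h3/= ?h ?h3.
have cF : continuous F.
  by move=> s; apply: differentiable_continuous; apply/derivable1_diffP; exact: (@ex_derive _ _ _ _ _ _ _ (dF s)).
have iP : leb.-integrable `[a, b] (EFin \o (fun z => poisson e (x - z))).
  by apply: continuous_compact_integrable; [exact: segment_compact|exact: continuous_subspaceT].
rewrite Rintegral_itv_bndo_bndc; last by apply: integrableS iP => //; exact: subset_itv_oo_cc.
rewrite Rintegral_itv_obnd_cbnd; last by apply: integrableS iP => //; exact: subset_itv_oc_cc.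
rewrite /Rintegral (@continuous_FTC2 _ _ F)//.
- by rewrite /= /F /poisson_mass mulrBr.
- exact: continuous_subspaceT.
- split => [s _| |]; [exact: (@ex_derive _ _ _ _ _ _ _ (dF s))| |].
  + exact/cvg_at_right_filter/cF.
  + exact/cvg_at_left_filter/cF.
- by move=> s _; rewrite derive1E (@derive_val _ _ _ _ _ _ _ (dF s)).
Qed.

Lemma continuous_poisson_mass e a b : continuous (poisson_mass e a b).
Proof.
have h c : continuous (fun x : R => atan ((c - x) / e)).
  move=> x; apply: continuous_comp; last exact: continuous_atan.
  by apply: cvgMl; apply: cvgB; [exact: cvg_cst|exact: cvg_id].
by move=> x; apply: cvgMr; apply: cvgB; exact: h.
Qed.

Lemma measurable_poisson_mass e a b (D : set (measurableTypeR R)) :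
  measurable_fun D (poisson_mass e a b).
Proof.
by apply: measurable_funTS; apply: continuous_measurable_fun; exact: continuous_poisson_mass.
Qed.

Lemma continuous_poisson_massN e a b : continuous (fun x => poisson_mass e a b (- x)).
Proof.
move=> x; apply: (@continuous_comp _ _ _ (fun x : R => - x) (poisson_mass e a b)).
  exact: opp_continuous.
exact: continuous_poisson_mass.
Qed.

Lemma poisson_mass_bound e a b x : `|poisson_mass e a b x| <= 2 * pi.
Proof.
rewrite /poisson_mass normrM ger0_norm// ler_wpM2l//.
have := (atan_ltpi2 ((b - x) / e), atan_gtNpi2 ((b - x) / e),
  atan_ltpi2 ((a - x) / e), atan_gtNpi2 ((a - x) / e)).
by case=> -[[h1 h2] h3] h4; rewrite ler_norml; apply/andP; split; lra.
Qed.

Lemma cvg_atan_harmonic (z : R) : z != 0 ->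
  atan (z / n.+1%:R^-1) @[n --> \oo] --> Num.sg z * (pi / 2).
Proof.
move=> z0; have H (y : R) : 0 < y -> atan (y / n.+1%:R^-1) @[n --> \oo] --> pi / 2.
  move=> y0; apply: (cvg_comp _ _ _ (@cvgy_atan R)).
  by under eq_fun do rewrite invrK; exact: cvg_natM_pinfty.
have [z1|z1] := ltP 0 z; first by rewrite gtr0_sg// mul1r; exact: H.
have {}z1 : z < 0 by rewrite lt_neqAle z0.
rewrite ltr0_sg// mulN1r; have /H/cvgN : 0 < - z by rewrite oppr_gt0.
apply: cvg_trans; apply: near_eq_cvg; apply: nearW => n.
by rewrite fctE mulNr atanN opprK.
Qed.

(** The arctangents tend to [pi/2] times the signs of [b - x] and [a - x]. At an end point the limit
    is [pi], half of the value inside; such points form a null set. *)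
Lemma cvg_poisson_mass a b x : a < b -> x != a -> x != b ->
  poisson_mass n.+1%:R^-1 a b x @[n --> \oo] --> 2 * pi * \1_(`]a, b[%classic : set R) x.
Proof.
move=> ab xa xb.
have ha := @cvg_atan_harmonic (a - x) _; have hb := @cvg_atan_harmonic (b - x) _.
have /ha {}ha : a - x != 0 by rewrite subr_eq0 eq_sym.
have /hb {}hb : b - x != 0 by rewrite subr_eq0 eq_sym.
have -> : 2 * pi * \1_(`]a, b[%classic : set R) x =
  2 * (Num.sg (b - x) * (pi / 2) - Num.sg (a - x) * (pi / 2)).
  rewrite indicE; have [ax|ax] := ltP a x.
    have [bx|bx] := ltP x b.
      rewrite mem_set/= ?in_itv/= ?ax ?bx// gtr0_sg ?subr_gt0// ltr0_sg ?subr_lt0//.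
      by field.
    rewrite memNset/= ?in_itv/= ?ax ?ltNge ?bx//.
    have {}bx : b < x by rewrite lt_neqAle bx eq_sym xb.
    by rewrite !ltr0_sg ?subr_lt0//; ring.
  rewrite memNset/= ?in_itv/= ?ltNge ?ax//.
  have {}ax : x < a by rewrite lt_neqAle ax xa.
  by rewrite !gtr0_sg ?subr_gt0 ?(lt_trans ax ab)//; ring.
by apply: cvgMr; exact: cvgB.
Qed.

End Poisson_kernel.

(** * From zero integrals over intervals and boxes to zero almost everywhere *)

Section vanishing_on_boxes.
Context {R : realType}.
Local Notation R2 := (measurableTypeR R * measurableTypeR R)%type.
Local Notation leb := (@lebesgue_measure R).

(** The open rays []x, +oo[] generate the sigma-algebra, are stable under intersection and cut
    [(0, L)] in intervals. *)
Lemma ae_eq0_itv (L : R) (g : R -> R) : leb.-integrable `]0, L[ (EFin \o g) ->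
  (forall a b, 0 <= a -> a < b -> b <= L -> \int[leb]_(x in `]a, b[) g x = 0) ->
  (forall A : set (measurableTypeR R), measurable A -> \int[leb]_(x in `]0, L[ `&` A) g x = 0) /\
  {ae leb, forall x, `]0, L[%classic x -> g x = 0}.
Proof.
move=> gi g0; pose D : set (measurableTypeR R) := `]0, L[%classic.
have mD : measurable D by exact: measurable_itv.
have g0' a b : 0 <= a -> b <= L -> \int[leb]_(x in `]a, b[) g x = 0.
  move=> a0 bL; have [ab|ba] := ltP a b; first exact: g0.
  by rewrite set_itv_ge ?Rintegral_set0// bnd_simp -leNgt.
have E (A : set (measurableTypeR R)) : \int[leb]_(x in A) (g \_ D) x = \int[leb]_(x in D `&` A) g x.
  by rewrite setIC Rintegral_mkcondr.
have [|||||h1 h2] := @Rintegral_generator_eq0 _ (measurableTypeR R) R leb (RGenOInfty.G (R := R)) (g \_ D).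
- exact: RGenOInfty.measurableE.
- move=> _ _ [x ->] [y ->]; exists (Num.max x y).
  by apply/seteqP; split => z /=; rewrite !in_itv/= !andbT gt_max;
    [move=> [-> ->]|move=> /andP[-> ->]].
- by rewrite -restrict_EFin; apply/(integrable_mkcond _ mD).
- by rewrite E setIT; exact: g0'.
- move=> _ [x ->]; rewrite E (_ : D `&` _ = `]Num.max x 0, L[%classic).
    by apply: g0' => //; rewrite le_max lexx orbT.
  apply/seteqP; split => z; rewrite /D /= !in_itv/= andbT gt_max.
    by move=> [/andP[-> ->] ->].
  by move=> /andP[/andP[-> ->] ->].
split=> [A mA|]; first by rewrite -E; exact: h1.
by refine (ae_imp h2 _) => x; rewrite patchE => + Dx; rewrite mem_set.
Qed.

(** One side of the box is enlarged at a time from an interval to a measurable set, by applying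
    [ae_eq0_itv] to the partial integral in that variable; measurable rectangles generate the
    product sigma-algebra. *)
Lemma ae_eq0_Omega (g : R * R -> R) : leb2.-integrable (Omega : set R2) (EFin \o g) ->
  (forall a1 b1 a2 b2, 0 <= a1 -> a1 < b1 -> b1 <= 1 -> 0 <= a2 -> a2 < b2 -> b2 <= 1 ->
     \int[leb2]_(x in `]a1, b1[ `*` `]a2, b2[) g x = 0) ->
  {ae leb2, forall x : R2, Omega x -> g x = 0}.
Proof.
move=> gi g0; pose D : set (measurableTypeR R) := `]0, 1[%classic.
have mD : measurable D by exact: measurable_itv.
have mO := measurable_Omega (R := R).
have giS (A : set R2) : measurable A -> A `<=` Omega -> (leb \x leb)%E.-integrable A (EFin \o g).
  by move=> mA AO; exact: integrableS gi.
have subD a b : 0 <= a -> b <= 1 -> (`]a, b[%classic `<=` D).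
  move=> a0 b1 x /=; rewrite !in_itv/= => /andP[ax xb].
  by rewrite /D /= in_itv/= (le_lt_trans a0 ax) (lt_le_trans xb b1).
have st1 (A : set (measurableTypeR R)) a b : measurable A -> 0 <= a -> a < b -> b <= 1 ->
    \int[leb2]_(x in (D `&` A) `*` `]a, b[) g x = 0.
  move=> mA a0 ab b1; have mB : measurable (`]a, b[%classic : set (measurableTypeR R)) by exact: measurable_itv.
  have iX (B' : set (measurableTypeR R)) : measurable B' -> B' `<=` D ->
      (leb \x leb)%E.-integrable (B' `*` `]a, b[%classic) (EFin \o g).
    move=> mB' sB'; apply: giS; first exact: measurableX.
    by move=> -[x y] [/= /sB' ? /(subD _ _ a0 b1) ?]; split.
  have mDA : measurable (D `&` A) by exact: measurableI.
  have e1 := @Rintegral_prod1 _ _ _ _ R leb leb _ _ g mDA mB (iX _ mDA (@subIsetl _ _ _)).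
  apply: (eq_trans e1).
  have [] := @ae_eq0_itv 1 (fun x => \int[leb]_(y in `]a, b[) g (x, y)).
  - exact: (@integrable_Rintegral1 _ _ _ _ R leb leb _ _ g mD mB (iX _ mD (@subset_refl _ _))).
  - move=> c d c0 cd d1; have mC : measurable (`]c, d[%classic : set (measurableTypeR R)) by exact: measurable_itv.
    have := @Rintegral_prod1 _ _ _ _ R leb leb _ _ g mC mB (iX _ mC (subD _ _ c0 d1)).
    by move=> <-; exact: g0.
  by move=> h _; exact: h.
have st2 (A B : set (measurableTypeR R)) : measurable A -> measurable B ->
    \int[leb2]_(x in (D `&` A) `*` (D `&` B)) g x = 0.
  move=> mA mB; have mDA : measurable (D `&` A) by exact: measurableI.
  have mDB : measurable (D `&` B) by exact: measurableI.
  have iX (B' : set (measurableTypeR R)) : measurable B' -> B' `<=` D ->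
      (leb \x leb)%E.-integrable ((D `&` A) `*` B') (EFin \o g).
    move=> mB' sB'; apply: giS; first exact: measurableX.
    by move=> -[x y] [/= [? _] /sB' ?]; split.
  have e2 := @Rintegral_prod2 _ _ _ _ R leb leb _ _ g mDA mDB (iX _ mDB (@subIsetl _ _ _)).
  apply: (eq_trans e2).
  have [] := @ae_eq0_itv 1 (fun y => \int[leb]_(x in D `&` A) g (x, y)).
  - exact: (@integrable_Rintegral2 _ _ _ _ R leb leb _ _ g mDA mD (iX _ mD (@subset_refl _ _))).
  - move=> c d c0 cd d1; have mC : measurable (`]c, d[%classic : set (measurableTypeR R)) by exact: measurable_itv.
    have := @Rintegral_prod2 _ _ _ _ R leb leb _ _ g mDA mC (iX _ mC (subD _ _ c0 d1)).
    by move=> <-; exact: st1.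
  by move=> h _; exact: h.
have E (A : set R2) : \int[leb2]_(x in A) (g \_ Omega) x = \int[leb2]_(x in Omega `&` A) g x.
  by rewrite setIC Rintegral_mkcondr.
have EX (A B : set (measurableTypeR R)) : Omega `&` A `*` B = (D `&` A) `*` (D `&` B).
  by apply/seteqP; split => -[x y] /= [[? ?] [? ?]].
have [|||||_ h2] := @Rintegral_generator_eq0 _ _ R leb2
   [set A `*` B | A in (measurable : set (set (measurableTypeR R))) &
                  B in (measurable : set (set (measurableTypeR R)))] (g \_ Omega).
- exact: measurable_prod_measurableType.
- move=> _ _ [A mA [B mB <-]] [A' mA' [B' mB' <-]].
  exists (A `&` A'); first exact: measurableI.
  by exists (B `&` B'); [exact: measurableI|rewrite setXI].
- by rewrite -restrict_EFin; apply/(integrable_mkcond _ mO).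
- by rewrite E -setXTT EX; exact: st2.
- by move=> _ [A mA [B mB <-]]; rewrite E EX; exact: st2.
by refine (ae_imp h2 _) => x; rewrite patchE => + Ox; rewrite mem_set.
Qed.

End vanishing_on_boxes.

(** * Injectivity of the sine transform on an interval *)

Section inversion.
Context {R : realType}.
Local Notation R2 := (measurableTypeR R * measurableTypeR R)%type.
Local Notation leb := (@lebesgue_measure R).
Implicit Types (e a b L : R).

Lemma ae_neq_point (c : R) : {ae leb, forall x, x != c}.
Proof.
exists [set c]; split; [exact: measurable_set1|exact: lebesgue_measure_set1|].
by move=> x /= /negP; rewrite negbK => /eqP.
Qed.

(** Abel summation of the sine transform shows that [psi] integrates to zero against the difference
    of the Poisson kernels at [x] and at its mirror image [- x]. Averaging over [x] in an interval
    and letting the damping disappear leaves [pi] times the integral of [psi] over that interval. *)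
Lemma sine_transform_inj L (psi : R -> R) : leb.-integrable `]0, L[ (EFin \o psi) ->
  (forall s, \int[leb]_(t in `]0, L[) (psi t * sin (s * t)) = 0) ->
  {ae leb, forall t, `]0, L[%classic t -> psi t = 0}.
Proof.
move=> pi0 S0; pose D : set (measurableTypeR R) := `]0, L[%classic.
have mD : measurable D by exact: measurable_itv.
have msin (x : R) : measurable_fun setT (fun s : measurableTypeR R => sin (s * x)).
  apply: continuous_measurable_fun => s; apply: continuous_comp; last exact: continuous_sin.
  by apply: cvgMl; exact: cvg_id.
apply: (ae_eq0_itv pi0 _).2 => a b a0 ab bL.
pose e n : R := n.+1%:R^-1.
have e0 n : 0 < e n by rewrite invr_gt0.
(* The product [sin (s t) sin (s x)] is half the difference of the cosines of [s (t - x)] and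
   [s (t + x)]; after the exchange of integrals the inner one is the vanishing transform. *)
have key n x : \int[leb]_(t in D) (psi t * (2^-1 * (poisson (e n) (t - x) - poisson (e n) (t + x)))) = 0.
  transitivity (\int[leb]_(t in D) (psi t * \int[leb]_s (damping (e n) s * (sin (s * t) * sin (s * x))))).
    apply: eq_Rintegral => t _; congr (_ * _).
    have i y := integrable_damped y (e0 n) (@continuous_cos R) (@cos_max R).
    rewrite -!Rintegral_damped_cos// -RintegralB// -RintegralZl//; last first.
      by have := integrableB measurableT (i (t - x)) (i (t + x)); apply: eq_integrable.
    apply: eq_Rintegral => s _.
    have -> : (t - x) * s = s * t - s * x by ring.
    have -> : (t + x) * s = s * t + s * x by ring.
    by rewrite cosB cosD; field.
  have := @Rintegral_swap _ _ _ _ R leb leb D setT psi (damping (e n)) mD measurableT pi0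
    (damping_integrable (e0 n)) (fun z => sin (z.2 * z.1) * sin (z.2 * x)) 1.
  move=> /= ->.
  - rewrite (_ : (fun s => _) = (fun=> 0)); first by rewrite Rintegral_cst// mul0r.
    apply/funext => s; rewrite (_ : \int[leb]_(t in D) _ =
      \int[leb]_(t in D) (sin (s * x) * (psi t * sin (s * t)))); last first.
      by apply: eq_Rintegral => t _; ring.
    rewrite RintegralZl ?S0 ?mulr0//.
    apply: (@integrable_mul_bounded _ _ _ leb D psi _ 1) => //; last by move=> t _; exact: sin_max.
    apply: measurable_funTS; apply: continuous_measurable_fun => t.
    by apply: continuous_comp; [apply: cvgMr; exact: cvg_id|exact: continuous_sin].
  - apply: measurable_funM.
      apply: measurable_funTS; apply: (measurableT_comp (continuous_measurable_fun (@continuous_sin R))).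
      exact: measurable_funM measurable_snd measurable_fst.
    exact: measurable_funTS (measurableT_comp (msin x) measurable_snd).
  - by move=> z _; rewrite normrM -[leRHS]mulr1 ler_pM// sin_max.
pose B : set (measurableTypeR R) := `]a, b[%classic.
have mB : measurable B by exact: measurable_itv.
have iB : leb.-integrable B (EFin \o cst (1 : R)).
  have ic : leb.-integrable `[a, b] (EFin \o cst (1 : R)).
    apply: continuous_compact_integrable; first exact: segment_compact.
    by apply: continuous_subspaceT => x; exact: cvg_cst.
  by apply: integrableS ic => //; exact: subset_itv_oo_cc.
have z n : \int[leb]_(t in D) (psi t * (2^-1 *
    (poisson_mass (e n) a b t - poisson_mass (e n) a b (- t)))) = 0.
  have mP (h : R2 -> R) : measurable_fun setT h -> measurable_fun setT (fun z => poisson (e n) (h z)).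
    by move=> mh; apply: (measurableT_comp _ mh); apply: continuous_measurable_fun; exact: continuous_poisson.
  have iP (h : R -> R) : continuous h -> leb.-integrable B (EFin \o (fun x => poisson (e n) (h x))).
    move=> ch; have ic : leb.-integrable `[a, b] (EFin \o (fun x => poisson (e n) (h x))).
      apply: continuous_compact_integrable; first exact: segment_compact.
      apply: continuous_subspaceT => x.
      by apply: (@continuous_comp _ _ _ h (poisson (e n))); [exact: ch|exact: continuous_poisson].
    by apply: integrableS ic => //; exact: subset_itv_oo_cc.
  have := @Rintegral_swap _ _ _ _ R leb leb B D (cst 1) psi mB mD iB pi0
    (fun z => 2^-1 * (poisson (e n) (z.2 - z.1) - poisson (e n) (z.2 + z.1))) (2 / e n + 2 / e n).
  rewrite (_ : \int[leb]_(x in B) _ = 0); last first.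
    rewrite (_ : \int[leb]_(x in B) _ = \int[leb]_(x in B) 0); first by rewrite Rintegral_cst// mul0r.
    by apply: eq_Rintegral => x _; rewrite /= key mulr0.
  move=> -> //.
  - apply: eq_Rintegral => t _; congr (_ * _); rewrite -!Rintegral_poisson// -RintegralB//; last 2 first.
    + by apply: iP => x; apply: cvgB; [exact: cvg_cst|exact: cvg_id].
    + by apply: iP => x; apply: cvgB; [exact: cvg_cst|exact: cvg_id].
    rewrite -RintegralZl//.
      apply: eq_Rintegral => x _; rewrite mul1r /= -(poissonN _ (- t - x)).
      by congr (_ * (_ - poisson _ _)); ring.
    have h1 : leb.-integrable B (EFin \o (fun x => poisson (e n) (t - x))).
      by apply: iP => x; apply: cvgB; [exact: cvg_cst|exact: cvg_id].
    have h2 : leb.-integrable B (EFin \o (fun x => poisson (e n) (- t - x))).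
      by apply: iP => x; apply: cvgB; [exact: cvg_cst|exact: cvg_id].
    by have := integrableB mB h1 h2; apply: eq_integrable.
  - apply: measurable_funTS; apply: measurable_funM; first exact: measurable_cst.
    apply: measurable_funB; apply: mP.
      exact: measurable_funB measurable_snd measurable_fst.
    exact: measurable_funD measurable_snd measurable_fst.
  - move=> x _; rewrite normrM ger0_norm ?invr_ge0// ler_pdivrMl//.
    rewrite (le_trans (ler_normB _ _))// (le_trans (lerD (poisson_bound _ (e0 n)) (poisson_bound _ (e0 n))))//.
    by have := divr_ge0 (ler0n R 2) (ltW (e0 n)) => h; lra.
have L1 : \int[leb]_(t in D) (psi t * (2^-1 *
    (poisson_mass (e n) a b t - poisson_mass (e n) a b (- t)))) @[n --> \oo] -->
   \int[leb]_(t in D) (psi t * (pi * \1_B t)).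
  have mpsi : measurable_fun D psi by apply/measurable_EFinP; exact: measurable_int pi0.
  apply: (@Rintegral_dominated_cvg _ _ _ leb D _ _ (fun t => (2 * pi) * `|psi t|)) => //.
  - move=> n; apply: measurable_funM => //; apply: measurable_funM; first exact: measurable_cst.
    by apply: measurable_funB; [exact: measurable_poisson_mass|exact: measurable_funTS (continuous_measurable_fun (@continuous_poisson_massN R (e n) a b))].
  - apply: measurable_funM => //; apply: measurable_funM; first exact: measurable_cst.
    exact: measurable_indic.
  - refine (ae_imp (ae_and (ae_neq_point a) (ae_neq_point b)) _) => t [ta tb]; rewrite /D /= in_itv/= => /andP[t0 tL].
    (* [- t] is to the left of the interval, so the mirror-image mass tends to zero. *)
    have Nta : - t < a by rewrite (lt_le_trans _ a0)// oppr_lt0.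
    have c1 := cvg_poisson_mass ab ta tb.
    have c2 := cvg_poisson_mass ab (negbT (lt_eqF Nta)) (negbT (lt_eqF (lt_trans Nta ab))).
    have i0 : \1_(`]a, b[%classic : set R) (- t) = 0 :> R.
      by rewrite indicE memNset//= in_itv/= ltNge (ltW Nta).
    rewrite i0 mulr0 in c2.
    have -> : (pi * \1_B t : R) = 2^-1 * (2 * pi * \1_(`]a, b[%classic : set R) t - 0).
      by rewrite subr0 /B; field.
    by apply: cvgMr; apply: cvgMr; exact: cvgB.
  - have := integrableZl mD (2 * pi) (integrable_norm pi0).
    by apply: eq_integrable.
  - move=> n t _; rewrite normrM mulrC ler_wpM2r// normrM ger0_norm ?invr_ge0// ler_pdivrMl//.
    rewrite (le_trans (ler_normB _ _))//.
    have := (poisson_mass_bound (e n) a b t, poisson_mass_bound (e n) a b (- t)).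
    by case=> h1 h2; rewrite (le_trans (lerD h1 h2))//; lra.
have L2 : \int[leb]_(t in D) (psi t * (2^-1 *
    (poisson_mass (e n) a b t - poisson_mass (e n) a b (- t)))) @[n --> \oo] --> 0.
  by under eq_fun do rewrite z; exact: cvg_cst.
have /eqP : \int[leb]_(t in D) (psi t * (pi * \1_B t)) = 0 by exact: (cvg_unique (@Rhausdorff R) L1 L2).
rewrite (_ : \int[leb]_(t in D) _ = pi * \int[leb]_(t in B) psi t).
  by rewrite mulf_eq0 gt_eqF ?pi_gt0//= => /eqP.
have BD : B `<=` D.
  by move=> x; rewrite /B /D /= !in_itv/= => /andP[h1 h2]; rewrite (le_lt_trans a0 h1) (lt_le_trans h2 bL).
have -> : \int[leb]_(t in B) psi t = \int[leb]_(t in D) (psi t * \1_B t).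
  rewrite -[in LHS](setIidr BD) Rintegral_mkcondr; apply: eq_Rintegral => t _.
  by rewrite patchE indicE; case: (t \in B); rewrite ?mulr1 ?mulr0.
rewrite -RintegralZl//; first by apply: eq_Rintegral => t _; rewrite mulrCA.
apply: (@integrable_mul_bounded _ _ _ leb D psi _ 1) => //.
by move=> t _; rewrite indicE ger0_norm// lern1 leq_b1.
Qed.

End inversion.

Section plane_measure.
Context {R : realType}.
Local Notation R2 := (measurableTypeR R * measurableTypeR R)%type.

(* A copy of [leb2] that carries its sigma-finiteness. *)
Definition plane_lebesgue : set R2 -> \bar R := leb2.

HB.instance Definition _ := isMeasure.Build _ _ _ plane_lebesgue (measure0 leb2)
  (measure_ge0 leb2) (@measure_semi_sigma_additive _ _ _ leb2).

Let plane_sigma_finite : sigma_finite setT plane_lebesgue.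
Proof.
pose I n : set (measurableTypeR R) := `]- (n%:R : R), n%:R[%classic.
have mI n : measurable (I n) by exact: measurable_itv.
exists (fun n => I n `*` I n).
  apply/esym; rewrite -subTset => -[x y] _.
  pose n := (Num.truncn (`|x| + `|y|)).+1.
  have h : `|x| + `|y| < n%:R by rewrite truncnS_gt.
  exists n => //; split; rewrite /I /= in_itv/= -ltr_norml.
    by apply: le_lt_trans h; rewrite lerDl.
  by apply: le_lt_trans h; rewrite lerDr.
move=> n; split; first exact: measurableX.
rewrite /plane_lebesgue leb2X//.
have -> : leb1 (I n) = lebesgue_measure `]- (n%:R : R), n%:R[%classic by [].
rewrite lebesgue_measure_itv/=.
by case: ifP => _; rewrite ?mul0e ?ltry// -EFinB -EFinM ltry.
Qed.

HB.instance Definition _ := Measure_isSigmaFinite.Build _ _ _ plane_lebesgue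
  plane_sigma_finite.

End plane_measure.

(** * Inversion of the cosine transform in the plane *)

Section plane_inversion.
Context {R : realType}.
Local Notation R2 := (measurableTypeR R * measurableTypeR R)%type.
Local Notation leb := (@lebesgue_measure R).
Local Notation box a1 b1 a2 b2 := (`]a1, b1[%classic `*` `]a2, b2[%classic : set R2).
Implicit Types (e : R).

Let P : {sigma_finite_measure set R2 -> \bar R} := plane_lebesgue.

Lemma plane_tensor (A B : set (measurableTypeR R)) (f g : R -> R) :
  measurable A -> measurable B ->
  leb.-integrable A (EFin \o f) -> leb.-integrable B (EFin \o g) ->
  leb2.-integrable (A `*` B) (EFin \o (fun z => f z.1 * g z.2)) /\
  \int[leb2]_(z in A `*` B) (f z.1 * g z.2) =
    (\int[leb]_(x in A) f x) * (\int[leb]_(y in B) g y).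
Proof. by move=> mA mB fi gi; split; [exact: integrable_tensor|exact: Rintegral_tensor]. Qed.

Section plane_pairs.
Variables (A B : set R2) (f g : R2 -> R).
Hypotheses (mA : measurable A) (mB : measurable B)
  (fi : leb2.-integrable A (EFin \o f)) (gi : leb2.-integrable B (EFin \o g)).
Variables (k : R2 * R2 -> R) (M : R).
Hypotheses (mk : measurable_fun (A `*` B) k)
  (kM : forall z, (A `*` B) z -> `|k z| <= M).

Lemma plane_swap :
  \int[leb2]_(x in A) (f x * \int[leb2]_(y in B) (g y * k (x, y))) =
  \int[leb2]_(y in B) (g y * \int[leb2]_(x in A) (f x * k (x, y))).
Proof. exact: (@Rintegral_swap _ _ _ _ R P P A B f g mA mB fi gi k M mk kM). Qed.

Lemma plane_kernel_integrable1 :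
  leb2.-integrable A (EFin \o (fun x => \int[leb2]_(y in B) (f x * g y * k (x, y)))).
Proof.
have h := @integrable_product_kernel _ _ _ _ R P P A B f g mA mB fi gi k M mk kM.
exact: (@integrable_Rintegral1 _ _ _ _ R P P A B _ mA mB h).
Qed.

Lemma plane_kernel_integrable2 :
  leb2.-integrable B (EFin \o (fun y => \int[leb2]_(x in A) (f x * g y * k (x, y)))).
Proof.
have h := @integrable_product_kernel _ _ _ _ R P P A B f g mA mB fi gi k M mk kM.
exact: (@integrable_Rintegral2 _ _ _ _ R P P A B _ mA mB h).
Qed.

End plane_pairs.

Lemma measurable_pdot : measurable_fun [set: R2 * R2] (fun z => pdot z.1 z.2 : R).
Proof.
apply: measurable_funD; apply: measurable_funM.
- exact: measurableT_comp measurable_fst measurable_fst.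
- exact: measurableT_comp measurable_fst measurable_snd.
- exact: measurableT_comp measurable_snd measurable_fst.
- exact: measurableT_comp measurable_snd measurable_snd.
Qed.

Lemma pdotC (x y : R * R) : pdot x y = pdot y x.
Proof. by rewrite /pdot mulrC [x.2 * _]mulrC. Qed.

Lemma measurable_cos_pdot2 : measurable_fun [set: R2 * R2] (fun z => cos (pdot z.1 z.2) : R).
Proof.
exact: measurableT_comp (continuous_measurable_fun (@continuous_cos R)) measurable_pdot.
Qed.

(** The damping is a tensor product, so the planar kernel factors into one-dimensional ones. The
    product of sines in the addition formula is odd in each variable and contributes nothing. *)
Lemma Rintegral_damped_plane e (y : R * R) : 0 < e ->
  leb2.-integrable setT (EFin \o (fun a : R2 => damping e a.1 * damping e a.2)) /\
  \int[leb2]_a (damping e a.1 * damping e a.2 * cos (pdot y a)) =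
    poisson e y.1 * poisson e y.2.
Proof.
move=> e0; have id := damping_integrable e0.
have iD := (plane_tensor measurableT measurableT id id).1.
rewrite setXTT in iD.
split; first exact: iD.
have ic z := integrable_damped z e0 (@continuous_cos R) (@cos_max R).
have is_ z := integrable_damped z e0 (@continuous_sin R) (@sin_max R).
have [I1 T1] := plane_tensor measurableT measurableT (ic y.1) (ic y.2).
have [I2 T2] := plane_tensor measurableT measurableT (is_ y.1) (is_ y.2).
rewrite setXTT in T1 T2 I1 I2.
rewrite (Rintegral_damped_cos _ e0) (Rintegral_damped_cos _ e0) in T1.
rewrite (Rintegral_damped_sin _ e0) mul0r in T2.
rewrite -[RHS]subr0 -T1 -T2 -RintegralB; [|exact: measurableT|exact: I1|exact: I2].
apply: eq_Rintegral => a _; rewrite /pdot cosD; ring.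
Qed.

Definition cos_transform (C : R * R -> R) (xi : R * R) : R :=
  \int[leb2]_a (C a * cos (pdot xi a)).

Section inversion_on_a_box.
Variables (f : R * R -> R) (a1 b1 a2 b2 : R).
Hypotheses (fi : leb2.-integrable (Omega : set R2) (EFin \o f))
  (Ci : leb2.-integrable [set: R2] (EFin \o cos_coef f))
  (a10 : 0 <= a1) (ab1 : a1 < b1) (b11 : b1 <= 1)
  (a20 : 0 <= a2) (ab2 : a2 < b2) (b21 : b2 <= 1).
Let Q : set R2 := box a1 b1 a2 b2.

Let mQ : measurable Q.
Proof. by apply: measurableX; exact: measurable_itv. Qed.

Let QO : Q `<=` Omega.
Proof.
move=> [x y] [/=]; rewrite !in_itv/= => /andP[x1 x2] /andP[y1 y2].
by split; rewrite /= in_itv/=; apply/andP; split;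
  [exact: le_lt_trans x1|exact: lt_le_trans b11|exact: le_lt_trans y1|exact: lt_le_trans b21].
Qed.

Let iO : leb2.-integrable (Omega : set R2) (EFin \o cst (1 : R)).
Proof.
have h : leb2.-integrable (Omega : set R2) (EFin \o trig (0, 0) 1 0).
  exact: cont_Omega_integrable (@trig_continuous R (0, 0) 1 0).
apply: eq_integrable h => //; first exact: measurable_Omega.
by move=> x _; rewrite /= trig10 /pdot !mul0r addr0 cos0.
Qed.

Let iQ : leb2.-integrable Q (EFin \o cst (1 : R)).
Proof. by apply: integrableS iO => //; exact: measurable_Omega. Qed.

Let W e (a : R2) := damping e a.1 * damping e a.2.

Let W1 e a : 0 < e -> `|W e a| <= 1.
Proof. by move=> e0; rewrite normrM -[leRHS]mulr1 ler_pM// damping_le1. Qed.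

Let mW e : measurable_fun setT (W e).
Proof.
apply: measurable_funM.
  exact: (measurableT_comp (continuous_measurable_fun (@continuous_damping R e)) measurable_fst).
exact: (measurableT_comp (continuous_measurable_fun (@continuous_damping R e)) measurable_snd).
Qed.

Let kQ (a : R2) : R := \int[leb2]_(xi in Q) cos (pdot xi a).

Let swapC (w : R2 -> R) M : measurable_fun setT w -> (forall a, `|w a| <= M) ->
  \int[leb2]_(xi in Q) \int[leb2]_a (cos_coef f a * (w a * cos (pdot xi a))) =
  \int[leb2]_a (cos_coef f a * (w a * kQ a)).
Proof.
move=> mw wM.
have := @plane_swap Q setT (cst 1) (cos_coef f) mQ measurableT iQ Ci
  (fun z => w z.2 * cos (pdot z.1 z.2)) M.
move=> h; transitivity (\int[leb2]_(x in Q) (1 * \int[leb2]_a (cos_coef f a * (w a * cos (pdot x a))))).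
  by apply: eq_Rintegral => x _; rewrite mul1r.
rewrite h.
- apply: eq_Rintegral => a _; congr (_ * _); rewrite /kQ -RintegralZl; [|exact: mQ|].
    by apply: eq_Rintegral => xi _; rewrite mul1r.
  have := integrable_mul_bounded mQ iQ (measurable_funTS (measurable_cos_pdot a)) (fun x _ => cos_max (pdot a x)).
  by apply: eq_integrable => // x _; rewrite /= mul1r pdotC.
- apply: measurable_funTS; apply: measurable_funM; last exact: measurable_cos_pdot2.
  exact: measurableT_comp mw measurable_snd.
- by move=> z _; rewrite normrM -[leRHS]mulr1 ler_pM ?cos_max.
Qed.

Let half_sum_le (p q r s c : R) : `|p| <= c -> `|q| <= c -> `|r| <= c -> `|s| <= c ->
  `|2^-1 * (p * q + r * s)| <= c * c.
Proof.
move=> pc qc rc sc; rewrite normrM ger0_norm ?invr_ge0// ler_pdivrMl// mulr_natl mulr2n.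
by rewrite (le_trans (ler_normD _ _))// !normrM lerD// ler_pM.
Qed.

Let kernel e (x xi : R2) : R := 2^-1 *
  (poisson e (x.1 - xi.1) * poisson e (x.2 - xi.2) + poisson e (x.1 + xi.1) * poisson e (x.2 + xi.2)).

(** [cos (a . x) cos (xi . a)] is half the sum of the cosines of [a . (x - xi)] and [a . (x + xi)].
    Integrating over [a] yields the Poisson kernels centred at [xi] and at its mirror image
    [- xi]. *)
Let smoothing e xi : 0 < e ->
  \int[leb2]_a (cos_coef f a * (W e a * cos (pdot xi a))) = \int[leb2]_(x in Omega) (f x * kernel e x xi).
Proof.
move=> e0; have iW := (Rintegral_damped_plane (0, 0) e0).1.
have := @plane_swap setT Omega (W e) f measurableT (@measurable_Omega R) iW fi
  (fun z => cos (pdot z.1 z.2) * cos (pdot xi z.1)) 1.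
move=> h; transitivity (\int[leb2]_a (W e a * \int[leb2]_(x in Omega) (f x * (cos (pdot a x) * cos (pdot xi a))))).
  apply: eq_Rintegral => a _; rewrite mulrCA; congr (_ * _).
  rewrite /cos_coef mulrC -RintegralZl; [|exact: measurable_Omega|exact: integrable_bounded_cos].
  by apply: eq_Rintegral => x _; ring.
rewrite h.
- apply: eq_Rintegral => x _; congr (_ * _).
  have [_ e1] := Rintegral_damped_plane (x.1 - xi.1, x.2 - xi.2) e0.
  have [_ e2] := Rintegral_damped_plane (x.1 + xi.1, x.2 + xi.2) e0.
  have h3 y : leb2.-integrable setT (EFin \o (fun a => W e a * cos (pdot y a))).
    apply: (@integrable_mul_bounded _ _ _ leb2 setT (W e) _ 1 measurableT iW); last by move=> a _; exact: cos_max.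
    exact: measurable_cos_pdot.
  rewrite /kernel -e1 -e2 -RintegralD; [|exact: measurableT|exact: h3|exact: h3].
  rewrite -RintegralZl; [|exact: measurableT|].
    apply: eq_Rintegral => a _.
    have -> : pdot (x.1 - xi.1, x.2 - xi.2) a = pdot a x - pdot xi a by rewrite /pdot/=; ring.
    have -> : pdot (x.1 + xi.1, x.2 + xi.2) a = pdot a x + pdot xi a by rewrite /pdot/=; ring.
    by rewrite cosB cosD /W; field.
  have := integrableD measurableT (h3 (x.1 - xi.1, x.2 - xi.2)) (h3 (x.1 + xi.1, x.2 + xi.2)).
  by apply: (eq_integrable measurableT).
- apply: measurable_funTS; apply: measurable_funM; first exact: measurable_cos_pdot2.
  exact: measurableT_comp (measurable_cos_pdot xi) measurable_fst.
- by move=> z _; rewrite normrM -[leRHS]mulr1 ler_pM ?cos_max.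
Qed.

Let mass e (x : R2) : R := 2^-1 *
  (poisson_mass e a1 b1 x.1 * poisson_mass e a2 b2 x.2 +
   poisson_mass e a1 b1 (- x.1) * poisson_mass e a2 b2 (- x.2)).

Let Rintegral_kernel e : 0 < e ->
  \int[leb2]_(xi in Q) \int[leb2]_(x in Omega) (f x * kernel e x xi) =
  \int[leb2]_(x in Omega) (f x * mass e x).
Proof.
move=> e0.
have mP (h : R2 * R2 -> R) : measurable_fun setT h -> measurable_fun setT (fun z => poisson e (h z)).
  by move=> mh; apply: (measurableT_comp _ mh); apply: continuous_measurable_fun; exact: continuous_poisson.
have m11 : measurable_fun [set: R2 * R2] (fun z => z.1.1) by exact: measurableT_comp measurable_fst measurable_fst.
have m12 : measurable_fun [set: R2 * R2] (fun z => z.1.2) by exact: measurableT_comp measurable_snd measurable_fst.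
have m21 : measurable_fun [set: R2 * R2] (fun z => z.2.1) by exact: measurableT_comp measurable_fst measurable_snd.
have m22 : measurable_fun [set: R2 * R2] (fun z => z.2.2) by exact: measurableT_comp measurable_snd measurable_snd.
have := @plane_swap Q Omega (cst 1) f mQ (@measurable_Omega R) iQ fi
  (fun z => kernel e z.2 z.1) ((2 / e) * (2 / e)).
move=> h; transitivity (\int[leb2]_(xi in Q) (1 * \int[leb2]_(x in Omega) (f x * kernel e x xi))).
  by apply: eq_Rintegral => x _; rewrite mul1r.
rewrite h.
- apply: eq_Rintegral => x _; congr (_ * _).
  have iP c a b : leb.-integrable `]a, b[ (EFin \o (fun z => poisson e (c - z))).
    have ic : leb.-integrable `[a, b] (EFin \o (fun z => poisson e (c - z))).
      apply: continuous_compact_integrable; first exact: segment_compact.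
      apply: continuous_subspaceT => z.
      apply: (@continuous_comp _ _ _ (fun z => c - z) (poisson e)); last exact: continuous_poisson.
      by apply: cvgB; [exact: cvg_cst|exact: cvg_id].
    by apply: integrableS ic; [exact: measurable_itv|exact: measurable_itv|exact: subset_itv_oo_cc].
  have mi a b : measurable (`]a, b[%classic : set (measurableTypeR R)) by exact: measurable_itv.
  have T c d := (plane_tensor (mi a1 b1) (mi a2 b2) (iP c a1 b1) (iP d a2 b2)).2.
  have I c d := (plane_tensor (mi a1 b1) (mi a2 b2) (iP c a1 b1) (iP d a2 b2)).1.
  have T1 := T x.1 x.2; have T2 := T (- x.1) (- x.2).
  rewrite (Rintegral_poisson _ e0 ab1) (Rintegral_poisson _ e0 ab2) in T1.
  rewrite (Rintegral_poisson _ e0 ab1) (Rintegral_poisson _ e0 ab2) in T2.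
  rewrite /mass -T1 -T2 -RintegralD; [|exact: mQ|exact: I|exact: I].
  rewrite -RintegralZl; [|exact: mQ|].
    apply: eq_Rintegral => xi _; rewrite mul1r /kernel -(poissonN e (- x.1 - _)) -(poissonN e (- x.2 - _)).
    by rewrite !opprB !opprK [_ + x.1]addrC [_ + x.2]addrC.
  have := integrableD mQ (I x.1 x.2) (I (- x.1) (- x.2)).
  by apply: (eq_integrable mQ).
- apply: measurable_funTS; apply: measurable_funM; first exact: measurable_cst.
  apply: measurable_funD; apply: measurable_funM; apply: mP.
  + exact: measurable_funB m21 m11.
  + exact: measurable_funB m22 m12.
  + exact: measurable_funD m21 m11.
  + exact: measurable_funD m22 m12.
- by move=> z _; apply: half_sum_le; exact: poisson_bound.
Qed.

(** Integration over the box turns the kernels into bounded masses, so both sides of the damped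
    identity converge for a merely integrable [f], without Lebesgue points. On the side of the
    coefficients, their integrability lets the damping tend to [1]. *)
Lemma cos_inversion_box :
  \int[leb2]_(xi in Q) (f xi - (2 * pi ^+ 2)^-1 * cos_transform (cos_coef f) xi) = 0.
Proof.
pose e n : R := n.+1%:R^-1.
have e0 n : 0 < e n by rewrite invr_gt0.
have mO := measurable_Omega (R := R).
have mC : measurable_fun setT (cos_coef f) by apply/measurable_EFinP; exact: measurable_int Ci.
have mf : measurable_fun (Omega : set R2) f by apply/measurable_EFinP; exact: measurable_int fi.
(* Fubini gives measurability of the integrable function [W 1 a * kQ a]; dividing by the positive
   [W 1] recovers [kQ]. *)
have mkQ : measurable_fun setT kQ.
  have := @plane_kernel_integrable2 Q setT (cst 1) (W 1) mQ measurableT iQ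
    (Rintegral_damped_plane (0, 0) ltr01).1 (fun z => cos (pdot z.1 z.2)) 1
    (measurable_funTS measurable_cos_pdot2) (fun z _ => cos_max _).
  move=> /measurable_int /measurable_EFinP h2.
  have Wn0 a : W 1 a != 0 by rewrite mulf_neq0// /damping gt_eqF// expR_gt0.
  have mWV : measurable_fun setT (fun a : R2 => (W 1 a)^-1).
    have dV s : (damping 1 s)^-1 = expR (`|s| : R) by rewrite /damping mul1r expRN invrK.
    have mn : measurable_fun setT (fun s : measurableTypeR R => expR (`|s| : R)).
      apply: continuous_measurable_fun => s; apply: continuous_comp; last exact: continuous_expR.
      exact: norm_continuous.
    rewrite (_ : (fun a => _) = (fun a : R2 => expR `|a.1| * expR `|a.2|)).
      by apply: measurable_funM; [exact: (measurableT_comp mn measurable_fst)|exact: (measurableT_comp mn measurable_snd)].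
    by apply/funext => a; rewrite /W invfM !dV.
  have := measurable_funM mWV h2; apply: eq_measurable_fun => a _ /=.
  transitivity ((W 1 a)^-1 * (W 1 a * kQ a)); last by rewrite mulKf.
  congr (_ * _).
  have i : leb2.-integrable Q (EFin \o (fun xi => cos (pdot xi a))).
    have := integrable_mul_bounded mQ iQ (measurable_funTS (measurable_cos_pdot a)) (fun x _ => cos_max (pdot a x)).
    by apply: eq_integrable => // x _; rewrite /= mul1r pdotC.
  rewrite /kQ -RintegralZl; [|exact: mQ|exact: i].
  by apply: eq_Rintegral => xi _; rewrite mul1r.
have kQ1 a : `|kQ a| <= \int[leb2]_(x in Q) `|(cst 1 x : R)|.
  have -> : kQ a = \int[leb2]_(x in Q) (cst 1 x * cos (pdot a x)).
    by apply: eq_Rintegral => xi _; rewrite mul1r pdotC.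
  rewrite -[leRHS]mul1r; apply: Rintegral_mul_le => //.
  - exact: measurable_funTS (measurable_cos_pdot a).
  - by move=> x _; exact: cos_max.
set K := \int[leb2]_(x in Q) `|_| in kQ1.
have chain n : \int[leb2]_a (cos_coef f a * (W (e n) a * kQ a)) = \int[leb2]_(x in Omega) (f x * mass (e n) x).
  rewrite -(@swapC (W (e n)) 1)//; last by move=> a; exact: W1.
  by rewrite -Rintegral_kernel//; apply: eq_Rintegral => xi _; exact: smoothing.
have L1 : \int[leb2]_a (cos_coef f a * (W (e n) a * kQ a)) @[n --> \oo] -->
    \int[leb2]_a (cos_coef f a * (1 * kQ a)).
  apply: (@Rintegral_dominated_cvg _ _ _ leb2 setT _ _ (fun a => K * `|cos_coef f a|)) => //.
  - by move=> n; apply: measurable_funM => //; apply: measurable_funM.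
  - by apply: measurable_funM => //; apply: measurable_funM.
  - apply: aeW => a _; apply: cvgMr; apply: cvgMl.
    have c0 s : damping (e n) s @[n --> \oo] --> (1 : R).
      rewrite -[1]expR0; apply: continuous_cvg; first exact: continuous_expR.
      rewrite -oppr0 -(mul0r `|s|); apply: cvgN; apply: cvgMl; exact: cvg_harmonic.
    by rewrite -[1](mulr1 1); apply: cvgM; exact: c0.
  - have := integrableZl measurableT K (integrable_norm Ci).
    by apply: eq_integrable.
  - move=> n a _; rewrite normrM mulrC ler_wpM2r// normrM -[leRHS]mul1r ler_pM ?W1//.
have L2 : \int[leb2]_(x in Omega) (f x * mass (e n) x) @[n --> \oo] -->
    \int[leb2]_(x in Omega) (f x * (2 * pi ^+ 2 * \1_Q x)).
  apply: (@Rintegral_dominated_cvg _ _ _ leb2 Omega _ _ (fun x => ((2 * pi) ^+ 2) * `|f x|)) => //.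
  - move=> n; apply: measurable_funM => //; apply: measurable_funTS.
    apply: measurable_funM; first exact: measurable_cst.
    apply: measurable_funD; apply: measurable_funM.
    + exact: (measurableT_comp (continuous_measurable_fun (@continuous_poisson_mass R (e n) a1 b1)) measurable_fst).
    + exact: (measurableT_comp (continuous_measurable_fun (@continuous_poisson_mass R (e n) a2 b2)) measurable_snd).
    + exact: (measurableT_comp (continuous_measurable_fun (@continuous_poisson_massN R (e n) a1 b1)) measurable_fst).
    + exact: (measurableT_comp (continuous_measurable_fun (@continuous_poisson_massN R (e n) a2 b2)) measurable_snd).
  - apply: measurable_funM => //; apply: measurable_funM; first exact: measurable_cst.
    exact: measurable_indic.
  - have null1 (c : R) : {ae leb2, forall x : R2, x.1 != c}.
      exists ([set c] `*` setT); split.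
      + by apply: measurableX => //; exact: measurable_set1.
      + rewrite leb2X//.
        by rewrite /leb1 [X in (X * _)%E]lebesgue_measure_set1 mul0e.
      + by move=> x /= /negP; rewrite negbK => /eqP.
    have null2 (c : R) : {ae leb2, forall x : R2, x.2 != c}.
      exists (setT `*` [set c]); split.
      + by apply: measurableX => //; exact: measurable_set1.
      + rewrite leb2X//.
        by rewrite /leb1 [X in (_ * X)%E]lebesgue_measure_set1 mule0.
      + by move=> x /= /negP; rewrite negbK => /eqP.
    refine (ae_imp (ae_and (ae_and (null1 a1) (null1 b1)) (ae_and (null2 a2) (null2 b2))) _).
    move=> [x y] [[/= xa xb] [ya yb]] [/=]; rewrite !in_itv/= => /andP[x0 x1] /andP[y0 y1].
    (* On [Omega] both coordinates are positive, so the reflected point misses the box and the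
       second product disappears. *)
    have neg (a b z : R) : 0 <= a -> a < b -> 0 < z -> poisson_mass (e n) a b (- z) @[n --> \oo] --> (0 : R).
      move=> a0 ab z0; have Nz : - z < a by rewrite (lt_le_trans _ a0)// oppr_lt0.
      have := cvg_poisson_mass ab (negbT (lt_eqF Nz)) (negbT (lt_eqF (lt_trans Nz ab))).
      by rewrite indicE memNset ?mulr0//= in_itv/= ltNge (ltW Nz).
    apply: cvgMr.
    have -> : 2 * pi ^+ 2 * \1_Q (x, y) = 2^-1 *
       (2 * pi * \1_(`]a1, b1[%classic : set R) x * (2 * pi * \1_(`]a2, b2[%classic : set R) y) + 0 * 0) :> R.
      rewrite /Q !indicE in_setX mulr0 addr0.
      by case: (x \in _); case: (y \in _) => /=; field.
    apply: cvgMr; apply: cvgD; apply: cvgM.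
    + exact: cvg_poisson_mass.
    + exact: cvg_poisson_mass.
    + exact: neg.
    + exact: neg.
  - have := integrableZl mO ((2 * pi) ^+ 2) (integrable_norm fi).
    by apply: eq_integrable.
  - move=> n x _; rewrite normrM mulrC ler_wpM2r// expr2.
    by apply: half_sum_le; exact: poisson_mass_bound.
have E : \int[leb2]_a (cos_coef f a * (1 * kQ a)) = \int[leb2]_(x in Omega) (f x * (2 * pi ^+ 2 * \1_Q x)).
  apply: (cvg_unique (@Rhausdorff R) L1).
  by rewrite (_ : (fun n => _) = (fun n => \int[leb2]_(x in Omega) (f x * mass (e n) x))) //; apply/funext.
rewrite -(@swapC (cst 1) 1)// in E; last by move=> a; rewrite normr1.
have p0 : 2 * pi ^+ 2 != 0 :> R by rewrite mulf_neq0// expf_neq0// gt_eqF// pi_gt0.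
have iF : leb2.-integrable Q (EFin \o f) by exact: integrableS fi.
have iC : leb2.-integrable Q (EFin \o cos_transform (cos_coef f)).
  have := @plane_kernel_integrable1 Q setT (cst 1) (cos_coef f) mQ measurableT iQ
    Ci (fun z => cos (pdot z.1 z.2)) 1
    (measurable_funTS measurable_cos_pdot2) (fun z _ => cos_max _).
  apply: eq_integrable => // xi _ /=; congr EFin; apply: eq_Rintegral => a _.
  by rewrite mul1r.
rewrite RintegralB//; last first.
  by have := integrableZl mQ (2 * pi ^+ 2)^-1 iC; apply: eq_integrable.
rewrite RintegralZl//.
have -> : \int[leb2]_(xi in Q) cos_transform (cos_coef f) xi = 2 * pi ^+ 2 * \int[leb2]_(xi in Q) f xi.
  transitivity (\int[leb2]_(xi in Q) \int[leb2]_a (cos_coef f a * (cst 1 a * cos (pdot xi a)))).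
    by apply: eq_Rintegral => xi _; apply: eq_Rintegral => a _; rewrite mul1r.
  rewrite E; have -> : \int[leb2]_(t in Q) f t = \int[leb2]_(t in Omega) (f t * \1_Q t).
    rewrite -[in LHS](setIidr QO) Rintegral_mkcondr; apply: eq_Rintegral => t _.
    by rewrite patchE indicE; case: (t \in Q); rewrite ?mulr1 ?mulr0.
  rewrite -RintegralZl//; first by apply: eq_Rintegral => t _; rewrite mulrCA.
  apply: (@integrable_mul_bounded _ _ _ leb2 Omega f _ 1) => //.
  by move=> t _; rewrite indicE ger0_norm// lern1 leq_b1.
by rewrite mulKf// subrr.
Qed.

End inversion_on_a_box.

(** The constant is twice the usual [1 / (4 pi^2)]: a cosine transform belongs to the even part of
    the zero extension, and on [Omega] this even part is [f / 2]. *)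
Lemma cos_inversion (f : R * R -> R) :
  leb2.-integrable (Omega : set R2) (EFin \o f) ->
  leb2.-integrable [set: R2] (EFin \o cos_coef f) ->
  {ae leb2, forall xi : R2, Omega xi ->
     f xi = (2 * pi ^+ 2)^-1 * cos_transform (cos_coef f) xi}.
Proof.
move=> fi Ci; have mO := measurable_Omega (R := R).
have iO : leb2.-integrable (Omega : set R2) (EFin \o cst (1 : R)).
  have h : leb2.-integrable (Omega : set R2) (EFin \o trig (0, 0) 1 0).
    exact: cont_Omega_integrable (@trig_continuous R (0, 0) 1 0).
  by apply: eq_integrable h => // x _; rewrite /= trig10 /pdot !mul0r addr0 cos0.
have iC : leb2.-integrable (Omega : set R2) (EFin \o cos_transform (cos_coef f)).
  have := @plane_kernel_integrable1 Omega setT (cst 1) (cos_coef f) mO measurableT iO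
    Ci (fun z => cos (pdot z.1 z.2)) 1
    (measurable_funTS measurable_cos_pdot2) (fun z _ => cos_max _).
  apply: eq_integrable => // xi _ /=; congr EFin; apply: eq_Rintegral => a _.
  by rewrite mul1r.
have := @ae_eq0_Omega R (fun xi => f xi - (2 * pi ^+ 2)^-1 * cos_transform (cos_coef f) xi).
move=> h; refine (ae_imp (h _ _) _).
- have := integrableB mO fi (integrableZl mO (2 * pi ^+ 2)^-1 iC).
  by apply: eq_integrable.
- by move=> a1 b1 a2 b2 *; exact: cos_inversion_box.
- by move=> xi + Ox => /(_ Ox) /eqP; rewrite subr_eq0 => /eqP.
Qed.

End plane_inversion.

(** * Zeros of the sine transforms *)

Section sine_zeros.
Context {R : realType}.
Local Notation R2 := (measurableTypeR R * measurableTypeR R)%type.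
Local Notation leb := (@lebesgue_measure R).
Variables (T : R) (psi : R -> R).
Hypotheses (T0 : 0 < T) (psii : leb.-integrable `]0, T[ (EFin \o psi)).

Let D : set (measurableTypeR R) := `]0, T[%classic.
Let mD : measurable D. Proof. exact: measurable_itv. Qed.

(** The [k]-th derivative of [sin (t s)] in [s]: each differentiation brings down a factor [t] and
    shifts the phase by a quarter period, which gives one formula for all orders. *)
Let wave (k : nat) (s t : R) : R := t ^+ k * sin (t * s + k%:R * (pi / 2)).

Definition sine_derivative (k : nat) (s : R) : R :=
  \int[leb]_(t in `]0, T[) (psi t * wave k s t).

Let mwave k s : measurable_fun D (wave k s).
Proof.
apply: measurable_funTS; apply: continuous_measurable_fun => t.
apply: cvgM; first exact: exprn_continuous.
apply: continuous_comp; last exact: continuous_sin.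
by apply: cvgD; [apply: cvgMl; exact: cvg_id|exact: cvg_cst].
Qed.

Let wave_le k s t : D t -> `|wave k s t| <= T ^+ k.
Proof.
rewrite /D /= in_itv/= => /andP[t0 tT]; rewrite normrM -[leRHS]mulr1 ler_pM ?sin_max//.
by rewrite normrX ger0_norm ?(ltW t0)// lerXn2r ?nnegrE ?(ltW t0) ?(ltW T0)// ltW.
Qed.

Let iwave k s : leb.-integrable D (EFin \o (fun t => psi t * wave k s t)).
Proof. exact: (integrable_mul_bounded mD psii (mwave k s) (wave_le k s)). Qed.

Let wave_derive k t s : is_derive s (1 : R) (fun s => psi t * wave k s t) (psi t * wave k.+1 s t).
Proof.
have da := is_derive_affine t (k%:R * (pi / 2)) s.
have ds := @is_derive1_comp _ sin _ s _ _ (is_derive_sin _) da.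
apply: is_derive_eq (is_deriveZ (psi t) (is_deriveZ (t ^+ k) ds)) _.
have E : k.+1%:R * (pi / 2) = k%:R * (pi / 2) + pi / 2 :> R by rewrite -natr1 mulrDl mul1r.
rewrite /wave E addrA sinDpihalf exprSr /GRing.scale/=.
have alg (p q c : R) : p * (q * (c * t)) = p * (q * t * c) by ring.
exact: alg.
Qed.

Lemma is_derive_sine_derivative k s :
  is_derive s (1 : R) (sine_derivative k) (sine_derivative k.+1 s).
Proof.
have dE (x y : R) : partial1of2 (fun s t => psi t * wave k s t) x y = psi y * wave k.+1 x y.
  by rewrite /partial1of2 derive1E (@derive_val _ _ _ _ _ _ _ (wave_derive k y x)).
have sI : `]s - 1, s + 1[%classic s by rewrite /= in_itv/=; apply/andP; split; lra.
(* Majorant for differentiation under the integral: times are at most [T], hence the power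
   [T^(k+1)]. *)
pose G t := `|psi t| * T ^+ k.+1.
have G0 t : 0 <= G t by rewrite mulr_ge0// exprn_ge0// ltW.
have Gi : leb.-integrable D (EFin \o G).
  have := integrableZr mD (T ^+ k.+1) (integrable_norm psii).
  by apply: eq_integrable.
have Gb x y : `]s - 1, s + 1[%classic x -> D y ->
    `|partial1of2 (fun s t => psi t * wave k s t) x y| <= G y.
  by move=> _ Dy; rewrite dE normrM ler_wpM2l//; exact: wave_le.
have := cvg_differentiation_under_integral mD sI (fun x _ => iwave k x)
  (fun x y _ _ => @ex_derive _ _ _ _ _ _ _ (wave_derive k y x)) G0 Gi Gb.
have -> : \int[leb]_(y in D) partial1of2 (fun s t => psi t * wave k s t) s y = sine_derivative k.+1 s.
  by apply: eq_Rintegral => y _; rewrite dE.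
move=> H; have {}H : (fun h : R => h^-1 *: ((sine_derivative k \o shift s) (h *: 1) - sine_derivative k s)) h @[h --> 0^']
    --> sine_derivative k.+1 s.
  by move: H; apply: cvg_trans; apply: near_eq_cvg; near=> h; rewrite /= [h *: 1]mulr1.
apply: DeriveDef; first by apply/cvg_ex; exists (sine_derivative k.+1 s).
exact: (cvg_lim (@Rhausdorff R) H).
Unshelve. all: by end_near. Qed.

Let M : R := \int[leb]_(t in D) `|psi t|.

Let sine_derivative_le k s : `|sine_derivative k s| <= T ^+ k * M.
Proof. exact: (Rintegral_mul_le mD psii (mwave k s) (wave_le k s)). Qed.

Let sine_derivative_mvt k s s0 : exists2 c, `|c - s0| <= `|s - s0| &
  sine_derivative k s - sine_derivative k s0 = sine_derivative k.+1 c * (s - s0).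
Proof.
have dd x : is_derive x (1 : R) (sine_derivative k) (sine_derivative k.+1 x) := is_derive_sine_derivative k x.
have cont a b : {within `[a, b], continuous (sine_derivative k)}.
  apply: continuous_subspaceT => x; apply: differentiable_continuous.
  by apply/derivable1_diffP; exact: (@ex_derive _ _ _ _ _ _ _ (dd x)).
have [ss|ss] := leP s s0.
- have [c] := MVT_segment ss (fun x _ => dd x) (cont _ _).
  rewrite in_itv/= => /andP[c1 c2] E; exists c.
    by rewrite !ler0_norm ?subr_le0// lerN2 lerD2r.
  by rewrite -opprB E -mulrN opprB.
- have [c] := MVT_segment (ltW ss) (fun x _ => dd x) (cont _ _).
  rewrite in_itv/= => /andP[c1 c2] E; exists c => //.
  by rewrite !ger0_norm ?subr_ge0// ?(ltW ss)// lerD2r.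
Qed.

(** An elementary form of analytic continuation. Each use of the mean value theorem raises the order
    by one and gains a factor [|s - s0| T <= 1/2], so the bound has to be proved for all orders at
    once; iterating it forces the value to be zero. *)
Let propagate s0 : (forall k, sine_derivative k s0 = 0) ->
  forall s, `|s - s0| * T <= 2^-1 -> forall k, sine_derivative k s = 0.
Proof.
move=> z0; have M0 : 0 <= M by apply: Rintegral_ge0.
have H n : forall s k, `|s - s0| * T <= 2^-1 -> `|sine_derivative k s| <= T ^+ k * M * 2^-1 ^+ n.
  elim: n => [|n IH] s k sT; first by rewrite expr0 mulr1.
  have [c cs E] := sine_derivative_mvt k s s0.
  rewrite -[sine_derivative k s]subr0 -(z0 k) E normrM.
  have cT : `|c - s0| * T <= 2^-1.
    by apply: le_trans sT; rewrite ler_wpM2r// ltW.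
  apply: (le_trans (ler_wpM2r (normr_ge0 _) (IH c k.+1 cT))).
  have alg (p q x m : R) : p * x * m * q * `|s - s0| = x * m * q * (`|s - s0| * p) by ring.
  rewrite exprS alg [2^-1 ^+ n.+1]exprSr [leRHS]mulrA.
  apply: ler_wpM2l; last exact: sT.
  apply: mulr_ge0; last by apply: exprn_ge0; rewrite invr_ge0.
  by apply: mulr_ge0 => //; apply: exprn_ge0; exact: ltW.
move=> s sT k; apply/eqP; rewrite -normr_le0 leNgt; apply/negP => p.
have c : T ^+ k * M * 2^-1 ^+ n @[n --> \oo] --> (0 : R).
  rewrite -(mulr0 (T ^+ k * M)); apply: cvgMr; apply: cvg_expr.
  by rewrite ger0_norm ?invr_ge0// invf_lt1// ltr1n.
have /cvgrPdist_lt/(_ _ p)[N _ hN] := c.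
have := hN N (leqnn N); rewrite sub0r normrN => h.
by have := le_lt_trans (le_trans (H N s k sT) (ler_norm _)) h; rewrite ltxx.
Qed.

Lemma sine_derivative_eq0 s0 : (forall k, sine_derivative k s0 = 0) ->
  forall s k, sine_derivative k s = 0.
Proof.
move=> z0; have H n : forall s, `|s - s0| * T <= n%:R * 2^-1 -> forall k, sine_derivative k s = 0.
  elim: n => [|n IH] s.
    rewrite mul0r pmulr_lle0// normr_le0 subr_eq0 => /eqP -> k; exact: z0.
  (* [s'] lies at the fraction [n / (n + 1)] of the way to [s]: it falls under the induction
     hypothesis, and what remains is within the radius of [propagate]. *)
  move=> sn; pose s' := s0 + (s - s0) * (n%:R / n.+1%:R).
  have n0 : (n.+1%:R : R) != 0 by rewrite pnatr_eq0.
  apply: (@propagate s').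
  - apply: IH; rewrite /s' addrC addKr normrM [X in _ * X * _]ger0_norm; last by rewrite divr_ge0.
    rewrite mulrAC (le_trans (ler_wpM2r _ sn)) ?divr_ge0//.
    by rewrite le_eqVlt; apply/orP; left; apply/eqP; field.
  - have -> : s - s' = (s - s0) / n.+1%:R by rewrite /s' -natr1; field; rewrite natr1.
    rewrite normrM [X in _ * X * _]ger0_norm ?invr_ge0// mulrAC ler_pdivrMr//.
    by rewrite [leRHS]mulrC.
(* The number of steps of length [1 / (2 T)] needed to reach [s]. *)
move=> s k; apply: (H (Num.truncn (`|s - s0| * T * 2)).+1).
by rewrite ler_pdivlMr// ltW// truncnS_gt.
Qed.

(** Every zero turns out to be an isolated zero of some derivative, and the isolated points of any
    set of reals are countable; the union over the orders remains countable. *)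
Lemma countable_sine_zeros :
  ~ {ae leb, forall t, `]0, T[%classic t -> psi t = 0} ->
  countable [set s | \int[leb]_(t in `]0, T[) (psi t * sin (s * t)) = 0].
Proof.
move=> npsi; have E0 s : sine_derivative 0 s = \int[leb]_(t in `]0, T[) (psi t * sin (s * t)).
  by apply: eq_Rintegral => t _; rewrite /wave expr0 mul1r mul0r addr0 mulrC [t * s]mulrC mulrC.
have nz s : exists k, sine_derivative k s != 0.
  apply: contrapT => z; apply: npsi; apply: (sine_transform_inj psii) => s'.
  rewrite -E0; apply: (@sine_derivative_eq0 s) => k; apply/eqP/negPn/negP => ks.
  by apply: z; exists k.
pose A k := isolated [set s | sine_derivative k s = 0].
apply: (@sub_countable _ _ _ (\bigcup_k A k)); last first.
  by apply: bigcup_countable => // k _; exact: countable_isolated.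
apply: subset_card_le => s /=; rewrite -E0 => s0.
(* The least order at which the derivative is nonzero. It is positive, so the derivative of the
   preceding order has a simple zero at [s]. *)
have [k ks kmin] := ex_minnP (nz s).
case: k ks kmin => [|k] ks kmin; first by rewrite s0 eqxx in ks.
have ks0 : sine_derivative k s = 0.
  by apply/eqP/negPn/negP => /kmin; rewrite ltnn.
exists k => //; split; first exact/mem_set.
have dd := is_derive_sine_derivative k s.
have c : (fun h : R => h^-1 *: ((sine_derivative k \o shift s) (h *: 1) - sine_derivative k s)) h @[h --> 0^']
    --> sine_derivative k.+1 s.
  have := @derive_val _ _ _ _ _ _ _ dd => <-.
  exact: (@ex_derive _ _ _ _ _ _ _ dd).
have l0 : 0 < `|sine_derivative k.+1 s| by rewrite normr_gt0.
(* The tolerance is the modulus of the limit itself: a second zero nearby would give a zero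
   quotient, at exactly that distance. *)
have /cvgrPdist_lt/(_ _ l0) := c.
rewrite near_withinE => /nbhs_ballP[e /= e0 he].
exists (ball s e); first exact: nbhsx_ballx.
apply/seteqP; split => x /=; last by move=> ->; split => //; exact: ballxx.
move=> [sx x0]; apply/eqP/negPn/negP => xs.
have : ball 0 e (x - s) by move: sx; rewrite /ball/= sub0r normrN distrC.
move=> /he; rewrite subr_eq0 => /(_ xs); rewrite ks0 /= [(x - s) *: 1]mulr1 subrK x0 subrr scaler0.
by rewrite subr0 ltxx.
Qed.

End sine_zeros.

(** * Circles and countable families of circles are null sets *)

Section circles.
Context {R : realType}.
Local Notation R2 := (measurableTypeR R * measurableTypeR R)%type.
Local Notation leb := (@lebesgue_measure R).

Lemma continuous_enorm : continuous (@enorm R).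
Proof.
move=> a; apply: (@continuous_comp _ _ _ (fun a : R * R => a.1 ^+ 2 + a.2 ^+ 2) Num.sqrt); last exact: sqrt_continuous.
apply: cvgD; apply: (@continuous_comp _ _ _ _ (fun x : R => x ^+ 2)); try exact: exprn_continuous.
  exact: cvg_fst.
exact: cvg_snd.
Qed.

Lemma measurable_enorm : measurable_fun [set: R2] (@enorm R).
Proof. exact: continuous_measurable_plane continuous_enorm. Qed.

(** A vertical line meets a circle in at most two points, so each section of the product measure is
    null. *)
Lemma circle_null (r : R) : {ae leb2, forall a : R2, enorm a != r}.
Proof.
pose C : set R2 := [set a | enorm a = r].
have mC : measurable C.
  rewrite (_ : C = setT `&` enorm @^-1` [set r]); last by rewrite setTI.
  by apply: measurable_enorm => //; exact: measurable_set1.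
exists C; split; [exact: mC| |by move=> a /= /negP; rewrite negbK => /eqP].
have -> : leb2 C = (\int[leb]_x leb (xsection C x))%E by [].
apply: integral0_eq => x _; apply/eqP; rewrite eq_le measure_ge0 andbT.
pose y := Num.sqrt (r ^+ 2 - x ^+ 2).
have sub : xsection C x `<=` [set y] `|` [set - y].
  move=> z; rewrite /xsection /= => /set_mem /= h.
  have : x ^+ 2 + z ^+ 2 = r ^+ 2.
    by rewrite -h /enorm/= sqr_sqrtr// addr_ge0// sqr_ge0.
  move=> {}h; have : `|z| = y by rewrite /y -h addrC addKr sqrtr_sqr.
  by move=> <-; case: (ger0P z) => _; [left|right]; rewrite /= ?opprK.
have mS c : measurable ([set c] : set (measurableTypeR R)) by exact: measurable_set1.
apply: (le_trans (le_measure leb _ _ sub)).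
- by rewrite inE; exact: measurable_xsection.
- by rewrite inE; exact: measurableU.
apply: (le_trans (measureU2 leb (mS y) (mS (- y)))).
have z0 (c : measurableTypeR R) : leb [set c] = 0%E := lebesgue_measure_set1 c.
rewrite -(adde0 0%E); apply: leeD; [move: (z0 y)|move: (z0 (- y))];
  by move=> /eqP; rewrite eq_le => /andP[h _]; exact: h.
Qed.

(** The exceptional frequencies lie on countably many circles, enumerated by an injection of [Z]
    into the integers. *)
Lemma enorm_avoids_countable (Z : set R) (c : R) : 0 < c -> countable Z ->
  {ae leb2, forall a : R2, ~ Z (c * enorm a)}.
Proof.
move=> c0 /countable_injP[f fI].
have H n : {ae leb2, forall a : R2, forall z, Z z -> f z = n -> c * enorm a != z}.
  have [[z [Zz zn]]|nz] := pselect (exists z, Z z /\ f z = n).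
    refine (ae_imp (circle_null (z / c)) _) => a az z' Zz' zn'.
    have -> : z' = z by apply: fI; rewrite ?inE// zn zn'.
    by apply: contra az => /eqP <-; rewrite mulrC mulKf// gt_eqF.
  by apply: aeW => a z Zz zn; exfalso; apply: nz; exists z.
refine (ae_imp (ae_foralln H) _) => a h Za.
by have := h _ _ Za erefl; rewrite eqxx.
Qed.

End circles.

(** * Regularization *)

Section frequency_data.
Context {R : realType}.
Local Notation R2 := (measurableTypeR R * measurableTypeR R)%type.
Local Notation leb := (@lebesgue_measure R).
Implicit Types (T c lam mu eps : R) (I J : data R) (a : R * R).

Lemma sin_lipschitz (x y : R) : `|sin x - sin y| <= `|x - y|.
Proof.
have H (u v : R) : u <= v -> `|sin v - sin u| <= `|v - u|.
  move=> uv; have [c _ ->] := MVT_segment uv (fun z _ => is_derive_sin z)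
    (continuous_subspaceT (@continuous_sin R)).
  by rewrite normrM -[leRHS]mul1r ler_wpM2r// cos_max.
by have [/H|/ltW /H] := leP x y; rewrite // distrC [leRHS]distrC.
Qed.

Lemma cos_lipschitz (x y : R) : `|cos x - cos y| <= `|x - y|.
Proof.
have H (z : R) : cos z = sin (z + pi / 2) by rewrite sinDpihalf.
by rewrite !H (le_trans (sin_lipschitz _ _))// opprD addrACA subrr addr0.
Qed.

Lemma coordinate_le_enorm (j : 'I_2) a : `|coordinate j a| <= enorm a.
Proof.
rewrite -sqrtr_sqr /enorm ler_sqrt ?addr_ge0 ?sqr_ge0// /coordinate.
by case: ifP => _; rewrite ?lerDl ?lerDr sqr_ge0.
Qed.

Lemma enorm_ge0 a : 0 <= enorm a. Proof. exact: sqrtr_ge0. Qed.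

Lemma enorm_sqr a : enorm a ^+ 2 = a.1 ^+ 2 + a.2 ^+ 2.
Proof. by rewrite sqr_sqrtr// addr_ge0// sqr_ge0. Qed.

Let mT T : measurable (`]0, T[%classic : set (measurableTypeR R)).
Proof. exact: measurable_itv. Qed.

Definition sine_pairing T (p : R -> R) c : R :=
  \int[leb1]_(t in `]0, T[%classic) (p (T - t) * sin (c * t)).

Let msin c (D : set (measurableTypeR R)) : measurable_fun D (fun t => sin (c * t)).
Proof.
apply: measurable_funTS; apply: continuous_measurable_fun => t.
by apply: continuous_comp; [apply: cvgMr; exact: cvg_id|exact: continuous_sin].
Qed.

Lemma sine_pairing_le T (p : R -> R) c : leb.-integrable `]0, T[ (EFin \o p) ->
  `|sine_pairing T p c| <= \int[leb1]_(t in `]0, T[%classic) `|p t|.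
Proof.
move=> pi0; have [_ ri] := Rintegral_reflect pi0.
have [<- _] := Rintegral_reflect (integrable_norm pi0).
rewrite -[leRHS]mul1r; apply: (Rintegral_mul_le (mT T) ri) => //.
by move=> t _; exact: sin_max.
Qed.

Lemma sine_pairingB T (p p' : R -> R) c : leb.-integrable `]0, T[ (EFin \o p) ->
  leb.-integrable `]0, T[ (EFin \o p') ->
  sine_pairing T p c - sine_pairing T p' c = sine_pairing T (p \- p') c.
Proof.
move=> pi0 pi1; have [_ r0] := Rintegral_reflect pi0; have [_ r1] := Rintegral_reflect pi1.
have h (q : R -> R) : leb.-integrable `]0, T[ (EFin \o q) ->
    leb.-integrable `]0, T[ (EFin \o (fun t => q t * sin (c * t))).
  move=> qi; apply: (@integrable_mul_bounded _ _ _ leb `]0, T[ q _ 1 (mT T) qi); first exact: msin.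
  by move=> t _; exact: sin_max.
rewrite /sine_pairing -RintegralB; [|exact: mT|exact: (h _ r0)|exact: (h _ r1)].
by apply: eq_Rintegral => t _; rewrite -mulrBl.
Qed.

Lemma continuous_sine_pairing T (p : R -> R) (g : R * R -> R) :
  leb.-integrable `]0, T[ (EFin \o p) -> continuous g ->
  continuous (fun a => sine_pairing T p (g a)).
Proof.
move=> pi0 cg a0; have [_ ri] := Rintegral_reflect pi0.
apply: (@Rintegral_mul_cvg _ _ _ leb `]0, T[ (fun t => p (T - t)) _ _ _ _
  (fun a => `|g a - g a0| * T)) => //.
- by exists 1 => t _; exact: sin_max.
- move=> a t; rewrite /= in_itv/= => /andP[t0 tT].
  rewrite (le_trans (sin_lipschitz _ _))// -mulrBl normrM ler_wpM2l//.
  by rewrite ger0_norm ltW.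
- rewrite -(mul0r T); apply: cvgMl; rewrite -(normr0 R) -(subrr (g a0)).
  by apply: cvg_norm; apply: cvgB; [exact: cg|exact: cvg_cst].
Qed.

Lemma phi_integrable T I : is_data T I -> leb.-integrable `]0, T[ (EFin \o phi I).
Proof. by move=> [/(Lp1_integrable _ _ (mT T))]. Qed.

Lemma data_integrable T I j : is_data T I ->
  [/\ L1_L1 T (surf I j), leb2.-integrable (Omega : set R2) (EFin \o u0 I j),
      leb2.-integrable (Omega : set R2) (EFin \o u0s I j) &
      leb2.-integrable (Omega : set R2) (EFin \o uT I j)].
Proof.
have mO := measurable_Omega (R := R).
by move=> [_ /(_ j)[h1 h2 h3 h4]]; split=> //; exact/(Lp1_integrable _ _ mO).
Qed.

Lemma cos_coef_le (w : R * R -> R) a : leb2.-integrable (Omega : set R2) (EFin \o w) ->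
  `|cos_coef w a| <= \int[leb2]_(x in Omega) `|w x|.
Proof.
move=> wi; rewrite -[leRHS]mul1r; apply: (Rintegral_mul_le (measurable_Omega (R := R)) wi).
  exact: measurable_funTS (measurable_cos_pdot a).
by move=> x _; exact: cos_max.
Qed.

Lemma cos_coef_lin (w w' : R * R -> R) p q a :
  leb2.-integrable (Omega : set R2) (EFin \o w) ->
  leb2.-integrable (Omega : set R2) (EFin \o w') ->
  cos_coef (fun x => p * w x + q * w' x) a = p * cos_coef w a + q * cos_coef w' a.
Proof.
move=> wi wi'; have mO := measurable_Omega (R := R).
have i0 := integrable_bounded_cos a wi; have i1 := integrable_bounded_cos a wi'.
rewrite /cos_coef -!RintegralZl; [|exact: mO|exact: i1|exact: mO|exact: i0].
rewrite -RintegralD; [|exact: mO| |].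
- apply: eq_Rintegral => x _; have alg (y z k : R) : (p * y + q * z) * k = p * (y * k) + q * (z * k) by ring.
  exact: alg.
- by have := integrableZl mO p i0; apply: (eq_integrable mO).
- by have := integrableZl mO q i1; apply: (eq_integrable mO).
Qed.

Lemma boundary_pairing_le T c Y a : L1_L1 T Y ->
  `|boundary_pairing T c Y a| <= fine (L1L1norm T Y).
Proof.
move=> Yi; rewrite (boundary_pairingE c a Yi).1 -slab_Rnorm// -[leRHS]mul1r.
apply: (Rintegral_mul_le (measurable_slab T) (slab_integrable Yi)).
  exact: measurable_wave_kernel.
by move=> z _; exact: wave_kernel_le1.
Qed.

Lemma boundary_pairing_lin T c (Y Y' : R -> R * R -> R) p q a : L1_L1 T Y -> L1_L1 T Y' ->
  boundary_pairing T c (fun t x => p * Y t x + q * Y' t x) a =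
    p * boundary_pairing T c Y a + q * boundary_pairing T c Y' a.
Proof.
move=> Yi Yi'; have mS := measurable_slab (R := R) T.
have k Z : L1_L1 T Z -> slab_measure.-integrable (boundary_slab T)
    (EFin \o (fun z : R * (R * R) => Z z.1 z.2 * wave_kernel T c a z)).
  move=> Zi; apply: (integrable_mul_bounded mS (slab_integrable Zi) _ (fun z _ => wave_kernel_le1 T c a z)).
  exact: measurable_wave_kernel.
have i0 := integrableZl mS p (k _ Yi); have i1 := integrableZl mS q (k _ Yi').
rewrite (boundary_pairingE c a Yi).1 (boundary_pairingE c a Yi').1.
rewrite -!RintegralZl; [|exact: mS|exact: k Yi'|exact: mS|exact: k Yi].
rewrite -RintegralD; [|exact: mS|exact: i0|exact: i1].
have := integrableD mS i0 i1.
set G := (fun z : R * (R * R) => p * (Y z.1 z.2 * wave_kernel T c a z) + q * (Y' z.1 z.2 * wave_kernel T c a z)).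
move=> Gi.
have E : G = (fun z => sin (c * (T - z.1)) * (p * Y z.1 z.2 + q * Y' z.1 z.2) * cos (pdot a z.2)).
  apply/funext => z; rewrite /G /wave_kernel.
  have alg (s y y' k0 : R) : p * (y * (s * k0)) + q * (y' * (s * k0)) = s * (p * y + q * y') * k0 by ring.
  exact: alg.
have {}Gi : slab_measure.-integrable (boundary_slab T) (EFin \o G) by [].
rewrite -/G; rewrite E in Gi *.
by rewrite (slab_Fubini (f := fun t x => sin (c * (T - t)) * (p * Y t x + q * Y' t x) * cos (pdot a x)) Gi).1.
Qed.

Lemma boundary_pairingB T c (Y Y' : R -> R * R -> R) a : L1_L1 T Y -> L1_L1 T Y' ->
  boundary_pairing T c (fun t => (Y t \- Y' t)%R) a =
    boundary_pairing T c Y a - boundary_pairing T c Y' a.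
Proof.
move=> Yi Yi'.
have E : (fun t => (Y t \- Y' t)%R) = (fun t x => 1 * Y t x + (- 1) * Y' t x).
  apply/funext => t; apply/funext => x.
  have alg (y y' : R) : y - y' = 1 * y + (- 1) * y' by ring.
  exact: alg.
rewrite E; apply: (eq_trans (boundary_pairing_lin c 1 (- 1) a Yi Yi')).
have alg (p q : R) : 1 * p + (- 1) * q = p - q by ring.
exact: alg.
Qed.

Let pdot_le a a0 (x : R * R) : 0 <= x.1 <= 1 -> 0 <= x.2 <= 1 ->
  `|pdot a x - pdot a0 x| <= `|a.1 - a0.1| + `|a.2 - a0.2|.
Proof.
move=> /andP[x0 x1] /andP[y0 y1]; rewrite /pdot opprD addrACA -!mulrBl.
rewrite (le_trans (ler_normD _ _))// !normrM lerD//.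
  by rewrite -[leRHS]mulr1 ler_wpM2l// ger0_norm.
by rewrite -[leRHS]mulr1 ler_wpM2l// ger0_norm.
Qed.

Let cvg_dist a0 : `|a.1 - a0.1| + `|a.2 - a0.2| @[a --> a0] --> (0 : R).
Proof.
rewrite -(addr0 0); apply: cvgD.
- rewrite -[X in _ --> X](normr0 R) -(subrr a0.1); apply: cvg_norm.
  by apply: cvgB; [exact: cvg_fst|exact: cvg_cst].
- rewrite -[X in _ --> X](normr0 R) -(subrr a0.2); apply: cvg_norm.
  by apply: cvgB; [exact: cvg_snd|exact: cvg_cst].
Qed.

Lemma continuous_cos_coef (w : R * R -> R) :
  leb2.-integrable (Omega : set R2) (EFin \o w) -> continuous (cos_coef w).
Proof.
move=> wi a0; apply: (@Rintegral_mul_cvg _ _ _ leb2 Omega w _ _ _ _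
  (fun a : R * R => `|a.1 - a0.1| + `|a.2 - a0.2|)).
- exact: measurable_Omega.
- exact: wi.
- by move=> a; exact: measurable_funTS (measurable_cos_pdot a).
- exact: measurable_funTS (measurable_cos_pdot a0).
- by exists 1 => x _; exact: cos_max.
- move=> a x /sub_Omega_square[]; rewrite /= !in_itv/= => h1 h2.
  by rewrite (le_trans (cos_lipschitz _ _))// pdot_le.
- exact: cvg_dist.
Qed.

Lemma continuous_boundary_pairing T (Y : R -> R * R -> R) (g : R * R -> R) :
  L1_L1 T Y -> continuous g -> continuous (fun a => boundary_pairing T (g a) Y a).
Proof.
move=> Yi cg a0.
have -> : (fun a => boundary_pairing T (g a) Y a) =
   (fun a => \int[slab_measure]_(z in boundary_slab T) (Y z.1 z.2 * wave_kernel T (g a) a z)).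
  by apply/funext => a; rewrite (boundary_pairingE _ _ Yi).1.
apply: (@Rintegral_mul_cvg _ _ _ slab_measure (boundary_slab T) (fun z : R * (R * R) => Y z.1 z.2) _ _
   (fun a => wave_kernel T (g a) a) (wave_kernel T (g a0) a0)
  (fun a : R * R => `|g a - g a0| * T + (`|a.1 - a0.1| + `|a.2 - a0.2|))).
- exact: measurable_slab.
- exact: slab_integrable.
- by move=> a; exact: measurable_wave_kernel.
- exact: measurable_wave_kernel.
- by exists 1 => z _; exact: wave_kernel_le1.
- move=> a [t x] [/= tT /sub_dOmega_square[]]; rewrite /= !in_itv/= => h1 h2.
  move: tT; rewrite in_itv/= => /andP[t0 tT]; rewrite /wave_kernel/=.
  have alg (s s0 k k0 : R) : s * k - s0 * k0 = (s - s0) * k + s0 * (k - k0) by ring.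
  rewrite alg (le_trans (ler_normD _ _))// !normrM lerD//.
    rewrite -[leRHS]mulr1 ler_pM ?cos_max//.
    rewrite (le_trans (sin_lipschitz _ _))// -mulrBl normrM ler_wpM2l//.
    by rewrite ger0_norm ?subr_ge0 ?(ltW tT)// gerBl ltW.
  rewrite -[leRHS]mul1r ler_pM ?sin_max//.
  by rewrite (le_trans (cos_lipschitz _ _))// pdot_le.
- rewrite -(addr0 0); apply: cvgD; last exact: cvg_dist.
  rewrite -(mul0r T); apply: cvgMl; rewrite -(normr0 R) -(subrr (g a0)).
  by apply: cvg_norm; apply: cvgB; [exact: cg|exact: cvg_cst].
Qed.

Lemma continuous_hcomp T I j (g : R * R -> R) : is_data T I -> continuous g ->
  continuous (fun a => hcomp T (g a) I j a).
Proof.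
move=> Id cg; have [s1 s2 s3 s4] := data_integrable j Id.
have cs : continuous (fun a => sin (g a * T)).
  move=> a; apply: (@continuous_comp _ _ _ (fun a => g a * T) sin); last exact: continuous_sin.
  by apply: cvgMl; exact: cg.
have cc : continuous (fun a => cos (g a * T)).
  move=> a; apply: (@continuous_comp _ _ _ (fun a => g a * T) cos); last exact: continuous_cos.
  by apply: cvgMl; exact: cg.
move=> a; apply: cvgB; last exact: continuous_boundary_pairing.
apply: cvgB; first apply: cvgD.
- by apply: cvgM; [apply: cvgN; exact: cs|exact: continuous_cos_coef].
- by apply: cvgM; [exact: cg|exact: continuous_cos_coef].
- by apply: cvgM; [apply: cvgM; [exact: cg|exact: cc]|exact: continuous_cos_coef].
Qed.

(** One estimate serves twice: for the size of [hcomp], and, by linearity in the data, for the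
    difference between two data sets. *)
Let hcomp_bound (s k c U S V P u v w z : R) : `|s| <= 1 -> `|k| <= 1 -> 0 <= c ->
  `|S| <= u -> `|V| <= v -> `|U| <= w -> `|P| <= z ->
  `|- s * S + c * V - c * k * U - P| <= (u + v + w + z) * (1 + c).
Proof.
move=> s1 k1 c0 Su Vv Uw Pz.
have u0 := le_trans (normr_ge0 _) Su; have v0 := le_trans (normr_ge0 _) Vv.
have w0 := le_trans (normr_ge0 _) Uw; have z0 := le_trans (normr_ge0 _) Pz.
have a1 : `|- s * S| <= u by rewrite normrM normrN -[leRHS]mul1r ler_pM.
have a2 : `|c * V| <= c * v by rewrite normrM ger0_norm// ler_wpM2l.
have a3 : `|c * k * U| <= c * w.
  by rewrite !normrM (ger0_norm c0) -mulrA ler_wpM2l// -[leRHS]mul1r ler_pM.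
apply: (@le_trans _ _ (u + c * v + c * w + z)).
  rewrite (le_trans (ler_normB _ _))// lerD// (le_trans (ler_normB _ _))// lerD//.
  by rewrite (le_trans (ler_normD _ _))// lerD.
have := mulr_ge0 c0 u0; have := mulr_ge0 c0 z0; nra.
Qed.

Lemma hcomp_le T I j : is_data T I ->
  exists2 K, 0 <= K & forall c a, 0 <= c -> `|hcomp T c I j a| <= K * (1 + c).
Proof.
move=> /(data_integrable j)[s1 s2 s3 s4].
exists ((\int[leb2]_(x in Omega) `|u0s I j x|) + (\int[leb2]_(x in Omega) `|uT I j x|) +
   (\int[leb2]_(x in Omega) `|u0 I j x|) + fine (L1L1norm T (surf I j))).
  rewrite !addr_ge0//; do ?[by apply: Rintegral_ge0].
  by have := boundary_pairing_le 0 (0, 0) s1; exact: le_trans.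
move=> c a c0; apply: hcomp_bound => //; do ?[exact: sin_max|exact: cos_max|exact: cos_coef_le].
exact: boundary_pairing_le.
Qed.

Let Lp1_fine (w w' : R * R -> R) eps :
  leb2.-integrable (Omega : set R2) (EFin \o w) -> leb2.-integrable (Omega : set R2) (EFin \o w') ->
  (Lpnorm leb2 Omega 1%E (w \- w')%R <= eps%:E)%E ->
  forall a, `|cos_coef w a - cos_coef w' a| <= eps.
Proof.
move=> wi wi' h a; have mO := measurable_Omega (R := R).
have -> : cos_coef w a - cos_coef w' a = cos_coef (w \- w')%R a.
  have -> : (w \- w')%R = (fun x => 1 * w x + (- 1) * w' x).
    by apply/funext => x /=; rewrite mul1r mulN1r.
  by rewrite cos_coef_lin// mul1r mulN1r.
have di : leb2.-integrable (Omega : set R2) (EFin \o (w \- w')%R).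
  by have := integrableB mO wi wi'; apply: (eq_integrable mO).
apply: (le_trans (cos_coef_le a di)).
move: h; rewrite Lpnorm1E//.
have /integrableP[_ fi] := di.
rewrite -[X in (X <= _)%E]fineK//.
by rewrite ge0_fin_numE//; apply: integral_ge0.
Qed.

Lemma hcompB T I J j eps : is_data T I -> is_data T J -> data_close T eps I J ->
  forall c a, 0 <= c -> `|hcomp T c I j a - hcomp T c J j a| <= (eps + eps + eps + eps) * (1 + c).
Proof.
move=> Id Jd [_ /(_ j)[h1 h2 h3 h4]] c a c0.
have [s1 s2 s3 s4] := data_integrable j Id; have [r1 r2 r3 r4] := data_integrable j Jd.
have alg (s k S V U P S' V' U' P' : R) :
   (- s * S + c * V - c * k * U - P) - (- s * S' + c * V' - c * k * U' - P') =
   - s * (S - S') + c * (V - V') - c * k * (U - U') - (P - P') by ring.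
rewrite /hcomp alg; apply: hcomp_bound => //; do ?[exact: sin_max|exact: cos_max|exact: Lp1_fine].
set B := boundary_pairing.
rewrite /B -boundary_pairingB//.
have m : L1_L1 T (fun t => (surf I j t \- surf J j t)%R).
  split; last exact: le_lt_trans h1 (ltry _).
  by apply: measurable_funB; [exact: s1.1|exact: r1.1].
apply: (le_trans (boundary_pairing_le _ _ m)).
have fn : L1L1norm T (fun t => (surf I j t \- surf J j t)%R) \is a fin_num.
  rewrite ge0_fin_numE; first exact: le_lt_trans h1 (ltry _).
  by apply: integral_ge0 => t _; apply: integral_ge0.
by rewrite -lee_fin fineK.
Qed.

End frequency_data.

Section measurable_inverse.
Context d (X : measurableType d) (R : realType).

(** For nonnegative values the inverse is the real power [-1], and at [0] both are [0] by
    convention, so division by [|a|^2] needs no separate treatment at the origin. *)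
Lemma measurable_inv_ge0 (f : X -> R) : (forall x, 0 <= f x) -> measurable_fun setT f ->
  measurable_fun setT (fun x => (f x)^-1).
Proof.
move=> f0 mf; have -> : (fun x => (f x)^-1) = (fun x => f x `^ (-1)).
  by apply/funext => x; rewrite powR_inv1.
exact: measurableT_comp (measurable_powR (-1)) mf.
Qed.

End measurable_inverse.

(** * The quotient for exact data and its stability under noise *)

Section reconstruction.
Context {R : realType}.
Local Notation R2 := (measurableTypeR R * measurableTypeR R)%type.
Local Notation leb := (@lebesgue_measure R).
Variables (T lam mu : R).
Hypotheses (T0 : 0 < T) (mu0 : 0 < mu) (lm0 : 0 < lam + 2 * mu).
Implicit Types (I J : data R) (a : R * R) (j : 'I_2) (eps del : R).

Local Notation c1 a := (Num.sqrt (lam + 2 * mu) * enorm a).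
Local Notation c2 a := (Num.sqrt mu * enorm a).

Let vdotE a (v : 'I_2 -> R) : vdot a v = coordinate 0 a * v 0 + coordinate 1 a * v 1.
Proof. exact: sum_I2. Qed.

Lemma hcomp_combination c I a (p q : R) : is_data T I ->
  - sin (c * T) * cos_coef (fun x => p * u0s I 0 x + q * u0s I 1 x) a
  + c * cos_coef (fun x => p * uT I 0 x + q * uT I 1 x) a
  - c * cos (c * T) * cos_coef (fun x => p * u0 I 0 x + q * u0 I 1 x) a
  - boundary_pairing T c (fun t x => p * surf I 0 t x + q * surf I 1 t x) a
  = p * hcomp T c I 0 a + q * hcomp T c I 1 a.
Proof.
move=> Id; have [s1 s2 s3 s4] := data_integrable 0 Id; have [r1 r2 r3 r4] := data_integrable 1 Id.
rewrite (boundary_pairing_lin _ _ _ _ s1 r1) (cos_coef_lin _ _ _ s2 r2).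
rewrite (cos_coef_lin _ _ _ s3 r3) (cos_coef_lin _ _ _ s4 r4) /hcomp.
have alg (s k x0 x1 y0 y1 z0 z1 b0 b1 : R) :
  - s * (p * x0 + q * x1) + c * (p * y0 + q * y1) - c * k * (p * z0 + q * z1) - (p * b0 + q * b1) =
  p * (- s * x0 + c * y0 - c * k * z0 - b0) + q * (- s * x1 + c * y1 - c * k * z1 - b1) by ring.
exact: alg.
Qed.

(** [h0] and [hj] are the same functional applied to two linear forms [L] in the components; the
    coefficients of [L] pull out. *)
Let functionalE c I a (L : ('I_2 -> R) -> R) (p q : R) :
  (forall v, L v = p * v 0 + q * v 1) -> is_data T I ->
  - sin (c * T) * \int[leb2]_(x in Omega) (L (fun i => u0s I i x) * cos (pdot a x))
  + c * \int[leb2]_(x in Omega) (L (fun i => uT I i x) * cos (pdot a x))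
  - c * cos (c * T) * \int[leb2]_(x in Omega) (L (fun i => u0 I i x) * cos (pdot a x))
  - \int[leb1]_(t in `]0, T[%classic) \int[arc_length]_(x in dOmega)
      (sin (c * (T - t)) * L (fun i => surf I i t x) * cos (pdot a x))
  = p * hcomp T c I 0 a + q * hcomp T c I 1 a.
Proof.
move=> LE Id; rewrite -(hcomp_combination c a p q Id).
have E (w : 'I_2 -> R * R -> R) : \int[leb2]_(x in Omega) (L (fun i => w i x) * cos (pdot a x)) =
    cos_coef (fun x => p * w 0 x + q * w 1 x) a.
  by apply: eq_Rintegral => x _; rewrite LE.
have F : \int[leb1]_(t in `]0, T[%classic) \int[arc_length]_(x in dOmega)
      (sin (c * (T - t)) * L (fun i => surf I i t x) * cos (pdot a x)) =
   boundary_pairing T c (fun t x => p * surf I 0 t x + q * surf I 1 t x) a.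
  by apply: eq_Rintegral => t _; apply: eq_Rintegral => x _; rewrite LE.
by rewrite E E E F.
Qed.

Lemma h0E I a : is_data T I ->
  h0 T lam mu I a = coordinate 0 a * hcomp T (c1 a) I 0 a + coordinate 1 a * hcomp T (c1 a) I 1 a.
Proof. by move=> Id; exact: (functionalE (c1 a) a (vdotE a) Id). Qed.

(* Coefficients of the map [v |-> |a|^2 v_j - a_j (a . v)] of the paper. *)
Definition transverse j a (i : 'I_2) : R :=
  enorm a ^+ 2 * (i == j)%:R - coordinate j a * coordinate i a.

Lemma hjE I j a : is_data T I ->
  hj T mu I j a = transverse j a 0 * hcomp T (c2 a) I 0 a + transverse j a 1 * hcomp T (c2 a) I 1 a.
Proof.
move=> Id; apply: (functionalE (c2 a) a _ Id) => v; rewrite vdotE /transverse.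
have alg (e x y z v0 v1 p q w : R) : e * w = e * p * v0 + e * q * v1 ->
  e * w - x * (y * v0 + z * v1) = (e * p - x * y) * v0 + (e * q - x * z) * v1 by move=> ->; ring.
apply: alg; move: (j); apply: I2P => /=.
  by rewrite mulr1n mulr0n mulr1 mulr0 mul0r addr0.
by rewrite mulr1n mulr0n mulr1 mulr0 mul0r add0r.
Qed.

Lemma transverse_le j a i : `|transverse j a i| <= 2 * enorm a ^+ 2.
Proof.
rewrite /transverse mulr_natl mulr2n (le_trans (ler_normB _ _))// lerD//.
  rewrite normrM ger0_norm ?sqr_ge0// -[leRHS]mulr1 ler_wpM2l ?sqr_ge0//.
  by case: (i == j); rewrite ?normr1 ?normr0.
by rewrite normrM expr2 ler_pM ?coordinate_le_enorm.
Qed.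

(** [exact_identity] is used with [b = a], and with [b] the [j]-th row of [|a|^2 - a a^T], which is
    orthogonal to [a]. The longitudinal and transverse parts [a_j (a . C)] and
    [|a|^2 C_j - a_j (a . C)] then add up to [|a|^2 C_j], which the prefactor [2 / |a|^2]
    normalizes. *)
Lemma gj_exact I (u : 'I_2 -> R -> R * R -> R) (f : 'I_2 -> R * R -> R) j a :
  is_data T I -> inverse_solution T lam mu I u f ->
  (forall j, Ck_L2 T 2 (u j) /\ L2_H2 T (u j)) -> (forall j, L2Omega (f j)) ->
  enorm a != 0 -> gj T lam mu I j a = 2 * DI T lam mu I a * cos_coef (f j) a.
Proof.
move=> Id sol reg fL2 a0.
have lmE : Num.sqrt (lam + 2 * mu) ^+ 2 = lam + 2 * mu by rewrite sqr_sqrtr// ltW.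
have mE : Num.sqrt mu ^+ 2 = mu by rewrite sqr_sqrtr// ltW.
have aE := enorm_sqr a.
have e1 := @exact_identity _ T lam mu I u f a (c1 a) (fun i => coordinate i a) T0 Id sol reg fL2.
have e2 := @exact_identity _ T lam mu I u f a (c2 a) (transverse j a) T0 Id sol reg fL2.
have jP : j = 0 \/ j = 1 by move: (j); apply: I2P; [left|right].
have {}e1 : coordinate 0 a * hcomp T (c1 a) I 0 a + coordinate 1 a * hcomp T (c1 a) I 1 a =
   D1 T lam mu I a * (coordinate 0 a * cos_coef (f 0) a + coordinate 1 a * cos_coef (f 1) a).
  rewrite -(sum_I2 (fun i => coordinate i a * hcomp T (c1 a) I i a)).
  rewrite -(sum_I2 (fun i => coordinate i a * cos_coef (f i) a)).
  by apply: e1 => i; rewrite exprMn lmE aE sum_I2 /coordinate /=; ring.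
have {}e2 : transverse j a 0 * hcomp T (c2 a) I 0 a + transverse j a 1 * hcomp T (c2 a) I 1 a =
   D2 T mu I a * (transverse j a 0 * cos_coef (f 0) a + transverse j a 1 * cos_coef (f 1) a).
  rewrite -(sum_I2 (fun i => transverse j a i * hcomp T (c2 a) I i a)).
  rewrite -(sum_I2 (fun i => transverse j a i * cos_coef (f i) a)).
  apply: e2 => i; rewrite exprMn mE aE sum_I2.
  (* Orthogonality to [a] removes the term with [lam + mu], so the eigenvalue is [mu |a|^2]. *)
  have -> : coordinate 0 a * transverse j a 0 + coordinate 1 a * transverse j a 1 = 0.
    by rewrite /transverse aE; case: jP => -> /=; rewrite /coordinate /= ?mulr1n ?mulr0n; ring.
  by rewrite mulr0 add0r.
have H0 := etrans (h0E a Id) e1; have Hj := etrans (hjE j a Id) e2.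
rewrite /gj /DI H0 Hj {H0 Hj e1 e2} /transverse /coordinate /=.
move: (D1 T lam mu I a) (D2 T mu I a) => d1 d2.
have h : a.1 ^+ 2 + a.2 ^+ 2 != 0 by rewrite -aE expf_neq0.
by case: jP => ->; move: (cos_coef (f 0) a) (cos_coef (f 1) a) => C0 C1;
  rewrite /= aE ?mulr1n ?mulr0n; field.
Qed.

(** Both terms are quadratic in [a], so the division by [|a|^2] costs nothing; [12 = 2 (2 + 4)],
    from two components each and the bound [2 |a|^2] on [transverse]. At [a = 0] the left side is
    zero, as the inverse of [0] is [0]. *)
Let bilinear_le j a (M N d1 d2 x0 x1 y0 y1 : R) : `|d1| <= M -> `|d2| <= M ->
  `|x0| <= N -> `|x1| <= N -> `|y0| <= N -> `|y1| <= N ->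
  `|2 / enorm a ^+ 2 * (coordinate j a * d2 * (coordinate 0 a * x0 + coordinate 1 a * x1) +
      d1 * (transverse j a 0 * y0 + transverse j a 1 * y1))| <= 12 * M * N.
Proof.
move=> d1M d2M x0N x1N y0N y1N.
have M0 := le_trans (normr_ge0 _) d1M; have N0 := le_trans (normr_ge0 _) x0N.
have r0 := enorm_ge0 a; set r := enorm a in r0 *.
have [->|rn0] := eqVneq r 0.
  by rewrite expr0n/= invr0 mulr0 mul0r normr0 mulr_ge0 ?mulr_ge0.
have r2 : 0 < r ^+ 2 by rewrite lt0r sqr_ge0 expf_neq0.
have C i := coordinate_le_enorm i a; have Tr i := transverse_le j a i; rewrite -/r in C Tr.
have h1 : `|coordinate 0 a * x0 + coordinate 1 a * x1| <= 2 * (r * N).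
  by rewrite mulr_natl mulr2n (le_trans (ler_normD _ _))// !normrM lerD// ler_pM.
have h2 : `|transverse j a 0 * y0 + transverse j a 1 * y1| <= 2 * (2 * r ^+ 2 * N).
  by rewrite [leRHS]mulr_natl mulr2n (le_trans (ler_normD _ _))// !normrM lerD// ler_pM.
have h3 : `|coordinate j a * d2| <= r * M by rewrite normrM ler_pM.
rewrite normrM ger0_norm; last by rewrite divr_ge0// ltW.
rewrite mulrAC ler_pdivrMr//.
apply: (@le_trans _ _ (2 * (r * M * (2 * (r * N)) + M * (2 * (2 * r ^+ 2 * N))))).
  rewrite ler_wpM2l// (le_trans (ler_normD _ _))// lerD//; first by rewrite normrM ler_pM.
  by rewrite normrM ler_pM.
by rewrite le_eqVlt; apply/orP; left; apply/eqP; ring.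
Qed.

(** Converts growth in either wave frequency into growth in [|a|]. *)
Let kap : R := 1 + Num.sqrt (lam + 2 * mu) + Num.sqrt mu.

Let freq_le a : 1 + c1 a <= kap * (1 + enorm a) /\ 1 + c2 a <= kap * (1 + enorm a).
Proof.
have r0 := enorm_ge0 a; have s1 := sqrtr_ge0 (lam + 2 * mu); have s2 := sqrtr_ge0 mu.
rewrite /kap; have := mulr_ge0 s1 r0; have := mulr_ge0 s2 r0.
set x := Num.sqrt (lam + 2 * mu) in s1 *; set y := Num.sqrt mu in s2 *; set r := enorm a in r0 *.
by move=> h1 h2; split; lra.
Qed.

Let kap0 : 0 <= kap.
Proof. by rewrite /kap !addr_ge0 ?sqrtr_ge0. Qed.

Let c1_ge0 a : 0 <= c1 a. Proof. by rewrite mulr_ge0 ?sqrtr_ge0 ?enorm_ge0. Qed.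
Let c2_ge0 a : 0 <= c2 a. Proof. by rewrite mulr_ge0 ?sqrtr_ge0 ?enorm_ge0. Qed.

Let hcomp_bound_of I : is_data T I -> exists2 K, 0 <= K & forall j c a, 0 <= c ->
  `|hcomp T c I j a| <= K * (1 + c).
Proof.
move=> Id; have [K0 K00 h0] := hcomp_le 0 Id; have [K1 K10 h1] := hcomp_le 1 Id.
exists (K0 + K1); first exact: addr_ge0.
move=> j c a c0; have c10 : 0 <= 1 + c by rewrite addr_ge0.
move: j; apply: I2P; [apply: (le_trans (h0 c a c0))|apply: (le_trans (h1 c a c0))];
  by rewrite ler_wpM2r// ?lerDl ?lerDr.
Qed.

Let phi_norm I : R := \int[leb1]_(t in `]0, T[%classic) `|phi I t|.

Lemma D12_le I a : is_data T I -> `|D1 T lam mu I a| <= phi_norm I /\ `|D2 T mu I a| <= phi_norm I.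
Proof.
by move=> /phi_integrable pi0; split; [exact: (sine_pairing_le (c1 a) pi0)|exact: (sine_pairing_le (c2 a) pi0)].
Qed.

Lemma D12B I J a eps : is_data T I -> is_data T J -> data_close T eps I J ->
  `|D1 T lam mu I a - D1 T lam mu J a| <= eps /\ `|D2 T mu I a - D2 T mu J a| <= eps.
Proof.
move=> /phi_integrable pi0 /phi_integrable pj0 [h _].
have mD : measurable (`]0, T[%classic : set (measurableTypeR R)) by exact: measurable_itv.
have di : leb.-integrable `]0, T[ (EFin \o (phi I \- phi J)%R).
  by have := integrableB mD pi0 pj0; apply: (eq_integrable mD).
have e : \int[leb1]_(t in `]0, T[%classic) `|(phi I \- phi J)%R t| <= eps.
  move: h; rewrite Lpnorm1E//; have /integrableP[_ fi] := di.
  rewrite -[X in (X <= _)%E]fineK//.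
  by rewrite ge0_fin_numE//; apply: integral_ge0.
have H c : `|sine_pairing T (phi I) c - sine_pairing T (phi J) c| <= eps.
  by rewrite sine_pairingB//; exact: le_trans (sine_pairing_le c di) e.
by split; [exact: (H (c1 a))|exact: (H (c2 a))].
Qed.

Lemma gj_le I : is_data T I -> exists2 K, 0 <= K & forall j a,
  `|gj T lam mu I j a| <= K * (1 + enorm a).
Proof.
move=> Id; have [K K0 Kh] := hcomp_bound_of Id.
exists (12 * phi_norm I * (K * kap)).
  by rewrite !mulr_ge0//; apply: Rintegral_ge0.
move=> j a; have [d1 d2] := D12_le a Id; have [f1 f2] := freq_le a.
rewrite /gj (h0E _ Id) (hjE _ _ Id) -[leRHS]mulrA.
have h1 i : `|hcomp T (c1 a) I i a| <= K * kap * (1 + enorm a).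
  by rewrite (le_trans (Kh _ _ _ (c1_ge0 a)))// -mulrA ler_wpM2l.
have h2 i : `|hcomp T (c2 a) I i a| <= K * kap * (1 + enorm a).
  by rewrite (le_trans (Kh _ _ _ (c2_ge0 a)))// -mulrA ler_wpM2l.
exact: bilinear_le.
Qed.

(** The constant depends on the exact data only: the size of the noisy functionals is replaced by
    that of the exact ones plus the error, which [eps <= 1] keeps bounded. This uniformity is needed
    as [eps] tends to zero. *)
Lemma gjB J : is_data T J -> exists2 K, 0 <= K & forall I eps, is_data T I ->
  0 <= eps <= 1 -> data_close T eps I J -> forall j a,
  `|gj T lam mu I j a - gj T lam mu J j a| <= K * (1 + enorm a) * eps.
Proof.
move=> Jd; have [K K0 Kh] := hcomp_bound_of Jd; set M := phi_norm J.
have M0 : 0 <= M by apply: Rintegral_ge0.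
exists (12 * ((K + 4) * kap) + 12 * M * (4 * kap)).
  by rewrite addr_ge0// !mulr_ge0// addr_ge0.
move=> I eps Id /andP[e0 e1] IJ j a.
have [d1 d2] := D12_le a Jd; have [f1 f2] := freq_le a; have [b1 b2] := D12B a Id Jd IJ.
have hB i := hcompB i Id Jd IJ.
have r0 : 0 <= 1 + enorm a by rewrite addr_ge0 ?enorm_ge0.
have diff c i : 0 <= c -> 1 + c <= kap * (1 + enorm a) ->
    `|hcomp T c I i a - hcomp T c J i a| <= 4 * kap * (1 + enorm a) * eps.
  move=> c0 cf; rewrite (le_trans (hB i c a c0))//.
  have -> : eps + eps + eps + eps = 4 * eps by ring.
  have -> : 4 * kap * (1 + enorm a) * eps = 4 * eps * (kap * (1 + enorm a)) by ring.
  by rewrite ler_wpM2l// mulr_ge0.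
have bnd c i : 0 <= c -> 1 + c <= kap * (1 + enorm a) ->
    `|hcomp T c I i a| <= (K + 4) * kap * (1 + enorm a).
  move=> c0 cf; rewrite -[hcomp T c I i a](subrK (hcomp T c J i a)) (le_trans (ler_normD _ _))//.
  have -> : (K + 4) * kap * (1 + enorm a) = 4 * kap * (1 + enorm a) * 1 + K * (kap * (1 + enorm a)) by ring.
  apply: lerD.
    by rewrite (le_trans (diff c i c0 cf))// ler_wpM2l// !mulr_ge0.
  by rewrite (le_trans (Kh i c a c0))// ler_wpM2l.
rewrite /gj (h0E _ Id) (hjE _ _ Id) (h0E _ Jd) (hjE _ _ Jd).
have B1 := bilinear_le j a b1 b2 (bnd _ 0 (c1_ge0 a) f1) (bnd _ 1 (c1_ge0 a) f1)
  (bnd _ 0 (c2_ge0 a) f2) (bnd _ 1 (c2_ge0 a) f2).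
have B2 := bilinear_le j a d1 d2 (diff _ 0 (c1_ge0 a) f1) (diff _ 1 (c1_ge0 a) f1)
  (diff _ 0 (c2_ge0 a) f2) (diff _ 1 (c2_ge0 a) f2).
(* The expression is bilinear: first the sine transforms change while the functionals are those of
   [I], then the functionals change while the sine transforms are those of [J]. *)
have alg (w t0 t1 k p q x0 x1 y0 y1 p' q' z0 z1 w0 w1 : R) :
   w * (k * q * (t0 * x0 + t1 * x1) + p * (transverse j a 0 * y0 + transverse j a 1 * y1)) -
   w * (k * q' * (t0 * z0 + t1 * z1) + p' * (transverse j a 0 * w0 + transverse j a 1 * w1)) =
   w * (k * (q - q') * (t0 * x0 + t1 * x1) + (p - p') * (transverse j a 0 * y0 + transverse j a 1 * y1)) +
   w * (k * q' * (t0 * (x0 - z0) + t1 * (x1 - z1)) + p' * (transverse j a 0 * (y0 - w0) + transverse j a 1 * (y1 - w1))) by ring.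
rewrite alg (le_trans (ler_normD _ _))// (le_trans (lerD B1 B2))//.
by rewrite -/M le_eqVlt; apply/orP; left; apply/eqP; ring.
Qed.

Lemma DI_le I a : is_data T I -> `|DI T lam mu I a| <= phi_norm I * phi_norm I.
Proof. by move=> Id; have [h1 h2] := D12_le a Id; rewrite /DI normrM ler_pM. Qed.

(** The Tikhonov-regularized quotient of [gj] by [DI]: it stays finite where [DI] vanishes. *)
Definition multiplier del I j a : R :=
  gj T lam mu I j a * DI T lam mu I a / (del + DI T lam mu I a ^+ 2).

Let ratio_le del x : 0 < del -> `|x / (del + x ^+ 2)| <= `|x| / del.
Proof.
move=> d0; have p : 0 < del + x ^+ 2 by rewrite ltr_pwDl ?sqr_ge0.
rewrite normrM [X in _ * X]ger0_norm ?invr_ge0 ?(ltW p)//.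
by rewrite ler_wpM2l// lef_pV2 ?posrE// lerDl sqr_ge0.
Qed.

(** The derivative of [x / (del + x^2)] is at most [1 / del] in modulus; here this appears through
    the exact factorization of the difference. *)
Let ratio_lipschitz del (x y : R) : 0 < del ->
  `|x / (del + x ^+ 2) - y / (del + y ^+ 2)| <= `|x - y| / del.
Proof.
move=> d0; have p : 0 < del + x ^+ 2 by rewrite ltr_pwDl ?sqr_ge0.
have q : 0 < del + y ^+ 2 by rewrite ltr_pwDl ?sqr_ge0.
have -> : x / (del + x ^+ 2) - y / (del + y ^+ 2) =
    (x - y) * ((del - x * y) / ((del + x ^+ 2) * (del + y ^+ 2))).
  by field; rewrite !gt_eqF.
rewrite normrM ler_wpM2l// normrM [X in _ * X]ger0_norm; last by rewrite invr_ge0 mulr_ge0// ltW.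
rewrite ler_pdivrMr ?mulr_gt0// ler_pdivlMl//.
(* With [u = |x|] and [v = |y|], the product of the denominators exceeds this bound by
   [del (u^2 - u v + v^2) + u^2 v^2]. *)
apply: (@le_trans _ _ (del * (del + `|x| * `|y|))).
  apply: ler_wpM2l; first exact: ltW.
  by apply: (le_trans (ler_normB _ _)); rewrite normrM (gtr0_norm d0).
rewrite -[x ^+ 2]real_normK ?num_real// -[y ^+ 2]real_normK ?num_real//.
have := normr_ge0 x; have := normr_ge0 y; move: `|x| `|y| => u v v0 u0.
have := sqr_ge0 (u - v); have := sqr_ge0 (u * v); nra.
Qed.

Lemma multiplier_le I del : is_data T I -> 0 < del -> exists2 K, 0 <= K & forall j a,
  `|multiplier del I j a| <= K * (1 + enorm a).
Proof.
move=> Id d0; have [K K0 Kg] := gj_le Id.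
exists (K * (phi_norm I * phi_norm I / del)).
  by rewrite mulr_ge0// divr_ge0 ?(ltW d0)// mulr_ge0//; apply: Rintegral_ge0.
move=> j a; rewrite /multiplier -mulrA normrM [leRHS]mulrAC ler_pM//.
by apply: (le_trans (ratio_le _ d0)); apply: ler_wpM2r; [rewrite invr_ge0 ltW|exact: DI_le].
Qed.

(** The filter is controlled through [1 / del], once for its size and once for its Lipschitz
    constant, so noise enters with the factor [eps / del] and linear growth in [|a|]. *)
Lemma multiplierB J : is_data T J -> exists2 K, 0 <= K & forall I eps del, is_data T I ->
  0 <= eps <= 1 -> 0 < del -> data_close T eps I J -> forall j a,
  `|multiplier del I j a - multiplier del J j a| <= K * (1 + enorm a) * (eps / del).
Proof.
move=> Jd; have [K1 K10 H1] := gjB Jd; have [K2 K20 H2] := gj_le Jd; set M := phi_norm J.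
have M0 : 0 <= M by apply: Rintegral_ge0.
exists (K1 * ((M + 1) * (M + 1)) + K2 * (M + 1 + M)).
  by rewrite addr_ge0// mulr_ge0// ?mulr_ge0// ?addr_ge0.
move=> I eps del Id e01 d0 IJ j a; have /andP[e0 e1] := e01.
have [d1 d2] := D12_le a Jd; have [b1 b2] := D12B a Id Jd IJ; rewrite -/M in d1 d2.
have r0 : 0 <= 1 + enorm a by rewrite addr_ge0 ?enorm_ge0.
have bd (x y : R) : `|y| <= M -> `|x - y| <= eps -> `|x| <= M + 1.
  move=> yM xy; rewrite -[x](subrK y) addrC (le_trans (ler_normD _ _))// lerD//.
  exact: le_trans xy e1.
have DIM : `|DI T lam mu I a| <= (M + 1) * (M + 1).
  by rewrite /DI normrM ler_pM//; [exact: bd d1 b1|exact: bd d2 b2].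
have DIB : `|DI T lam mu I a - DI T lam mu J a| <= (M + 1 + M) * eps.
  rewrite /DI; have alg (x y x' y' : R) : x * y - x' * y' = y * (x - x') + x' * (y - y') by ring.
  rewrite alg (le_trans (ler_normD _ _))// !normrM mulrDl lerD// ler_pM//.
  exact: bd d2 b2.
have alg (x y x' y' : R) : x * y - x' * y' = (x - x') * y + x' * (y - y') by ring.
have E I' : multiplier del I' j a =
    gj T lam mu I' j a * (DI T lam mu I' a / (del + DI T lam mu I' a ^+ 2)).
  by rewrite /multiplier mulrA.
have prod (x y p q : R) : `|x| <= p -> `|y| <= q -> `|x * y| <= p * q.
  by move=> xp yq; rewrite normrM ler_pM.
have id : 0 <= del^-1 by rewrite invr_ge0 ltW.
rewrite (E I) (E J) alg; apply: (le_trans (ler_normD _ _)).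
have -> : (K1 * ((M + 1) * (M + 1)) + K2 * (M + 1 + M)) * (1 + enorm a) * (eps / del) =
  (K1 * (1 + enorm a) * eps) * ((M + 1) * (M + 1) / del) + (K2 * (1 + enorm a)) * ((M + 1 + M) * eps / del) by ring.
apply: lerD; apply: prod.
- exact: H1 Id e01 IJ j a.
- by apply: (le_trans (ratio_le _ d0)); exact: ler_wpM2r.
- exact: H2.
- by apply: (le_trans (ratio_lipschitz _ _ d0)); exact: ler_wpM2r.
Qed.

Let cont_c1 : continuous (fun a => c1 a).
Proof. by move=> a; apply: cvgMr; exact: continuous_enorm. Qed.
Let cont_c2 : continuous (fun a => c2 a).
Proof. by move=> a; apply: cvgMr; exact: continuous_enorm. Qed.

Lemma measurable_DI I : is_data T I -> measurable_fun [set: R2] (DI T lam mu I).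
Proof.
move=> /phi_integrable pi0; apply: measurable_funM; apply: continuous_measurable_plane.
- exact: (continuous_sine_pairing pi0 cont_c1).
- exact: (continuous_sine_pairing pi0 cont_c2).
Qed.

Lemma measurable_coordinate i : measurable_fun [set: R2] (@coordinate R i).
Proof. by rewrite /coordinate; case: (i == 0); [exact: measurable_fst|exact: measurable_snd]. Qed.

Lemma measurable_gj I j : is_data T I -> measurable_fun [set: R2] (gj T lam mu I j).
Proof.
move=> Id; have pi0 := phi_integrable Id.
have mh1 i : measurable_fun [set: R2] (fun a => hcomp T (c1 a) I i a).
  by apply: continuous_measurable_plane; exact: continuous_hcomp.
have mh2 i : measurable_fun [set: R2] (fun a => hcomp T (c2 a) I i a).
  by apply: continuous_measurable_plane; exact: continuous_hcomp.
have me2 : measurable_fun [set: R2] (fun a => enorm a ^+ 2 : R).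
  exact: measurable_funX (measurable_enorm (R := R)).
have mt i : measurable_fun [set: R2] (fun a => transverse j a i).
  apply: measurable_funB; apply: measurable_funM; [exact: me2|exact: measurable_cst| |];
  exact: measurable_coordinate.
rewrite (_ : gj T lam mu I j = (fun a => 2 * (enorm a ^+ 2)^-1 *
   (coordinate j a * D2 T mu I a * (coordinate 0 a * hcomp T (c1 a) I 0 a + coordinate 1 a * hcomp T (c1 a) I 1 a) +
    D1 T lam mu I a * (transverse j a 0 * hcomp T (c2 a) I 0 a + transverse j a 1 * hcomp T (c2 a) I 1 a)))); last first.
  by apply/funext => a; rewrite /gj (h0E _ Id) (hjE _ _ Id).
apply: measurable_funM.
  apply: measurable_funM; first exact: measurable_cst.
  by apply: measurable_inv_ge0 => // a; exact: sqr_ge0.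
have mD1 : measurable_fun [set: R2] (D1 T lam mu I).
  by apply: continuous_measurable_plane; exact: (continuous_sine_pairing pi0 cont_c1).
have mD2 : measurable_fun [set: R2] (D2 T mu I).
  by apply: continuous_measurable_plane; exact: (continuous_sine_pairing pi0 cont_c2).
have mc i := measurable_coordinate i.
apply: measurable_funD; apply: measurable_funM.
- by apply: measurable_funM.
- by apply: measurable_funD; apply: measurable_funM.
- by [].
- by apply: measurable_funD; apply: measurable_funM.
Qed.

Lemma measurable_multiplier I j del : is_data T I -> 0 < del ->
  measurable_fun [set: R2] (multiplier del I j).
Proof.
move=> Id d0; have mD := measurable_DI Id; apply: measurable_funM.
  by apply: measurable_funM; first exact: measurable_gj.
apply: measurable_inv_ge0 => [a|]; first by rewrite addr_ge0 ?sqr_ge0 ?ltW.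
by apply: measurable_funD; [exact: measurable_cst|exact: measurable_funX].
Qed.

End reconstruction.

(** * Symmetry and area of discs, and the essential supremum *)

Section plane_geometry.
Context {R : realType}.
Local Notation R2 := (measurableTypeR R * measurableTypeR R)%type.
Local Notation leb := (@lebesgue_measure R).

(** Written with [0 - _] so that each coordinate is the reflection [t |-> T - t] at [T = 0], whose
    invariance is known. *)
Definition negp (a : R2) : R2 := (0 - a.1, 0 - a.2).

Lemma measurable_negp : measurable_fun setT negp.
Proof.
apply/measurable_fun_pairP; split.
  exact: (measurableT_comp (measurable_reflect 0) measurable_fst).
exact: (measurableT_comp (measurable_reflect 0) measurable_snd).
Qed.

Lemma leb2_negp (A : set R2) : measurable A -> pushforward leb2 negp A = leb2 A.
Proof.
move=> mA; apply/esym.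
pose m := measure_function_pushforward__canonical__measure_function_Measure (@leb2 R) measurable_negp.
apply: (@product_measure_unique _ _ _ _ R leb leb m) => //.
move=> B C mB mC; have -> : m (B `*` C) = leb2 (negp @^-1` (B `*` C)) by [].
have mp (D : set (measurableTypeR R)) : measurable D -> measurable ((fun x : measurableTypeR R => 0 - x : measurableTypeR R) @^-1` D).
  by move=> mD; rewrite -[_ @^-1` _]setTI; exact: measurable_reflect.
have -> : negp @^-1` (B `*` C) = ((fun x : measurableTypeR R => 0 - x : measurableTypeR R) @^-1` B) `*`
    ((fun x : measurableTypeR R => 0 - x : measurableTypeR R) @^-1` C) by [].
rewrite leb2X; [|exact: mp|exact: mp].
by congr (_ * _)%E; exact: lebesgue_reflect.
Qed.

Lemma measurable_ball (r : R) : measurable (euclidean_ball r : set R2).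
Proof.
rewrite (_ : euclidean_ball r = setT `&` enorm @^-1` `]-oo, r[%classic).
  by apply: measurable_enorm => //; exact: measurable_itv.
by rewrite setTI; apply/seteqP; split => a; rewrite /= in_itv.
Qed.

(** The bound is the area of the circumscribed square; the exact value with [pi] would not change
    the rate. *)
Lemma ball_area (r : R) : 0 <= r ->
  leb2.-integrable (euclidean_ball r : set R2) (EFin \o cst (1 : R)) /\
  \int[leb2]_(a in euclidean_ball r) (1 : R) <= 4 * r ^+ 2.
Proof.
move=> r0; have mB := measurable_ball r.
pose S : set (measurableTypeR R) := `]- r, r[%classic.
have mS : measurable S by exact: measurable_itv.
have lS : leb1 S = (2 * r)%:E.
  have -> : leb1 S = lebesgue_measure `]- r, r[%classic by [].
  rewrite lebesgue_measure_itv/= lte_fin; case: ifPn => h; first by rewrite -EFinB; congr EFin; ring.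
  have -> : r = 0 by apply/eqP; rewrite eq_le r0 andbT; move: h; rewrite -leNgt; lra.
  by rewrite mulr0.
have sub : euclidean_ball r `<=` S `*` S.
  move=> a ar; have C i := le_lt_trans (coordinate_le_enorm i a) ar.
  by split; rewrite /S /= in_itv/= -ltr_norml; [exact: (C 0)|exact: (C 1)].
have lB : (leb2 (euclidean_ball r) <= (4 * r ^+ 2)%:E)%E.
  have lSS : (leb2 (S `*` S) <= (4 * r ^+ 2)%:E)%E.
    have E : leb2 (S `*` S) = (leb1 S * leb1 S)%E := leb2X mS mS.
    by rewrite E lS -EFinM lee_fin le_eqVlt; apply/orP; left; apply/eqP; ring.
  apply: (le_trans (le_measure leb2 _ _ sub)); [by rewrite inE| |exact: lSS].
  by rewrite inE; exact: measurableX.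
split.
  apply/integrableP; split; first exact/measurable_EFinP/measurable_cst.
  rewrite (_ : integral _ _ _ = leb2 (euclidean_ball r)); first exact: le_lt_trans lB (ltry _).
  rewrite -[RHS]mul1e -integral_cst//; apply: eq_integral => x _ /=.
  by rewrite normr1.
rewrite Rintegral_cst// mul1r -lee_fin fineK//.
by rewrite ge0_fin_numE//; exact: le_lt_trans lB (ltry _).
Qed.

Lemma Lpnorm_oo_le (F : R * R -> R) (b : R) : 0 <= b ->
  {ae leb2, forall x : R2, Omega x -> `|F x| <= b} -> (Lpnorm leb2 Omega +oo%E F <= b%:E)%E.
Proof.
(* The norm of exponent [+oo] is an essential supremum when the whole space has positive measure and
   [0] otherwise. *)
move=> b0 h; rewrite /Lpnorm unlock; case: ifPn => _; last by rewrite lee_fin.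
apply/ess_supP; refine (ae_imp h _) => x /= Fx.
rewrite patchE; case: ifPn => [/set_mem/Fx|_]; first by rewrite lee_fin.
by rewrite normr0 lee_fin.
Qed.

End plane_geometry.

(** * Asymptotics of the cut-off radius and of the regularization parameter *)

Section parameters.
Context {R : realType}.
Variables (T : R).
Hypothesis T0 : 0 < T.
Implicit Types (eps : R).

Let kq : R := q_reg / (9 * expR 1 * T).

Let kq_gt0 : 0 < kq.
Proof. by rewrite divr_gt0 ?mulr_gt0 ?expR_gt0// /q_reg invr_gt0. Qed.

Lemma near_ln_inv_ge M : \forall eps \near (0 : R)^'+, M <= ln eps^-1.
Proof.
near=> eps; have e0 : 0 < eps by near: eps; exact: nbhs_right_gt.
rewrite lnV ?posrE// lerNr -[leRHS]expRK ler_ln ?posrE ?expR_gt0//.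
by near: eps; apply: nbhs_right_le; exact: expR_gt0.
Unshelve. all: by end_near. Qed.

Let R_regE eps : R_reg T eps = kq * (ln eps^-1 / ln (ln eps^-1)).
Proof. by []. Qed.

(** With [y] the iterated logarithm of [1/eps], the quotient of logarithms is [exp y / y], which is
    at least [y / 2]. The threshold [y0] is read off from this. *)
Lemma near_R_reg_ge M : \forall eps \near (0 : R)^'+, M <= R_reg T eps.
Proof.
pose y0 := Num.max 1 (2 * M / kq).
near=> eps; have Ly : expR y0 <= ln eps^-1 by near: eps; exact: near_ln_inv_ge.
rewrite R_regE; set L := ln eps^-1 in Ly *; have L0 : 0 < L := lt_le_trans (expR_gt0 _) Ly.
have yy : y0 <= ln L by rewrite -[y0]expRK ler_ln ?posrE ?expR_gt0.
set y := ln L in yy *.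
have [y1 y2] : 1 <= y /\ 2 * M / kq <= y by split; apply: le_trans yy; rewrite le_max lexx ?orbT.
have yp : 0 < y by exact: lt_le_trans y1.
have LE : y ^+ 2 / 2 <= L.
  have := expR_ge1Dxn 1 (ltW yp); rewrite /y lnK ?posrE// -/y => h.
  by apply: le_trans h; rewrite lerDr.
have h1 : M <= kq * (y / 2) by move: y2; rewrite ler_pdivrMr// => h; lra.
apply: (le_trans h1); rewrite ler_wpM2l ?(ltW kq_gt0)// ler_pdivlMr//.
by apply: le_trans LE; rewrite expr2 mulrAC.
Unshelve. all: by end_near. Qed.

(** Once the iterated logarithm is at least [1], dividing by it can only decrease the value. *)
Lemma near_R_reg_le : \forall eps \near (0 : R)^'+,
  [/\ 1 <= ln eps^-1, 0 <= R_reg T eps & R_reg T eps <= kq * ln eps^-1].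
Proof.
near=> eps; have Ly : expR 1 <= ln eps^-1 by near: eps; exact: near_ln_inv_ge.
rewrite R_regE; set L := ln eps^-1 in Ly *; have L0 : 0 < L := lt_le_trans (expR_gt0 _) Ly.
have y1 : 1 <= ln L by rewrite -[1]expRK ler_ln ?posrE ?expR_gt0.
have yp : 0 < ln L by exact: lt_le_trans y1.
split.
- by apply: le_trans Ly; rewrite -[leLHS]addr0 (le_trans _ (expR_ge1Dx 1))// lerD2l.
- by apply: mulr_ge0; [exact: ltW|apply: divr_ge0; exact: ltW].
- by rewrite ler_wpM2l ?(ltW kq_gt0)// ler_pdivrMr// ler_peMr// ltW.
Unshelve. all: by end_near. Qed.

Lemma delta_reg_gt0 eps : 0 < eps -> 0 < delta_reg eps.
Proof. exact: powR_gt0. Qed.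

(** The exponent is [(1 + 6/7) / 2 = 13/14]. *)
Let delta_exp eps : 0 < eps -> delta_reg eps = expR (- (13 / 14 * ln eps^-1)).
Proof.
move=> e0; rewrite /delta_reg /powR gt_eqF// lnV ?posrE//; congr expR.
by rewrite /q_reg; field.
Qed.

Lemma near_delta_reg_le (eta : R) : 0 < eta -> \forall eps \near (0 : R)^'+, delta_reg eps <= eta.
Proof.
move=> eta0; near=> eps; have e0 : 0 < eps by near: eps; exact: nbhs_right_gt.
have h : - (14 / 13 * ln eta) <= ln eps^-1 by near: eps; exact: near_ln_inv_ge.
rewrite delta_exp// -[leRHS]lnK ?posrE// ler_expR; lra.
Unshelve. all: by end_near. Qed.

(** With [L = ln (1/eps)] the quotient is [exp (- L / 14)]. The fourth power of [L] is chosen to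
    exceed by one the cubic growth of the factors in the radius; it comes from [x^4 / 4! <= exp x]
    at [x = L / 14]. *)
Lemma noise_rate eps : 0 < eps -> 0 < ln eps^-1 ->
  eps / delta_reg eps <= 4`!%:R * 14 ^+ 4 / ln eps^-1 ^+ 4.
Proof.
move=> e0; rewrite delta_exp// expRN invrK; set L := ln eps^-1 => L0.
have -> : eps = expR (- L) by rewrite /L lnV ?posrE// opprK lnK ?posrE.
rewrite -expRD (_ : - L + _ = - (L / 14)); last by field.
rewrite expRN -[leRHS]invrK lef_pV2 ?posrE ?expR_gt0//; last first.
  by rewrite invr_gt0 divr_gt0 ?exprn_gt0// mulr_gt0 ?exprn_gt0// ltr0n fact_gt0.
have L14 : 0 <= L / 14 by rewrite divr_ge0// ltW.
have := expR_ge1Dxn 3 L14; apply: le_trans.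
rewrite invf_div -[leLHS]add0r lerD// expr_div_n le_eqVlt; apply/orP; left; apply/eqP.
by rewrite invfM [(_ `!%:R)^-1 * _]mulrC mulrA.
Qed.

(** One factor [R] comes from the linear growth of the multiplier and [R^2] from the area of the
    disc. All together the product is at most [B / L] with [L = ln (1/eps)]. *)
Lemma cvg_noise (A : R) : 0 <= A ->
  A * (1 + R_reg T eps) * (4 * R_reg T eps ^+ 2) * (eps / delta_reg eps) @[eps --> (0 : R)^'+] --> (0 : R).
Proof.
move=> A0; pose B := A * (4 * kq ^+ 2 * (1 + kq)) * (4`!%:R * 14 ^+ 4).
have k0 := ltW kq_gt0.
have B0 : 0 <= B.
  apply: mulr_ge0; last by rewrite mulr_ge0 ?exprn_ge0.
  by apply: mulr_ge0 => //; apply: mulr_ge0; [rewrite mulr_ge0 ?exprn_ge0|rewrite addr_ge0].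
apply/cvgrPdist_le => /= eta eta0; near=> eps.
have e0 : 0 < eps by near: eps; exact: nbhs_right_gt.
have [L1 R0 RL] : [/\ 1 <= ln eps^-1, 0 <= R_reg T eps & R_reg T eps <= kq * ln eps^-1].
  by near: eps; exact: near_R_reg_le.
have LB : B / eta <= ln eps^-1 by near: eps; exact: near_ln_inv_ge.
have L0 : 0 < ln eps^-1 := lt_le_trans ltr01 L1.
have rt := noise_rate e0 L0; have d0 := delta_reg_gt0 e0.
have rt0 : 0 <= eps / delta_reg eps by rewrite divr_ge0 ?ltW.
move: (ln eps^-1) L1 L0 RL LB rt => L L1 L0 RL LB rt.
move: (R_reg T eps) R0 RL => r R0 RL; move: (eps / delta_reg eps) rt rt0 => w rt rt0.
have h0 : 0 <= A * (1 + r) * (4 * r ^+ 2) * w.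
  by rewrite !mulr_ge0 ?addr_ge0 ?sqr_ge0.
rewrite sub0r normrN ger0_norm//.
have h1 : 1 + r <= (1 + kq) * L by rewrite mulrDl mul1r lerD.
have h2 : r ^+ 2 <= kq ^+ 2 * L ^+ 2 by rewrite -exprMn lerXn2r ?nnegrE// mulr_ge0// ltW.
apply: (@le_trans _ _ (A * ((1 + kq) * L) * (4 * (kq ^+ 2 * L ^+ 2)) * (4`!%:R * 14 ^+ 4 / L ^+ 4))).
  apply: ler_pM => //; first by rewrite !mulr_ge0 ?addr_ge0 ?sqr_ge0.
  apply: ler_pM; [by rewrite mulr_ge0// addr_ge0|by rewrite mulr_ge0 ?sqr_ge0| |].
    by rewrite ler_wpM2l.
  by rewrite ler_wpM2l.
have -> : A * ((1 + kq) * L) * (4 * (kq ^+ 2 * L ^+ 2)) * (4`!%:R * 14 ^+ 4 / L ^+ 4) = B / L.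
  by rewrite /B; move: (4`!%:R * 14 ^+ 4 : R) => z; field; rewrite gt_eqF.
by rewrite ler_pdivrMr// mulrC -ler_pdivrMr.
Unshelve. all: by end_near. Qed.

End parameters.

(** * The regularized solution: reality, continuity and convergence *)

Section regularized_solution.
Context {R : realType}.
Local Notation R2 := (measurableTypeR R * measurableTypeR R)%type.
Local Notation leb := (@lebesgue_measure R).
Variables (T lam mu : R).
Hypotheses (T0 : 0 < T) (mu0 : 0 < mu) (lm0 : 0 < lam + 2 * mu).
Implicit Types (I J : data R) (a xi : R * R) (j : 'I_2) (eps del r : R).

Local Notation mult := (multiplier T lam mu).

Lemma f_regE eps I j xi :
  complex.Re (f_reg T lam mu eps I j xi) = (4 * pi ^+ 2)^-1 *
    \int[leb2]_(a in euclidean_ball (R_reg T eps)) (mult (delta_reg eps) I j a * cos (pdot xi a)) /\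
  complex.Im (f_reg T lam mu eps I j xi) = (4 * pi ^+ 2)^-1 *
    \int[leb2]_(a in euclidean_ball (R_reg T eps)) (mult (delta_reg eps) I j a * sin (pdot xi a)).
Proof.
split; rewrite /f_reg /Cintegral /=.
- rewrite mul0r subr0; congr (_ * _); apply: eq_Rintegral => a _.
  by rewrite /= mul0r subr0.
- rewrite mul0r addr0; congr (_ * _); apply: eq_Rintegral => a _.
  by rewrite /= mul0r addr0.
Qed.

Lemma measurable_sin_pdot xi : measurable_fun [set: R2] (fun a => sin (pdot xi a)).
Proof.
have : measurable_fun [set: R2] (trig xi 0 1).
  exact: continuous_measurable_plane (@trig_continuous R xi 0 1).
by apply: eq_measurable_fun => a _; rewrite /trig mul0r add0r mul1r.
Qed.

Lemma multiplier_integrable I j del r : is_data T I -> 0 < del ->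
  leb2.-integrable (euclidean_ball r : set R2) (EFin \o mult del I j).
Proof.
move=> Id d0; have mB := measurable_ball (R := R) r.
have [r0|r0] := ltP r 0.
  rewrite (_ : euclidean_ball r = set0); first exact: integrable_set0.
  rewrite -subset0 => a /= ar.
  by have := lt_trans (le_lt_trans (enorm_ge0 a) ar) r0; rewrite ltxx.
have [K K0 HK] := multiplier_le lam mu Id d0.
have mm : measurable_fun (euclidean_ball r : set R2) (mult del I j).
  by apply: measurable_funTS; exact: measurable_multiplier.
have := @integrable_mul_bounded _ _ _ leb2 (euclidean_ball r) (cst 1) (mult del I j) (K * (1 + r))
  mB (ball_area r0).1 mm.
move=> h; apply: (eq_integrable mB) (h _) => [a _|a ar] /=; first by rewrite mul1r.
rewrite (le_trans (HK j a))// ler_wpM2l// lerD2l; exact: ltW.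
Qed.

Let negp_enorm a : enorm (negp a) = enorm a.
Proof. by rewrite /enorm /negp /= !sub0r !sqrrN. Qed.

Let pdot_negp a x : pdot (negp a) x = - pdot a x.
Proof. by rewrite /pdot /negp /= !sub0r !mulNr opprD. Qed.

Let coordinate_negp i a : coordinate i (negp a) = - coordinate i a.
Proof. by rewrite /coordinate /negp; case: ifP => _; rewrite /= sub0r. Qed.

Let hcomp_negp c I i a : hcomp T c I i (negp a) = hcomp T c I i a.
Proof.
have E (w : R * R -> R) : cos_coef w (negp a) = cos_coef w a.
  by apply: eq_Rintegral => x _; rewrite pdot_negp cosN.
rewrite /hcomp !E; congr (_ - _).
by apply: eq_Rintegral => t _; apply: eq_Rintegral => x _; rewrite pdot_negp cosN.
Qed.

(** The scalar functionals depend on [a] through cosines and [|a|]. The coordinates change sign in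
    pairs: twice in the longitudinal term and twice inside [transverse]. *)
Lemma multiplier_even I j del a : is_data T I -> mult del I j (negp a) = mult del I j a.
Proof.
move=> Id; have DE : DI T lam mu I (negp a) = DI T lam mu I a.
  by rewrite /DI /D1 /D2 negp_enorm.
have TE i : transverse j (negp a) i = transverse j a i.
  by rewrite /transverse negp_enorm !coordinate_negp mulrNN.
have GE : gj T lam mu I j (negp a) = gj T lam mu I j a.
  rewrite /gj (h0E lam mu _ Id) (hjE mu _ _ Id) (h0E lam mu a Id) (hjE mu j a Id).
  rewrite !TE !negp_enorm !hcomp_negp !coordinate_negp /D1 /D2 !negp_enorm.
  have alg (k p q q' x y : R) : - k * p * (- q * x + - q' * y) = k * p * (q * x + q' * y) by ring.
  congr (_ * (_ + _)); exact: alg.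
by rewrite /multiplier GE DE.
Qed.

(** An even multiplier against a sine, over a disc symmetric about the origin, has an integral equal
    to its own opposite. *)
Lemma f_reg_real eps I j xi : is_data T I -> 0 < eps ->
  complex.Im (f_reg T lam mu eps I j xi) = 0.
Proof.
move=> Id e0; rewrite (f_regE eps I j xi).2.
set B := euclidean_ball _; set f := fun a => _.
have mB : measurable (B : set R2) := measurable_ball _.
have fi : leb2.-integrable (B : set R2) (EFin \o f).
  apply: (@integrable_mul_bounded _ _ _ leb2 B _ _ 1 mB).
  - exact: multiplier_integrable Id (delta_reg_gt0 e0).
  - exact: measurable_funTS (measurable_sin_pdot xi).
  - by move=> a _; exact: sin_max.
have [E _] := Rintegral_preserving (@measurable_negp R) (@leb2_negp R) mB fi.
have preB : @negp R @^-1` B = B.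
  by apply/seteqP; split => a; rewrite /B /euclidean_ball /= negp_enorm.
rewrite preB in E; have {}E : \int[leb2]_(a in B) f a = - \int[leb2]_(a in B) f a.
  rewrite -{1}E -mulN1r -RintegralZl; [|exact: mB|exact: fi].
  apply: eq_Rintegral => a _; rewrite /f multiplier_even// pdotC pdot_negp pdotC sinN.
  by rewrite mulN1r mulrN.
have -> : \int[leb2]_(a in B) f a = 0 by lra.
by rewrite mulr0.
Qed.

Lemma f_reg_continuous eps I j : is_data T I -> 0 < eps ->
  continuous (fun xi => complex.Re (f_reg T lam mu eps I j xi)).
Proof.
move=> Id e0 xi0.
have -> : (fun xi => complex.Re (f_reg T lam mu eps I j xi)) = (fun xi => (4 * pi ^+ 2)^-1 *
    \int[leb2]_(a in euclidean_ball (R_reg T eps)) (mult (delta_reg eps) I j a * cos (pdot xi a))).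
  by apply/funext => xi; rewrite (f_regE eps I j xi).1.
apply: cvgMr; set r := R_reg T eps.
apply: (@Rintegral_mul_cvg _ _ _ leb2 (euclidean_ball r) (mult (delta_reg eps) I j) _ _
  (fun xi a => cos (pdot xi a)) (fun a => cos (pdot xi0 a))
  (fun xi : R * R => `|xi.1 - xi0.1| * r + `|xi.2 - xi0.2| * r)).
- exact: measurable_ball.
- exact: multiplier_integrable Id (delta_reg_gt0 e0).
- by move=> xi; exact: measurable_funTS (measurable_cos_pdot xi).
- exact: measurable_funTS (measurable_cos_pdot xi0).
- by exists 1 => a _; exact: cos_max.
- move=> xi a ar; rewrite (le_trans (cos_lipschitz _ _))//.
  have C i : `|coordinate i a| <= r by exact: ltW (le_lt_trans (coordinate_le_enorm i a) ar).
  rewrite /pdot opprD addrACA -!mulrBl (le_trans (ler_normD _ _))// !normrM lerD// ler_wpM2l//.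
    exact: (C 0).
  exact: (C 1).
- rewrite -(addr0 0); apply: cvgD; rewrite -(mul0r r); apply: cvgMl.
  + rewrite -[X in _ --> X](normr0 R) -(subrr xi0.1); apply: cvg_norm.
    by apply: cvgB; [exact: cvg_fst|exact: cvg_cst].
  + rewrite -[X in _ --> X](normr0 R) -(subrr xi0.2); apply: cvg_norm.
    by apply: cvgB; [exact: cvg_snd|exact: cvg_cst].
Qed.

Section convergence.
Variables (J : data R) (u : 'I_2 -> R -> R * R -> R) (f : 'I_2 -> R * R -> R) (j : 'I_2).
Hypotheses (Jd : is_data T J) (sol : inverse_solution T lam mu J u f)
  (reg : forall j, Ck_L2 T 2 (u j) /\ L2_H2 T (u j)) (fL2 : forall j, L2Omega (f j))
  (phi_neq0 : ~ {ae leb1, forall t, `]0, T[%classic t -> phi J t = 0})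
  (Ci : leb2.-integrable [set: R2] (EFin \o cos_coef (f j))).

(** Both factors are values of a single sine transform, that of the time-reversed [phi], at two
    positive multiples of [|a|]; its zeros are countable, so the bad frequencies lie on countably
    many circles. *)
Lemma DI_ae_neq0 : {ae leb2, forall a : R2, DI T lam mu J a != 0}.
Proof.
have pi0 := phi_integrable Jd; have [_ ri] := Rintegral_reflect pi0.
have nz : ~ {ae leb, forall t, `]0, T[%classic t -> phi J (T - t) = 0}.
  (* If the reversed function vanished almost everywhere, reflecting the null set would make [phi J]
     vanish almost everywhere. *)
  move=> [N [mN N0 sN]]; apply: phi_neq0.
  exists ((fun x : measurableTypeR R => T - x : measurableTypeR R) @^-1` N); split.
  - by rewrite -[_ @^-1` _]setTI; exact: measurable_reflect.
  - exact: etrans (lebesgue_reflect T mN) N0.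
  move=> t /= h; apply: sN => h2; apply: h => tT.
  have -> : t = T - (T - t) by rewrite subKr.
  by apply: h2; move: tT; rewrite /= !in_itv/= => /andP[? ?]; apply/andP; split; lra.
have cz := countable_sine_zeros T0 ri nz.
have s1 : 0 < Num.sqrt (lam + 2 * mu) by rewrite sqrtr_gt0.
have s2 : 0 < Num.sqrt mu by rewrite sqrtr_gt0.
refine (ae_imp (ae_and (enorm_avoids_countable s1 cz) (enorm_avoids_countable s2 cz)) _).
by move=> a [/= z1 z2]; rewrite /DI mulf_neq0//; apply/eqP.
Qed.

(** For exact data the truncated multiplier equals [2 C_j] times this factor, which lies in [[0, 1]]
    and tends to [1] wherever [DI] is nonzero. *)
Let damp del r a : R := \1_(euclidean_ball r) a * (DI T lam mu J a ^+ 2 / (del + DI T lam mu J a ^+ 2)).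

Let damp01 del r a : 0 < del -> 0 <= damp del r a <= 1.
Proof.
move=> d0; have p : 0 < del + DI T lam mu J a ^+ 2 by rewrite ltr_pwDl ?sqr_ge0.
rewrite /damp indicE; case: (a \in _); last by rewrite mul0r lexx ler01.
rewrite mul1r divr_ge0 ?sqr_ge0 ?(ltW p)//= ler_pdivrMr// mul1r lerDr ltW//.
Qed.

Let mdamp del r : 0 < del -> measurable_fun [set: R2] (damp del r).
Proof.
move=> d0; have mD := measurable_DI lam mu Jd.
apply: measurable_funM; first exact: measurable_indic (measurable_ball r).
apply: measurable_funM; first exact: measurable_funX.
apply: measurable_inv_ge0 => [a|]; first by rewrite addr_ge0 ?sqr_ge0 ?ltW.
by apply: measurable_funD; [exact: measurable_cst|exact: measurable_funX].
Qed.

Let truncation_error del r : R :=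
  \int[leb2]_a `|cos_coef (f j) a * (2 * (damp del r a - 1))|.

Let mC : measurable_fun [set: R2] (cos_coef (f j)).
Proof. by apply/measurable_EFinP; exact: measurable_int Ci. Qed.

Let cvg_truncation : truncation_error (delta_reg eps) (R_reg T eps) @[eps --> (0 : R)^'+] --> (0 : R).
Proof.
(* Dominated convergence is sequential, so the limit is tested along sequences of positive numbers
   tending to zero. *)
apply/cvg_at_rightP => v [v0 vc].
have vr : v @ \oo --> (0 : R)^'+.
  move=> P P0; have H0 : \forall x \near (0 : R), 0 < x -> P x := P0.
  have H1 : \forall n \near \oo, 0 < v n -> P (v n) := vc _ H0.
  have H2 : \forall n \near \oo, P (v n) by apply: filterS H1 => n h; exact: (h (v0 n)).
  exact: H2.
have d0 n : 0 < delta_reg (v n) by exact: delta_reg_gt0.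
rewrite (_ : 0 = \int[leb2]_(a in [set: R2]) 0); last by rewrite Rintegral_cst// mul0r.
apply: (@Rintegral_dominated_cvg _ _ _ leb2 setT _ _ (fun a => 2 * `|cos_coef (f j) a|)) => //.
- move=> n; apply: measurableT_comp => //; apply: measurable_funM => //.
  apply: measurable_funM; first exact: measurable_cst.
  by apply: measurable_funB; [exact: mdamp|exact: measurable_cst].
- refine (ae_imp DI_ae_neq0 _) => a Da _.
  have c : damp (delta_reg (v n)) (R_reg T (v n)) a @[n --> \oo] --> (1 : R).
    set x := DI T lam mu J a in Da *; have x2 : 0 < x ^+ 2 by rewrite lt0r sqr_ge0 expf_neq0.
    apply/cvgrPdist_le => /= eta eta0; near=> n.
    have an : enorm a + 1 <= R_reg T (v n) by near: n; exact: vr (near_R_reg_ge T0 _).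
    (* Inside the disc [1 - damp] is [delta / (delta + x^2)], which is at most [eta] when
       [delta <= eta x^2]. *)
    have dn : delta_reg (v n) <= eta * x ^+ 2.
      by near: n; apply: (vr _ (near_delta_reg_le _)); exact: mulr_gt0.
    have p : 0 < delta_reg (v n) + x ^+ 2 by rewrite ltr_pwDl ?ltW.
    rewrite /damp -/x indicE mem_set; last by rewrite /euclidean_ball /= (lt_le_trans _ an)// ltrDl.
    rewrite mul1r (_ : 1 - _ = delta_reg (v n) / (delta_reg (v n) + x ^+ 2)); last by field; rewrite gt_eqF.
    rewrite ger0_norm ?divr_ge0 ?(ltW p) ?(ltW (d0 n))// ler_pdivrMr// (le_trans dn)// ler_wpM2l ?(ltW eta0)//.
    by rewrite lerDr ltW.
  have Z : 0 = `|cos_coef (f j) a * (2 * (1 - 1))| :> R by rewrite subrr !mulr0 normr0.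
  rewrite [X in _ --> X]Z.
  by apply: cvg_norm; apply: cvgMr; apply: cvgMr; apply: cvgB; [exact: c|exact: cvg_cst].
- have := integrableZl measurableT 2 (integrable_norm Ci).
  by apply: (eq_integrable measurableT).
- move=> n a _; rewrite normr_id normrM [leRHS]mulrC; apply: ler_wpM2l => //.
  have /andP[h1 h2] := damp01 (R_reg T (v n)) a (d0 n).
  by rewrite ler_norml; apply/andP; split; lra.
Unshelve. all: by end_near. Qed.

(** The exact multiplier is inserted between the two terms: replacing the data costs the first
    summand, and truncating and damping the exact coefficients costs the second. Cosines are bounded
    by [1], so nothing depends on [xi] and the estimate is uniform in space. *)
Lemma reconstruction_error I del r N xi : is_data T I -> 0 < del -> 0 <= r -> 0 <= N ->
  (forall a, `|mult del I j a - mult del J j a| <= N * (1 + enorm a)) ->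
  `|\int[leb2]_(a in euclidean_ball r) (mult del I j a * cos (pdot xi a)) -
    2 * cos_transform (cos_coef (f j)) xi| <= N * (1 + r) * (4 * r ^+ 2) + truncation_error del r.
Proof.
move=> Id d0 r0 N0 HN; have mB : measurable (euclidean_ball r : set R2) := measurable_ball r.
have mcos := measurable_cos_pdot xi.
have im K : is_data T K -> leb2.-integrable (euclidean_ball r : set R2) (EFin \o (fun a => mult del K j a * cos (pdot xi a))).
  move=> Kd; apply: (@integrable_mul_bounded _ _ _ leb2 (euclidean_ball r) _ _ 1 mB).
  - exact: multiplier_integrable.
  - exact: measurable_funTS mcos.
  - by move=> a _; exact: cos_max.
have ic : leb2.-integrable [set: R2] (EFin \o (fun a => cos_coef (f j) a * cos (pdot xi a))).
  apply: (@integrable_mul_bounded _ _ _ leb2 setT _ _ 1 measurableT Ci) => // a _; exact: cos_max.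
have ie : leb2.-integrable [set: R2] (EFin \o (fun a => cos_coef (f j) a * (2 * (damp del r a - 1)))).
  apply: (@integrable_mul_bounded _ _ _ leb2 setT _ _ 2 measurableT Ci).
    apply: measurable_funM; first exact: measurable_cst.
    by apply: measurable_funB; [exact: mdamp|exact: measurable_cst].
  move=> a _; have /andP[h1 h2] := damp01 r a d0.
  by rewrite ler_norml; apply/andP; split; lra.
have iec : leb2.-integrable [set: R2]
    (EFin \o (fun a => cos_coef (f j) a * (2 * (damp del r a - 1)) * cos (pdot xi a))).
  by apply: (@integrable_mul_bounded _ _ _ leb2 setT _ _ 1 measurableT ie) => // a _; exact: cos_max.
have S1 : `|\int[leb2]_(a in euclidean_ball r) (mult del I j a * cos (pdot xi a)) -
   \int[leb2]_(a in euclidean_ball r) (mult del J j a * cos (pdot xi a))| <= N * (1 + r) * (4 * r ^+ 2).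
  rewrite -RintegralB; [|exact: mB|exact: im|exact: im].
  have [i1 a1] := ball_area r0.
  rewrite (_ : \int[leb2]_(x in euclidean_ball r) _ = \int[leb2]_(a in euclidean_ball r)
     (cst 1 a * ((mult del I j a - mult del J j a) * cos (pdot xi a)))); last first.
    by apply: eq_Rintegral => a _; rewrite mul1r mulrBl.
  apply: (@le_trans _ _ (N * (1 + r) * \int[leb2]_(a in euclidean_ball r) `|(cst 1 a : R)|)).
    apply: (Rintegral_mul_le mB i1).
      apply: measurable_funTS; apply: measurable_funM => //.
      by apply: measurable_funB; exact: measurable_multiplier.
    move=> a ar; rewrite normrM -[leRHS]mulr1 ler_pM ?cos_max//.
    by rewrite (le_trans (HN a))// ler_wpM2l// lerD2l; exact: ltW.
  rewrite ler_wpM2l ?mulr_ge0 ?addr_ge0//; apply: le_trans a1.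
  rewrite le_eqVlt; apply/orP; left; apply/eqP; apply: eq_Rintegral => a _.
  exact: normr1.
have S2 : `|\int[leb2]_(a in euclidean_ball r) (mult del J j a * cos (pdot xi a)) -
    2 * cos_transform (cos_coef (f j)) xi| <= truncation_error del r.
  have mi0 : measurable_fun [set: R2] (\1_(euclidean_ball r) : R2 -> R) := measurable_indic mB.
  have E : \int[leb2]_(a in euclidean_ball r) (mult del J j a * cos (pdot xi a)) =
      \int[leb2]_a (cos_coef (f j) a * (2 * damp del r a) * cos (pdot xi a)).
    rewrite -(setTI (euclidean_ball r)) Rintegral_mkcondr; apply: ae_eq_Rintegral => //.
    - apply/(measurable_restrictT _ mB); apply: measurable_funTS.
      by apply: measurable_funM => //; exact: measurable_multiplier.
    - apply: measurable_funM => //; apply: measurable_funM => //.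
      by apply: measurable_funM; [exact: measurable_cst|exact: mdamp].
    (* The identity for [gj] requires a nonzero frequency; the origin is the circle of radius zero,
       a null set. *)
    refine (ae_imp (circle_null 0) _) => a an0 _; rewrite patchE /damp indicE.
    case: (a \in _); last by rewrite mul0r !mulr0 mul0r.
    congr (_ * _); rewrite /multiplier (gj_exact T0 mu0 lm0 j Jd sol reg fL2 an0) mul1r.
    have alg (d C q : R) : 2 * d * C * d * q = C * (2 * (d ^+ 2 * q)) by ring.
    exact: alg.
  rewrite E /cos_transform -RintegralZl; [|exact: measurableT|exact: ic].
  have iA : leb2.-integrable [set: R2] (EFin \o (fun a => cos_coef (f j) a * (2 * damp del r a) * cos (pdot xi a))).
    apply: (@integrable_mul_bounded _ _ _ leb2 setT _ _ 1 measurableT _ mcos) => [|a _]; last exact: cos_max.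
    apply: (@integrable_mul_bounded _ _ _ leb2 setT _ _ 2 measurableT Ci).
      by apply: measurable_funM; [exact: measurable_cst|exact: mdamp].
    move=> a _; have /andP[h1 h2] := damp01 r a d0.
    by rewrite ler_norml; apply/andP; split; lra.
  have iB : leb2.-integrable [set: R2] (EFin \o (fun a => 2 * (cos_coef (f j) a * cos (pdot xi a)))).
    by have := integrableZl measurableT 2 ic; apply: (eq_integrable measurableT).
  rewrite -RintegralB; [|exact: measurableT|exact: iA|exact: iB].
  rewrite (_ : \int[leb2]_x _ = \int[leb2]_a (cos_coef (f j) a * (2 * (damp del r a - 1)) * cos (pdot xi a))); last first.
    apply: eq_Rintegral => a _.
    have alg (C d k : R) : C * (2 * d) * k - 2 * (C * k) = C * (2 * (d - 1)) * k by ring.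
    exact: alg.
  rewrite /truncation_error -[leRHS]mul1r.
  by apply: (Rintegral_mul_le measurableT ie) => // a _; exact: cos_max.
have tri (x y z : R) p q : `|x - y| <= p -> `|y - z| <= q -> `|x - z| <= p + q.
  move=> h1 h2; have -> : x - z = (x - y) + (y - z) by ring.
  by rewrite (le_trans (ler_normD _ _))// lerD.
exact: tri S1 S2.
Qed.

Lemma f_reg_cvg (I : R -> data R) e1 : 0 < e1 ->
  (forall eps, 0 < eps -> eps < e1 -> is_data T (I eps)) ->
  (forall eps, 0 < eps -> eps < e1 -> data_close T eps (I eps) J) ->
  Lpnorm leb2 Omega +oo%E (fun xi => complex.Re (f_reg T lam mu eps (I eps) j xi) - f j xi)
    @[eps --> 0^'+] --> 0%E.
Proof.
move=> e10 Id IJ; have [N N0 HN] := multiplierB lam mu Jd.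
have inv := cos_inversion (L2Omega_integrable (fL2 j)) Ci.
pose E eps := (4 * pi ^+ 2)^-1 * (N * (1 + R_reg T eps) * (4 * R_reg T eps ^+ 2) * (eps / delta_reg eps) +
   truncation_error (delta_reg eps) (R_reg T eps)).
have E0 : E eps @[eps --> (0 : R)^'+] --> (0 : R).
  rewrite -[X in _ --> X](mulr0 (4 * pi ^+ 2)^-1); apply: cvgMr.
  rewrite -[X in _ --> X](addr0 0).
  by apply: cvgD; [exact: cvg_noise|exact: cvg_truncation].
apply: (@squeeze_cvge _ _ _ _ (cst 0%E) _ (EFin \o E)); last 2 first.
- exact: cvg_cst.
- by apply/fine_cvgP; split; [exact: nearW|exact: E0].
near=> eps.
have e0 : 0 < eps by near: eps; exact: nbhs_right_gt.
have e01 : eps < e1 by near: eps; exact: nbhs_right_lt.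
have eps1 : eps <= 1 by near: eps; apply: nbhs_right_le.
have r0 : 0 <= R_reg T eps by near: eps; exact: near_R_reg_ge.
have d0 := delta_reg_gt0 e0.
have Ie := Id _ e0 e01; have IJe := IJ _ e0 e01.
have w0 : 0 <= eps / delta_reg eps by rewrite divr_ge0 ?ltW.
have p0 : 0 < 4 * pi ^+ 2 :> R by rewrite mulr_gt0// exprn_gt0// pi_gt0.
have e01' : 0 <= eps <= 1 by rewrite eps1 ltW.
have pt xi : `|\int[leb2]_(a in euclidean_ball (R_reg T eps)) (mult (delta_reg eps) (I eps) j a * cos (pdot xi a)) -
    2 * cos_transform (cos_coef (f j)) xi| <=
   N * (1 + R_reg T eps) * (4 * R_reg T eps ^+ 2) * (eps / delta_reg eps) +
   truncation_error (delta_reg eps) (R_reg T eps).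
  have -> : N * (1 + R_reg T eps) * (4 * R_reg T eps ^+ 2) * (eps / delta_reg eps) =
    N * (eps / delta_reg eps) * (1 + R_reg T eps) * (4 * R_reg T eps ^+ 2) by ring.
  apply: reconstruction_error => //; first exact: mulr_ge0.
  by move=> a; have := HN _ _ _ Ie e01' d0 IJe j a; rewrite mulrAC.
apply/andP; split; first exact: Lnorm_ge0.
apply: Lpnorm_oo_le.
  rewrite /E mulr_ge0 ?invr_ge0 ?(ltW p0)//.
  exact: le_trans (normr_ge0 _) (pt (0, 0)).
refine (ae_imp inv _) => xi h Oxi; rewrite (h Oxi) (f_regE eps (I eps) j xi).1.
(* The factor [2] of [gj] reconciles the constant of the cosine inversion with that of the
   regularized solution. *)
have -> : (2 * pi ^+ 2)^-1 * cos_transform (cos_coef (f j)) xi =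
   (4 * pi ^+ 2)^-1 * (2 * cos_transform (cos_coef (f j)) xi).
  have alg (p x : R) : p != 0 -> (2 * p ^+ 2)^-1 * x = (4 * p ^+ 2)^-1 * (2 * x).
    by move=> pn0; field.
  by apply: alg; rewrite gt_eqF// pi_gt0.
by rewrite -mulrBr normrM gtr0_norm ?invr_gt0// /E ler_wpM2l ?invr_ge0 ?(ltW p0).
Unshelve. all: by end_near. Qed.

End convergence.

End regularized_solution.

Unset Implicit Arguments.

Theorem theorem3 (R : realType) (T lam mu : R)
    (T_gt0 : 0 < T) (mu_gt0 : 0 < mu) (lam2mu_gt0 : 0 < lam + 2 * mu)
    (Iex : data R) (uex : 'I_2 -> R -> R * R -> R) (fex : 'I_2 -> R * R -> R)
    (Iex_data : is_data T Iex)
    (exact_sol : inverse_solution T lam mu Iex uex fex)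
    (uex_reg : forall j, Ck_L2 T 2 (uex j) /\ L2_H2 T (uex j))
    (fex_L2 : forall j, L2Omega (fex j))
    (phiex_neq0 : ~ {ae leb1, forall t, `]0, T[%classic t -> phi Iex t = 0})
    (fex_cos : forall j,
      (\int[leb2]_a
         `|\int[leb2]_(x in Omega) (fex j x * cos (pdot a x))|%R%:E < +oo)%E)
    (I : R -> data R)
    (I_data : forall eps, 0 < eps -> eps < (expR 1)^-1 -> is_data T (I eps))
    (I_close : forall eps, 0 < eps -> eps < (expR 1)^-1 ->
       data_close T eps (I eps) Iex) :
  (forall eps, 0 < eps -> eps < (expR 1)^-1 -> forall j,
     (forall xi, closure Omega xi ->
        complex.Im (f_reg T lam mu eps (I eps) j xi) = 0) /\
     {within closure Omega,
        continuous (fun xi => complex.Re (f_reg T lam mu eps (I eps) j xi))}) /\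
  (forall j,
     Lpnorm leb2 Omega +oo%E
       (fun xi => complex.Re (f_reg T lam mu eps (I eps) j xi) - fex j xi)
       @[eps --> 0^'+] --> 0%E).

Proof.
have e0 : 0 < (expR 1)^-1 :> R by rewrite invr_gt0 expR_gt0.
split=> [eps eps0 eps1 j|j].
  have Ie := I_data _ eps0 eps1; split=> [xi _|]; first exact: f_reg_real.
  by apply: continuous_subspaceT; exact: f_reg_continuous.
apply: (f_reg_cvg T_gt0 mu_gt0 lam2mu_gt0 Iex_data exact_sol uex_reg fex_L2 phiex_neq0 _ e0 I_data I_close).
(* The integrability assumption on the coefficients only bounds an integral; their measurability
   comes from their continuity in the frequency. *)
have mC : measurable_fun setT (cos_coef (fex j)).
  by apply: continuous_measurable_plane; apply: continuous_cos_coef; exact: L2Omega_integrable.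
by apply/integrableP; split; [exact/measurable_EFinP|exact: fex_cos].
Qed.
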